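(* Let $\mathbb M$ be a compact metric space with a probability measure $\mathbb P$, $X_1,X_2,\dots$ i.i.d. from $\mathbb P$, and $h:\mathbb M\times\mathbb M\to\mathbb R$ a symmetric, continuous, positive semi-definite kernel. Let $J\subset\mathbb N$ be a finite index set with $0<\gamma_J\le\theta_{\min}$ (notation as in the context). As $n\to\infty$ (with $J\subset\{1,\dots,n\}$), the sequence of random variables $$\sqrt n\Big(\sum_{k\in J}\sum_{\ell\in J}\langle\hat\varphi_{k,n},[\phi_\ell]_n\rangle_{L^2(\mathbb P_n)}^2-|J|\Big)$$ converges weakly to $\mathscr G_{\mathbb P}\big(\sum_{k\in J}\phi_k^2\big)$.
   Context: $L^2(\mathbb P)$ is the real $L^2$ space with $\langle f,g\rangle_{L^2(\mathbb P)}=\int fg\,d\mathbb P$; $\mathbb Pf=\int f\,d\mathbb P$. $\mathbb P_n$ is the empirical measure of $X_1,\dots,X_n$; $L^2(\mathbb P_n)$ is $\mathbb R^n$ with $\langle u,v\rangle_{L^2(\mathbb P_n)}=\frac1n\sum_iu_iv_i$; $[f]_n=(f(X_i))_{i=1}^n$. The integral operator $\mathbf Hf(x)=\int h(x,y)f(y)\,d\mathbb P(y)$ on $L^2(\mathbb P)$ has eigenpairs $(\lambda_k,\phi_k)_{k\in\mathbb N}$, $\phi_k$ orthonormal in $L^2(\mathbb P)$, $\lambda_1\ge\lambda_2\ge\dots\ge0$ with multiplicity (Mercer; $\phi_k$ continuous when $\lambda_k>0$). The kernel Gram matrix $\hat{\mathbf H}_n=(h(X_i,X_{i'})/n)_{i,i'}$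 has eigenpairs $(\hat\lambda_{k,n},\hat\varphi_{k,n})_{1\le k\le n}$, eigenvalues in non-increasing order with multiplicity, $\hat\varphi_{k,n}$ orthonormal in $L^2(\mathbb P_n)$. $J$ is nonempty, $\gamma_J=\min_{k\in J,\ell\notin J}|\lambda_k-\lambda_\ell|$, $\theta_{\min}=\min_{k\in J}\lambda_k$. $\mathscr G_{\mathbb P}$ is the generalized $\mathbb P$-Brownian bridge: the centered Gaussian process indexed by $L^2(\mathbb P)$ with covariance $\mathrm{Cov}(\mathscr G_{\mathbb P}(f),\mathscr G_{\mathbb P}(g))=\mathbb P(fg)-\mathbb Pf\,\mathbb Pg$. *)

(* Defs.v *)
From HB Require Import structures.
From mathcomp Require Import all_boot all_order all_algebra finmap.
From mathcomp Require Import all_classical all_reals all_analysis.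

Set Implicit Arguments.
Unset Strict Implicit.
Unset Printing Implicit Defensive.

Import Order.TTheory GRing.Theory Num.Theory.
Import numFieldNormedType.Exports.

Local Open Scope classical_set_scope.
Local Open Scope ring_scope.

(* Generated sigma-algebras require a pointed carrier; a space carrying a
   probability measure is nonempty, so pointedness is no restriction. *)
#[short(type="pointedMetricType")]
HB.structure Definition PointedMetric (K : numDomainType) :=
  { M of Metric K M & isPointed M }.

Definition borel (R : realType) (M : pointedMetricType R) :=
  g_sigma_algebraType (@open M).

Section kernel_operator.
Context (R : realType) (M : pointedMetricType R).
Implicit Types (P : probability (borel M) R) (h : M -> M -> R) (f g : M -> R).

Definition in_L2 P f : Prop := (f : borel M -> R) \in Lfun P 2%:E.

Definition L2_inner P f g : R := \int[P]_x (f x * g x).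

Definition psd_kernel h : Prop :=
  forall (m : nat) (x : 'I_m -> M) (c : 'I_m -> R),
    0 <= \sum_(i < m) \sum_(j < m) c i * c j * h (x i) (x j).

Definition kernel_op P h f : M -> R := fun x => \int[P]_y (h x y * f y).

(* Elements of L^2(P) are represented by functions, hence equalities in
   L^2(P) hold P-almost everywhere. *)
Definition eigen_eq P h (mu : R) f : Prop :=
  {ae P, forall x : borel M, kernel_op P h f x = mu * f x}.

(* If L^2(P) has finite dimension, there is no infinite orthonormal sequence
   and (lam_k)_k is padded with zeros; orthonormality is therefore required
   only of the eigenfunctions with positive eigenvalues.  The last field says
   that each nonzero eigenvalue is listed with its multiplicity: its eigenspace
   is spanned by the phi_k attached to it. *)
Record kernel_eigensystem P h (lam : nat -> R) (phi : nat -> M -> R) : Prop := {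
  eigenfun_L2 : forall k, in_L2 P (phi k) ;
  eigenfun_eq : forall k, eigen_eq P h (lam k) (phi k) ;
  eigenval_ge0 : forall k, 0 <= lam k ;
  eigenval_nincr : forall k l, (k <= l)%N -> lam l <= lam k ;
  eigenfun_orthonormal : forall k l, 0 < lam k -> 0 < lam l ->
    L2_inner P (phi k) (phi l) = (k == l)%:R ;
  eigenfun_continuous : forall k, 0 < lam k -> continuous (phi k) ;
  eigenval_multiplicity : forall (mu : R) f, mu != 0 ->
    in_L2 P f -> eigen_eq P h mu f ->
    exists (N : nat) (c : nat -> R),
      {ae P, forall x : borel M,
        f x = \sum_(k < N | lam k == mu) c k * phi k x} }.

End kernel_operator.

Section spectral_gap.
Context (R : realType).
Implicit Types (lam : nat -> R) (J : {fset nat}).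

(* Indices start at 0, so that lam 0 is the largest eigenvalue.  For
   nonempty J and nonincreasing nonnegative lam, both infima are attained. *)
Definition gamma_gap lam J : R :=
  inf [set r | exists k l, [/\ k \in J, l \notin J & r = `|lam k - lam l| ]].

Definition theta_min lam J : R := inf [set lam k | k in [set` J]].

End spectral_gap.

Section empirical.
Context (R : realType) (M : pointedMetricType R).

Definition emp_inner (n : nat) (u v : 'cV[R]_n) : R :=
  n%:R^-1 * \sum_(i < n) u i 0 * v i 0.

Definition sample_vec (n : nat) (x : nat -> M) (f : M -> R) : 'cV[R]_n :=
  \col_(i < n) f (x i).

Definition gram (h : M -> M -> R) (n : nat) (x : nat -> M) : 'M[R]_n :=
  \matrix_(i < n, j < n) (h (x i) (x j) / n%:R).

Record gram_eigensystem (h : M -> M -> R) (n : nat) (x : nat -> M)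
    (lam : 'I_n -> R) (v : 'I_n -> 'cV[R]_n) : Prop := {
  gram_eigen : forall k, gram h n x *m v k = lam k *: v k ;
  gram_eigenval_nincr : forall k l : 'I_n, (k <= l)%N -> lam l <= lam k ;
  gram_orthonormal : forall k l, emp_inner (v k) (v l) = (k == l)%:R }.

(* The sum over k ranges over all of J as soon as J is included in [0, n[. *)
Definition eigenspace_stat (J : {fset nat}) (phi : nat -> M -> R)
    (n : nat) (x : nat -> M) (v : 'I_n -> 'cV[R]_n) : R :=
  Num.sqrt n%:R *
    (\sum_(k < n | (k : nat) \in J) \sum_(l <- J)
        emp_inner (v k) (sample_vec n x (phi l)) ^+ 2
     - #|` J|%:R).

End empirical.

Section probability_notions.
Context (R : realType).

Definition iid_sample d (Omega : measurableType d) (Pr : probability Omega R)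
    d' (T : measurableType d') (P : probability T R)
    (X : nat -> Omega -> T) : Prop :=
  [/\ forall i, measurable_fun setT (X i),
      forall i (A : set T), measurable A -> Pr (X i @^-1` A) = P A
    & forall (s : {fset nat}) (A : nat -> set T),
        (forall i, measurable (A i)) ->
        Pr (\bigcap_(i in [set` s]) (X i @^-1` A i)) =
        (\prod_(i <- s) Pr (X i @^-1` A i))%E ].

(* normal_prob m s is parametrized by the standard deviation s and is a
   Gaussian law only if s != 0; the Gaussian law of variance 0 is Dirac. *)
Definition gaussian_rv d (Omega : measurableType d) (Pr : probability Omega R)
    (Z : Omega -> R) : Prop :=
  measurable_fun setT Z /\
  exists m s : R, 0 <= s /\
    forall A : set R, measurable A ->
      Pr (Z @^-1` A) = if s == 0 then \d_m A else normal_prob m s A.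

(* A process is Gaussian if its finite linear combinations are. *)
Record brownian_bridge (M : pointedMetricType R) (P : probability (borel M) R)
    d (Omega : measurableType d) (Pr : probability Omega R)
    (G : (M -> R) -> Omega -> R) : Prop := {
  bridge_gaussian : forall (m : nat) (f : 'I_m -> M -> R) (c : 'I_m -> R),
    (forall i, in_L2 P (f i)) ->
    gaussian_rv Pr (fun w => \sum_(i < m) c i * G (f i) w) ;
  bridge_centered : forall f, in_L2 P f -> 'E_Pr[G f]%E = 0%E ;
  bridge_cov : forall f g, in_L2 P f -> in_L2 P g ->
    covariance Pr (G f) (G g) =
      (\int[P]_x (f x * g x) - (\int[P]_x f x) * (\int[P]_x g x))%:E }.

(* The variables may live on different probability spaces. *)
Definition weakly_converges d (Omega : measurableType d)
    (Pr : probability Omega R) (T : nat -> Omega -> R)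
    d' (Omega' : measurableType d') (Pr' : probability Omega' R)
    (Z : Omega' -> R) : Prop :=
  forall f : R -> R, continuous f -> bounded_fun f ->
    (fun n => \int[Pr]_w f (T n w)) @ \oo --> \int[Pr']_w f (Z w).

End probability_notions.

(* Main.v *)
Require Import Defs.
From HB Require Import structures.
From mathcomp Require Import all_boot all_order all_algebra finmap.
From mathcomp Require Import all_classical all_reals all_analysis.
From mathcomp Require Import measurable_realfun ring lra zify.

Import Order.TTheory GRing.Theory Num.Theory.
Import numFieldNormedType.Exports.
Local Open Scope classical_set_scope.
Local Open Scope ring_scope.

Set Implicit Arguments.
Unset Strict Implicit.
Unset Printing Implicit Defensive.

(** Write f_l for the vector of the values of phi_l at the sample, v_k for the
    eigenvectors of the Gram matrix H and l_k for its eigenvalues.  The v_k form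
    an orthonormal basis, so by Parseval the statistic equals S - R, where
      S = sqrt n * sum_(l in J) (<f_l, f_l> - 1) = n^(-1/2) * sum_i psi (X_i),
      R = sqrt n * sum_(l in J) sum_(k notin J) <v_k, f_l>^2,
    and psi = sum_(l in J) phi_l^2 - |J| is bounded with mean 0.  The variance of
    psi is the variance of the bridge at sum_(l in J) phi_l^2, so S converges to
    the stated limit by the central limit theorem, and R must be shown to be
    negligible.  For l in J the eigenvalue lam_l is at least gamma > 0, so that the
    phi_l are continuous and orthonormal.

    R is small because the error is squared.  The residual H f_l - lam_l f_l is a
    vector of centered sample averages, of mean squared norm O(1/n)
    (gram_residual_moment), and its component along v_k is
    (l_k - lam_l) <v_k, f_l>.  As soon as l_k stays at distance gamma / 2 from
    lam_l for all k outside J, one gets R <= (2 / gamma)^2 sqrt n * O(1/n)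
    (residual_bound).

    It remains to see that the empirical eigenvalues separate (gap_likely), for
    which each l_k has to be close to lam_k with high probability.  The lower
    bound is Courant-Fischer on the span of f_0, ..., f_k
    (eigenval_lower_likely).  The upper bound (eigenval_upper_likely) must control
    all directions orthogonal to f_0, ..., f_(N-1).  There H acts as the Gram
    matrix of the kernel g deflated by its first N eigenpairs, the squares of the
    Gram matrices of the powers of g are close to the Gram matrices of the squared
    powers, and so the quadratic form is bounded by the 2^r-th root of the
    Hilbert-Schmidt norm of g^(2^r).  That this root tends to the spectral bound
    lam_N is a spectral radius formula (hs2_kpow_small): otherwise suitably
    normalized powers of g would converge to an eigenkernel for an eigenvalue
    outside [0, lam_N], contradicting the completeness of the eigensystem.

    Two soft reductions complete the argument.  Eigenvectors need not depend
    measurably on the sample, so events of high probability are described by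
    measurable majorants (likely).  Weak convergence is tested on bounded
    Lipschitz functions only (weakly_converges_lipschitz), and for these the
    central limit theorem follows from Lindeberg's exchange of summands
    (lindeberg) after smoothing (lipschitz_taylor3_approx). *)

(** * Bounded measurable functions and their expectations *)

(** The functions of the sample below are bounded, the kernel and the eigenfunctions
    being continuous on a compact space; boundedness makes every integrability
    condition automatic. *)
Definition bmeas d (T : measurableType d) (R : realType) (f : T -> R) : Prop :=
  measurable_fun [set: T] f /\ exists B, forall x, `|f x| <= B.

Section bmeas_closure.
Context d (T : measurableType d) (R : realType).
Implicit Types f g : T -> R.

Lemma bmeas_cst (c : R) : bmeas (fun _ : T => c).
Proof. by split; [exact: measurable_cst|exists `|c|]. Qed.

Lemma bmeasD f g : bmeas f -> bmeas g -> bmeas (fun x => f x + g x).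
Proof.
move=> [mf [B fB]] [mg [C gC]]; split; first exact: measurable_funD.
by exists (B + C) => x; rewrite (le_trans (ler_normD _ _))// lerD.
Qed.

Lemma bmeasM f g : bmeas f -> bmeas g -> bmeas (fun x => f x * g x).
Proof.
move=> [mf [B fB]] [mg [C gC]]; split; first exact: measurable_funM.
by exists (B * C) => x; rewrite normrM ler_pM.
Qed.

Lemma bmeasN f : bmeas f -> bmeas (fun x => - f x).
Proof.
move=> [mf [B fB]]; split; first exact: measurableT_comp.
by exists B => x; rewrite normrN.
Qed.

Lemma bmeasB f g : bmeas f -> bmeas g -> bmeas (fun x => f x - g x).
Proof. by move=> bf bg; apply: bmeasD => //; exact: bmeasN. Qed.

Lemma bmeasX n f : bmeas f -> bmeas (fun x => f x ^+ n).
Proof.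
move=> [mf [B fB]]; split; first exact: measurable_funX.
by exists (B ^+ n) => x; rewrite normrX lerXn2r ?nnegrE// (le_trans _ (fB x)).
Qed.

Lemma bmeas_norm f : bmeas f -> bmeas (fun x => `|f x|).
Proof.
move=> [mf [B fB]]; split; first exact: measurableT_comp.
by exists B => x; rewrite normr_id.
Qed.

Lemma bmeas_sum I (s : seq I) (p : pred I) (F : I -> T -> R) :
  (forall i, p i -> bmeas (F i)) -> bmeas (fun x => \sum_(i <- s | p i) F i x).
Proof.
move=> bF; elim: s => [|i s IH].
  rewrite (_ : (fun x => _) = (fun=> 0)); last by apply/funext => x; rewrite big_nil.
  exact: bmeas_cst.
have [pi|npi] := boolP (p i); last first.
  rewrite (_ : (fun x => _) = (fun x => \sum_(j <- s | p j) F j x))//.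
  by apply/funext => x; rewrite big_cons (negbTE npi).
rewrite (_ : (fun x => _) = (fun x => F i x + \sum_(j <- s | p j) F j x)); last first.
  by apply/funext => x; rewrite big_cons pi.
by apply: bmeasD => //; exact: bF.
Qed.

Lemma bmeas_comp d' (T' : measurableType d') (h : T' -> T) f :
  bmeas f -> measurable_fun [set: T'] h -> bmeas (fun x => f (h x)).
Proof.
move=> [mf [B fB]] mh; split; first exact: measurableT_comp.
by exists B.
Qed.

Lemma bmeas_cvg (F : nat -> T -> R) f (B : R) :
  (forall n, bmeas (F n)) -> (forall x, `|f x| <= B) ->
  (forall x, F ^~ x @ \oo --> f x) -> bmeas f.
Proof.
move=> bF fB cF; split; last by exists B.
by apply: (@measurable_fun_cvg _ _ _ setT F) => [n|x _]; [exact: (bF n).1|exact: cF].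
Qed.

End bmeas_closure.

Section bmeas_integral.
Context d (T : measurableType d) (R : realType) (mu : probability T R).
Implicit Types f g : T -> R.

Lemma bmeas_integrable f : bmeas f -> mu.-integrable setT (EFin \o f).
Proof.
move=> [mf [B fB]]; apply: measurable_bounded_integrable => //=.
  by rewrite (le_lt_trans (probability_le1 _ _))// ltry.
exists `|B|; split; first exact: num_real.
by move=> x Bx y _ /=; rewrite (le_trans (fB y))// ltW// (le_lt_trans (ler_norm _)).
Qed.

Lemma RintegralEfin f : bmeas f -> ((\int[mu]_x f x)%:E = \int[mu]_x (f x)%:E)%E.
Proof. by move=> bf; rewrite /Rintegral fineK// integrable_fin_num// bmeas_integrable. Qed.

Lemma expect_cst (c : R) : \int[mu]_x c = c.
Proof. by rewrite Rintegral_cst//= probability_setT mulr1. Qed.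

Lemma expectD f g : bmeas f -> bmeas g ->
  \int[mu]_x (f x + g x) = \int[mu]_x f x + \int[mu]_x g x.
Proof. by move=> bf bg; apply: RintegralD => //; exact: bmeas_integrable. Qed.

Lemma expectB f g : bmeas f -> bmeas g ->
  \int[mu]_x (f x - g x) = \int[mu]_x f x - \int[mu]_x g x.
Proof. by move=> bf bg; apply: RintegralB => //; exact: bmeas_integrable. Qed.

Lemma expectZ c f : bmeas f -> \int[mu]_x (c * f x) = c * \int[mu]_x f x.
Proof. by move=> bf; apply: RintegralZl => //; exact: bmeas_integrable. Qed.

Lemma expectZr c f : bmeas f -> \int[mu]_x (f x * c) = (\int[mu]_x f x) * c.
Proof. by move=> bf; apply: RintegralZr => //; exact: bmeas_integrable. Qed.

Lemma expect_sum I (s : seq I) (p : pred I) (F : I -> T -> R) :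
  (forall i, p i -> bmeas (F i)) ->
  \int[mu]_x (\sum_(i <- s | p i) F i x) = \sum_(i <- s | p i) \int[mu]_x F i x.
Proof.
move=> bF; elim: s => [|i s IH].
  under eq_Rintegral do rewrite big_nil.
  by rewrite big_nil expect_cst.
under eq_Rintegral do rewrite big_cons.
rewrite big_cons; case: ifPn => [pi|//].
by rewrite expectD ?IH//; [exact: bF|exact: bmeas_sum].
Qed.

Lemma le_expect f g : bmeas f -> bmeas g -> (forall x, f x <= g x) ->
  \int[mu]_x f x <= \int[mu]_x g x.
Proof. by move=> bf bg fg; apply: le_Rintegral => //; exact: bmeas_integrable. Qed.

Lemma norm_expect_le f B : bmeas f -> (forall x, `|f x| <= B) ->
  `|\int[mu]_x f x| <= B.
Proof.
move=> bf fB; rewrite (le_trans (le_normr_Rintegral _ _))//.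
  exact: bmeas_integrable.
by rewrite -[leRHS]expect_cst le_expect//; [exact: bmeas_norm|exact: bmeas_cst].
Qed.

Lemma norm_expectB_le f g h : bmeas f -> bmeas g -> bmeas h ->
  (forall x, `|f x - g x| <= h x) ->
  `|\int[mu]_x f x - \int[mu]_x g x| <= \int[mu]_x h x.
Proof.
move=> bf bg bh fgh; rewrite -expectB//.
have bfg := bmeasB bf bg.
rewrite (le_trans (le_normr_Rintegral _ _))//; first exact: bmeas_integrable.
by apply: le_expect => //; exact: bmeas_norm.
Qed.

Lemma expect_ae f g : bmeas f -> bmeas g -> {ae mu, forall x, f x = g x} ->
  \int[mu]_x f x = \int[mu]_x g x.
Proof.
move=> [mf _] [mg _] fg; congr fine; apply: ae_eq_integral => //.
- exact/measurable_EFinP.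
- exact/measurable_EFinP.
- by apply: filterS fg => x /= -> _.
Qed.

Lemma expect_ge0 f : (forall x, 0 <= f x) -> 0 <= \int[mu]_x f x.
Proof. by move=> f0; exact: Rintegral_ge0. Qed.

Lemma expect_sqr0 f : bmeas f -> \int[mu]_x (f x ^+ 2) = 0 ->
  {ae mu, forall x, f x = 0}.
Proof.
move=> bf f0; have b2 := bmeasX 2 bf.
have i0 : (\int[mu]_x `|((f x) ^+ 2)%:E| = 0)%E.
  under eq_integral do rewrite gee0_abs ?lee_fin ?sqr_ge0//.
  by rewrite -RintegralEfin// f0.
have m2 : measurable_fun [set: T] (fun x => ((f x) ^+ 2)%:E).
  by apply/measurable_EFinP; exact: b2.1.
have := (ae_eq_integral_abs mu measurableT m2).1 i0.
by apply: filterS => x /= /(_ I) [] /eqP; rewrite sqrf_eq0 => /eqP.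
Qed.

(** The integral of (s f + t g)^2 is nonnegative for all s and t. *)
Lemma expect_CauchySchwarz f g : bmeas f -> bmeas g ->
  (\int[mu]_x (f x * g x)) ^+ 2 <=
  (\int[mu]_x (f x ^+ 2)) * \int[mu]_x (g x ^+ 2).
Proof.
move=> bf bg.
set b := \int[mu]_x (f x * g x); set F := \int[mu]_x (f x ^+ 2).
set a := \int[mu]_x (g x ^+ 2).
have key s t : 0 <= s ^+ 2 * F + s * t * b *+ 2 + t ^+ 2 * a.
  have -> : s ^+ 2 * F + s * t * b *+ 2 + t ^+ 2 * a =
      \int[mu]_x ((s * f x + t * g x) ^+ 2).
    rewrite (_ : (fun x => (s * f x + t * g x) ^+ 2) =
       (fun x => s ^+ 2 * f x ^+ 2 + (s * t *+ 2) * (f x * g x) + t ^+ 2 * g x ^+ 2)).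
      rewrite !expectD ?expectZ -/F -/a -/b//; [ring|..];
        by do ?[exact: bmeas_cst|exact: bmeasX|apply: bmeasD|apply: bmeasM].
    by apply/funext => x; ring.
  by apply: expect_ge0 => x; exact: sqr_ge0.
have a0 : 0 <= a by apply: expect_ge0 => x; exact: sqr_ge0.
have F0 : 0 <= F by apply: expect_ge0 => x; exact: sqr_ge0.
have [a_eq0|a_neq0] := eqVneq a 0.
  have [->|b0] := eqVneq b 0; first by rewrite expr0n mulr_ge0.
  have := key b (- (F + 1)); rewrite a_eq0.
  have b2 : 0 < b ^+ 2 by rewrite exprn_even_gt0.
  nra.
have a_gt0 : 0 < a by rewrite lt_neqAle eq_sym a_neq0.
have := key a (- b); nra.
Qed.

End bmeas_integral.

Section bmeas_fubini.
Context d1 d2 (T1 : measurableType d1) (T2 : measurableType d2) (R : realType).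
Context (m2 : probability T2 R).
Implicit Types f : T1 * T2 -> R.

Lemma bmeas_section1 f x : bmeas f -> bmeas (fun y => f (x, y)).
Proof. by move=> bf; apply: (bmeas_comp bf); exact: pair1_measurable. Qed.

Lemma bmeas_section2 f y : bmeas f -> bmeas (fun x => f (x, y)).
Proof. by move=> bf; apply: (bmeas_comp bf); exact: pair2_measurable. Qed.

Lemma bmeas_prod_integrable (m1 : probability T1 R) f : bmeas f -> (m1 \x m2)%E.-integrable setT (EFin \o f).
Proof.
move=> [mf [B fB]]; apply: measurable_bounded_integrable => //=.
  rewrite -setXTT product_measure1E//= !probability_setT mule1.
  by rewrite ltry.
exists `|B|; split; first exact: num_real.
by move=> x Bx y _ /=; rewrite (le_trans (fB y))// ltW// (le_lt_trans (ler_norm _)).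
Qed.

Lemma bmeas_expect2 f : bmeas f -> bmeas (fun x => \int[m2]_y f (x, y)).
Proof.
move=> bf; split.
  have [[x0 _]|T0] := pselect (exists x : T1, True); last first.
    move=> _ Y _; rewrite (_ : _ `&` _ = set0)//.
    by apply/seteqP; split => x //= _; apply: T0; exists x.
  apply/measurable_EFinP.
  have -> : EFin \o (fun x => \int[m2]_y f (x, y)) = fubini_F m2 (EFin \o f).
    by apply/funext => x /=; rewrite RintegralEfin//; exact: bmeas_section1.
  apply: (@measurable_fubini_F _ _ _ _ _ \d_x0).
  exact: bmeas_prod_integrable bf.
case: (bf) => _ [B fB]; exists B => x; apply: norm_expect_le => //.
exact: bmeas_section1.
Qed.

Lemma expect_prod (m1 : probability T1 R) f : bmeas f ->
  fine (\int[(m1 \x m2)%E]_z (f z)%:E) = \int[m1]_x \int[m2]_y f (x, y).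
Proof.
move=> bf; rewrite -integral12_prod_meas1; last exact: bmeas_prod_integrable.
congr fine; apply: eq_integral => x _.
by rewrite RintegralEfin//; exact: bmeas_section1.
Qed.

Lemma expect_fubini (m1 : probability T1 R) f : bmeas f ->
  \int[m1]_x \int[m2]_y f (x, y) = \int[m2]_y \int[m1]_x f (x, y).
Proof.
move=> bf; rewrite -expect_prod// -integral21_prod_meas1; last exact: bmeas_prod_integrable.
congr fine; apply: eq_integral => x _.
by rewrite RintegralEfin//; exact: bmeas_section2.
Qed.

End bmeas_fubini.

Section bmeas_transfer.
Context d1 d2 (T1 : measurableType d1) (T2 : measurableType d2) (R : realType).
Context (m1 : probability T1 R) (m2 : probability T2 R) (X : T1 -> T2).
Hypotheses (mX : measurable_fun [set: T1] X)
  (lawX : forall A, measurable A -> m1 (X @^-1` A) = m2 A).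

Lemma expect_law f : bmeas f -> \int[m1]_x f (X x) = \int[m2]_y f y.
Proof.
move=> bf; have bfX := bmeas_comp bf mX.
have mf : measurable_fun setT (EFin \o f) by apply/measurable_EFinP; exact: bf.1.
congr fine; transitivity (\int[m1]_(x in X @^-1` setT) ((EFin \o f) \o X) x)%E => //.
rewrite -integral_pushforward//; last first.
  exact: (bmeas_integrable m1 bfX).
by apply: eq_measure_integral => A mA _; exact: lawX.
Qed.

Lemma ae_law (p : T2 -> Prop) : {ae m2, forall y, p y} -> {ae m1, forall x, p (X x)}.
Proof.
move=> [A [mA A0 pA]]; exists (X @^-1` A); split.
- by rewrite -[X @^-1` A]setTI; exact: mX.
- by rewrite lawX.
- by move=> x px; apply: pA.
Qed.

End bmeas_transfer.

(** * Measurability on a compact metric space and independence *)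

Section compact_kernels.
Context (R : realType) (M : pointedMetricType R) (hM : compact [set: M]).

Lemma measurable_open_borel (A : set M) : open A -> measurable (A : set (borel M)).
Proof. by move=> oA; exact: sub_sigma_algebra. Qed.

Lemma continuous_bounded (T : topologicalType) (f : T -> R) :
  compact [set: T] -> continuous f -> exists B, forall x, `|f x| <= B.
Proof.
move=> cT cf; have /compact_bounded [B [_ fB]] : compact (f @` [set: T]).
  by apply: continuous_compact => //; exact: continuous_subspaceT.
exists (B + 1) => x; apply: (fB (B + 1)); first by rewrite ltrDl.
by exists x.
Qed.

Lemma continuous_bmeas (f : M -> R) : continuous f -> bmeas (f : borel M -> R).
Proof.
move=> cf; split; last exact: continuous_bounded.
apply: (measurability _ (RGenOInfty.measurableE R)) => //.
move=> _ [_ [x ->] <-]; rewrite setTI; apply: measurable_open_borel.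
by rewrite set_itvoy; apply: open_comp => [? _|]; [exact: cf|exact: open_gt].
Qed.

(** h is a uniform limit of kernels of the form sum_j 1_(A_j)(x) h (x_j, y), which are
    measurable for the product of the Borel sigma-algebras: by compactness h(x, .)
    is within e of h(x0, .) uniformly for x near x0, and finitely many x0 suffice. *)
Lemma continuous_kernel_bmeas (h : M -> M -> R) :
  continuous (fun z : M * M => h z.1 z.2) ->
  bmeas (fun z : borel M * borel M => h z.1 z.2).
Proof.
move=> ch.
have [B hB] : exists B : R, forall z : M * M, `|h z.1 z.2| <= B.
  by apply: continuous_bounded => //; rewrite -setXTT; exact: compact_setX.
have cont2 x : continuous (h x).
  move=> y; apply: (cvg_comp (fun y => (x, y)) (fun z => h z.1 z.2) _ (ch (x, y))).
  by apply: cvg_pair; [exact: cvg_cst|exact: cvg_id].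
have approx (e : R) : 0 < e -> exists k : M -> M -> R,
    bmeas (fun z : borel M * borel M => k z.1 z.2) /\
    forall x y, `|h x y - k x y| <= e.
  move=> e0.
  pose U x0 := [set x | forall y, `|h x y - h x0 y| < e].
  have nU x0 : nbhs x0 (U x0).
    have nc := (compact_near_coveringP [set: M]).1 hM M (nbhs x0)
      (fun x y => `|h x y - h x0 y| < e) _.
    suff /nc : forall y, [set: M] y ->
        \forall y' \near y & x \near x0, `|h x y' - h x0 y'| < e.
      by apply: filterS => x Hx y; exact: Hx.
    move=> y _.
    have e20 : 0 < e / 2 by rewrite divr_gt0.
    have /cvgrPdist_lt/(_ _ e20) C1 := ch (x0, y).
    have /cvgrPdist_lt/(_ _ e20) C2 := cont2 x0 y.
    have D2 : \forall y' \near y & x \near x0, `|h x0 y - h x0 y'| < e / 2.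
      by exists ([set y' | `|h x0 y - h x0 y'| < e / 2], [set: M]) => [|[? ?] []//]; split => //; exact: filterT.
    have D1 : \forall y' \near y & x \near x0, `|h x0 y - h x y'| < e / 2.
      case: C1 => -[Q1 Q2] /= [q1 q2] Q.
      by exists (Q2, Q1) => //= -[a b] /= [qa qb]; apply: (Q (b, a)).
    apply: filterS2 D1 D2 => -[y' x] /= d1 d2.
    have -> : h x y' - h x0 y' = - (h x0 y - h x y') + (h x0 y - h x0 y') by ring.
    by rewrite (le_lt_trans (ler_normD _ _))// normrN (splitr e) ltrD.
  pose V x0 : set M := (U x0)^°%classic.
  have cover : [set: M] `<=` \bigcup_(x0 in [set: M]) V x0.
    by move=> x _; exists x => //; exact: nU.
  have oU x0 : [set: M] x0 -> open (V x0) by move=> _; exact: open_interior.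
  have := hM; rewrite compact_cover => /(_ _ _ _ oU cover)[D' _ cD].
  (* h (x0, y) for the first x0 of s whose V x0 contains x *)
  pose step := fix step (s : seq M) (x y : M) : R :=
    if s is x0 :: s' then
      \1_(V x0) x * h x0 y + (1 - \1_(V x0) x) * step s' x y
    else 0.
  exists (step (enum_fset D')); split.
    elim: (enum_fset D') => [|x0 s IH] /=; first exact: bmeas_cst.
    have b1 : bmeas (fun z : borel M * borel M => (\1_(V x0) z.1 : R)).
      apply: (@bmeas_comp _ _ _ _ _ fst (\1_(V x0) : borel M -> R)); last exact: measurable_fst.
      split; first by apply: measurable_indic; apply: measurable_open_borel; exact: open_interior.
      by exists 1 => x; rewrite indicE; case: (_ \in _); rewrite /= ?normr1 ?normr0.
    apply: bmeasD; apply: bmeasM => //.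
      apply: (@bmeas_comp _ _ _ _ _ snd (h x0 : borel M -> R)); last exact: measurable_snd.
      exact: continuous_bmeas.
    by apply: bmeasB => //; exact: bmeas_cst.
  move=> x y; have [x0 /= xD xU] := cD x I.
  have : x0 \in enum_fset D' by [].
  elim: (enum_fset D') => [//|x1 s IH] /=; rewrite inE indicE.
  have [xU1 _|xU1] := boolP (x \in V x1).
    rewrite mul1r subrr mul0r addr0 ltW//.
    by move: xU1; rewrite inE => /interior_subset; exact.
  rewrite mul0r subr0 mul1r add0r => /predU1P[x01|//].
  by move: xU1; rewrite -x01 mem_set.
have inv n : 0 < n.+1%:R^-1 :> R by rewrite invr_gt0.
pose k n := projT1 (cid (approx _ (inv n))).
have kP n := projT2 (cid (approx _ (inv n))).
apply: (@bmeas_cvg _ (borel M * borel M)%type _ (fun n z => k n z.1 z.2) _ B) => [n|x|x].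
- exact: (kP n).1.
- exact: hB.
- apply/cvgrPdist_le => e e0; near=> n.
  rewrite (le_trans ((kP n).2 _ _))// ltW//.
  by near: n; exact: near_infty_natSinv_lt (PosNum e0).
Unshelve. all: by end_near.
Qed.

End compact_kernels.

Section sequence_space.
Context (R : realType) (M : pointedMetricType R).

Definition cylinders : set (set (nat -> borel M)) :=
  [set C | exists (s : seq nat) (A : nat -> set (borel M)),
    (forall i, measurable (A i)) /\ C = [set x | forall i, i \in s -> A i (x i)]].

(** Sequences of points of M with the product sigma-algebra. *)
Definition seqspace := g_sigma_algebraType cylinders.

Lemma measurable_coord i : measurable_fun [set: seqspace] (fun x : seqspace => x i : borel M).
Proof.
move=> _ A mA; rewrite setTI; apply: sub_sigma_algebra.
exists [:: i], (fun=> A); split => //; apply/seteqP; split => x /=.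
  by move=> Axi j; rewrite inE => /eqP ->.
by move=> /(_ i); rewrite inE eqxx; exact.
Qed.

Lemma measurable_seqspace d (T : measurableType d) (f : T -> seqspace) :
  (forall i, measurable_fun setT (fun t => f t i : borel M)) ->
  measurable_fun setT f.
Proof.
move=> mf; apply: (measurability (rT := seqspace) _ (erefl <<s cylinders >>)) => // _ [_ [s [A [mA ->]]] <-].
rewrite setTI.
have -> : f @^-1` [set x | forall i, i \in s -> A i (x i)] =
    \bigcap_(i in [set` s]) (fun t => f t i) @^-1` A i by [].
apply: fin_bigcap_measurable => // i _.
by rewrite -[X in measurable X]setTI; exact: mf.
Qed.

Definition upd (x : nat -> M) (l : nat) (z : M) : nat -> M :=
  fun i => if i == l then z else x i.

Lemma cylinders_setI : setI_closed cylinders.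
Proof.
move=> _ _ [s [A [mA ->]]] [t [B [mB ->]]].
exists (s ++ t), (fun i => (if i \in s then A i else setT) `&` (if i \in t then B i else setT)).
split.
  by move=> i; apply: measurableI; case: ifP.
apply/seteqP; split => x /=.
  by move=> [xA xB] i; rewrite mem_cat; case: ifP => [/xA|_]; case: ifP => [/xB|].
move=> H; split => i si; have := H i; rewrite mem_cat si ?orbT => /(_ isT) [].
  by [].
by [].
Qed.

Section resample.
Context (P : probability (borel M) R).
Context d (Omega : measurableType d) (Pr : probability Omega R) (X : nat -> Omega -> M).
Hypothesis hX : iid_sample Pr P (X : nat -> Omega -> borel M).

Lemma measurable_sample i : measurable_fun setT (X i : Omega -> borel M).
Proof. by case: hX => + _ _; exact. Qed.

Let Xs (w : Omega) : seqspace := fun i => X i w.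
Let Psi l (u : Omega * borel M) : seqspace := upd (Xs u.1) l u.2.

Let mXs : measurable_fun setT Xs.
Proof. by apply: measurable_seqspace => i; exact: measurable_sample. Qed.

Let mPsi l : measurable_fun setT (Psi l).
Proof.
apply: measurable_seqspace => i; rewrite /Psi /upd; case: eqP => _.
  exact: measurable_snd.
by apply: (measurableT_comp (measurable_sample i)); exact: measurable_fst.
Qed.

Lemma iid_preimage (s : seq nat) (A : nat -> set (borel M)) : uniq s ->
  (forall i, measurable (A i)) ->
  Pr [set w | forall i, i \in s -> A i (X i w)] = (\prod_(i <- s) P (A i))%E.
Proof.
move=> us mA; case: hX => _ law indep.
have := indep [fset i in s]%fset A mA.
have -> : \bigcap_(i in [set` [fset i in s]%fset]) (X i @^-1` A i) =
    [set w | forall i, i \in s -> A i (X i w)].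
  apply/seteqP; split => w /= H i => [si|]; first by apply: H; rewrite /= !inE.
  by move=> si; apply: H; move: si; rewrite /= !inE.
move=> ->; rewrite (perm_big s)/=; last first.
  by apply: uniq_perm => [|//|i]; rewrite ?fset_uniq// !inE.
by apply: eq_bigr => i _; rewrite law.
Qed.

(** Independence turns both sides into the same product of probabilities. *)
Lemma sample_cylinder_resample l C : cylinders C ->
  Pr (Xs @^-1` C) = (Pr \x P)%E (Psi l @^-1` C).
Proof.
move=> [s [A [mA ->]]].
pose A' i := if i \in s then A i else setT.
have mA' i : measurable (A' i) by rewrite /A'; case: ifP.
pose t := rem l (undup s).
have ut : uniq t by rewrite rem_uniq// undup_uniq.
have tl i : (i \in t) = (i != l) && (i \in s).
  by rewrite (mem_rem_uniq _ (undup_uniq s)) !inE mem_undup.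
have -> : Xs @^-1` [set x | forall i, i \in s -> A i (x i)] =
    [set w | forall i, i \in l :: t -> A' i (X i w)].
  apply/seteqP; split => w /= H i.
    move=> _; rewrite /A'; case: ifP => // si; exact: H.
  move=> si; have := H i; rewrite /A' si; apply.
  by rewrite inE tl si andbT; case: eqP.
rewrite iid_preimage//=; last by rewrite ut tl eqxx.
have -> : Psi l @^-1` [set x | forall i, i \in s -> A i (x i)] =
    [set w | forall i, i \in t -> A' i (X i w)] `*` A' l.
  apply/seteqP; split => -[w z] /=; rewrite /Psi /upd /=.
    move=> H; split => [i|].
      by rewrite tl => /andP[il si]; have := H i si; rewrite (negbTE il) /A' si.
    by rewrite /A'; case: ifP => // sl; have := H l sl; rewrite eqxx.
  move=> [H Hl] i si; case: eqP => il.
    by move: Hl; rewrite /A' -il si.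
  by have := H i; rewrite tl si andbT /A' si; apply; exact/eqP.
rewrite product_measure1E//; last first.
  have -> : [set w | forall i, i \in t -> A' i (X i w)] =
      \bigcap_(i in [set` t]) (X i @^-1` A' i) by [].
  apply: fin_bigcap_measurable => // i _.
  by rewrite -[X in measurable X]setTI; exact: measurable_sample.
by rewrite big_cons -iid_preimage// muleC.
Qed.

(** Independence of one coordinate from all the others, in the form in which it
    is used: the l-th sample point may be replaced by a fresh one. *)
Lemma expect_resample l (F : seqspace -> R) : bmeas F ->
  \int[Pr]_w F (fun i => X i w) =
  \int[Pr]_w \int[P]_z F (upd (fun i => X i w) l z).
Proof.
move=> bF.
have mF : measurable_fun setT (EFin \o F) by apply/measurable_EFinP; exact: bF.1.
have bP : bmeas (F \o Psi l) by exact: (bmeas_comp bF (mPsi l)).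
have bX : bmeas (F \o Xs) by exact: (bmeas_comp bF mXs).
rewrite -(expect_prod P Pr bP).
transitivity (fine (\int[Pr]_(w in Xs @^-1` setT) ((EFin \o F) \o Xs) w)%E) => //.
rewrite -integral_pushforward//; last exact: (bmeas_integrable Pr bX).
transitivity (fine (\int[(Pr \x P)%E]_(w in Psi l @^-1` setT) ((EFin \o F) \o Psi l) w)%E) => //.
rewrite -integral_pushforward//; last exact: (bmeas_prod_integrable P Pr bP).
(* The laws of both sequences agree on cylinders, which generate and are stable
   under intersection. *)
congr fine; apply: eq_measure_integral => C mC _.
pose fX : {mfun Omega >-> seqspace} := HB.pack Xs (isMeasurableFun.Build _ _ _ _ _ mXs).
pose fP : {mfun (Omega * borel M)%type >-> seqspace} :=
  HB.pack (Psi l) (isMeasurableFun.Build _ _ _ _ _ (mPsi l)).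
have := @measure_unique _ R seqspace cylinders (fun=> setT) (erefl _) cylinders_setI _ _
  (pushforward Pr fX) (pushforward (Pr \x P)%E fP).
apply => //.
- by move=> _; exists [::], (fun=> setT); split => //; apply/seteqP; split.
- by apply: bigcup_const; by exists 0%N.
- by move=> A cA; exact: (sample_cylinder_resample l cA).
- by move=> _ /=; rewrite /pushforward preimage_setT probability_setT ltry.
Qed.

Lemma expect_sample i (f : borel M -> R) : bmeas f -> \int[Pr]_w f (X i w) = \int[P]_y f y.
Proof. by move=> bf; apply: expect_law => //; [exact: measurable_sample|by case: hX => _ /(_ i)]. Qed.

Lemma ae_sample i (p : borel M -> Prop) : {ae P, forall y, p y} -> {ae Pr, forall w, p (X i w)}.
Proof. by apply: ae_law => //; [exact: measurable_sample|by case: hX => _ /(_ i)]. Qed.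

Lemma bmeas_sample (F : seqspace -> R) : bmeas F -> bmeas (fun w => F (fun i => X i w)).
Proof. by move=> bF; exact: (bmeas_comp bF mXs). Qed.

Lemma bmeas_coord i (f : borel M -> R) : bmeas f -> bmeas (fun x : seqspace => f (x i)).
Proof. by move=> bf; apply: (bmeas_comp bf); exact: measurable_coord. Qed.

Lemma bmeas_coord2 i j (f : borel M * borel M -> R) :
  bmeas f -> bmeas (fun x : seqspace => f (x i, x j)).
Proof.
move=> bf; apply: (bmeas_comp bf).
by apply: measurable_fun_pair; exact: measurable_coord.
Qed.

End resample.

End sequence_space.

Section second_moment.
Context (R : realType) (M : pointedMetricType R).
Context (P : probability (borel M) R).
Context d (Omega : measurableType d) (Pr : probability Omega R) (X : nat -> Omega -> M).
Hypothesis hX : iid_sample Pr P (X : nat -> Omega -> borel M).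

Local Notation T3 := ((borel M * borel M) * borel M)%type.

Lemma bmeas_coord3 i j k (f : T3 -> R) :
  bmeas f -> bmeas (fun x : seqspace M => f ((x i, x j), x k)).
Proof.
move=> bf; apply: (bmeas_comp bf).
apply: measurable_fun_pair; last exact: measurable_coord.
by apply: measurable_fun_pair; exact: measurable_coord.
Qed.

(** The factor with index l has conditional mean zero: resample X_l. *)
Lemma expect_centered_prod (eta : T3 -> R) (i j k l : nat) : bmeas eta ->
  {ae Pr, forall w, \int[P]_z eta ((X i w, X j w), z) = 0} ->
  l != i -> l != j -> l != k ->
  \int[Pr]_w (eta ((X i w, X j w), X k w) * eta ((X i w, X j w), X l w)) = 0.
Proof.
move=> be ae0 li lj lk.
have bF : bmeas (fun x : seqspace M => eta ((x i, x j), x k) * eta ((x i, x j), x l)).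
  by apply: bmeasM; exact: bmeas_coord3.
rewrite (expect_resample hX l bF)/=.
transitivity (\int[Pr]_w 0); last by rewrite expect_cst.
rewrite /upd ![_ == l]eq_sym (negbTE li) (negbTE lj) (negbTE lk) eqxx.
have b3 : bmeas (fun w => eta ((X i w, X j w), X k w)).
  by apply: (bmeas_sample hX (F := fun x => eta ((x i, x j), x k))); exact: bmeas_coord3.
have b2 : bmeas (fun w => \int[P]_z eta ((X i w, X j w), z)).
  apply: (bmeas_sample hX (F := fun x => \int[P]_z eta ((x i, x j), z))).
  exact: (bmeas_coord2 i j (bmeas_expect2 P be)).
transitivity (\int[Pr]_w (eta ((X i w, X j w), X k w) * \int[P]_z eta ((X i w, X j w), z))).
  by apply: eq_Rintegral => w _; rewrite expectZ//; exact: bmeas_section1.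
apply: expect_ae; [exact: bmeasM|exact: bmeas_cst|].
by apply: filterS ae0 => w ->; rewrite mulr0.
Qed.

(** The summands are centered given X_i and X_j, and those with indices k and l are
    uncorrelated unless l is i, j or k, which happens for at most 3n pairs. *)
Lemma second_moment_le (eta : T3 -> R) (B : R) (i j n : nat) : bmeas eta ->
  (forall u, `|eta u| <= B) ->
  {ae Pr, forall w, \int[P]_z eta ((X i w, X j w), z) = 0} ->
  \int[Pr]_w ((n%:R^-1 * \sum_(k < n) eta ((X i w, X j w), X k w)) ^+ 2)
    <= 3 * B ^+ 2 / n%:R.
Proof.
move=> be eB ae0.
have b1 k : bmeas (fun w => eta ((X i w, X j w), X k w)).
  by apply: (bmeas_sample hX (F := fun x => eta ((x i, x j), x k))); exact: bmeas_coord3.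
have b2 k l : bmeas (fun w => eta ((X i w, X j w), X k w) * eta ((X i w, X j w), X l w)).
  exact: bmeasM.
have -> : \int[Pr]_w ((n%:R^-1 * \sum_(k < n) eta ((X i w, X j w), X k w)) ^+ 2) =
   n%:R^-1 ^+ 2 * \sum_(k < n) \sum_(l < n)
     \int[Pr]_w (eta ((X i w, X j w), X k w) * eta ((X i w, X j w), X l w)).
  under [in RHS]eq_bigr do rewrite -expect_sum//.
  rewrite -expect_sum; last by move=> k _; exact: bmeas_sum.
  rewrite -expectZ; last by apply: bmeas_sum => k _; exact: bmeas_sum.
  apply: eq_Rintegral => w _; rewrite exprMn; congr (_ * _).
  by rewrite expr2 mulr_suml; apply: eq_bigr => k _; rewrite mulr_sumr.
have B0 : 0 <= B by rewrite (le_trans _ (eB point)).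
have bound k l : \int[Pr]_w (eta ((X i w, X j w), X k w) * eta ((X i w, X j w), X l w))
    <= B ^+ 2 * ((l == i) + (l == j) + (l == k))%:R.
  have [|] := boolP [|| l == i, l == j | l == k]; last first.
    rewrite !negb_or => /and3P[li lj lk].
    by rewrite expect_centered_prod// (negbTE li) (negbTE lj) (negbTE lk) mulr0.
  move=> H; apply: (@le_trans _ _ (B ^+ 2)).
    apply: (le_trans (ler_norm _)); apply: norm_expect_le => // w.
    by rewrite normrM expr2 ler_pM.
  by rewrite ler_peMr ?exprn_ge0// ler1n; move: H; do 3 case: eqP.
have count1 (m : nat) : (\sum_(l < n) ((l : nat) == m) <= 1)%N.
  have [mn|nm] := ltnP m n.
    rewrite (bigD1 (Ordinal mn))//= eqxx big1// => l lm.
    by apply/eqP; rewrite eqb0; apply: contra lm => /eqP lm; apply/eqP; exact: val_inj.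
  rewrite big1// => l _; apply/eqP; rewrite eqb0.
  by rewrite neq_ltn (leq_trans (ltn_ord l) nm).
have [n0|n0] := posnP n.
  by rewrite n0 invr0 expr0n mul0r mulr0.
apply: (@le_trans _ _ (n%:R^-1 ^+ 2 * \sum_(k < n) (B ^+ 2 * 3))).
  rewrite ler_wpM2l// ler_sum// => k _.
  apply: (@le_trans _ _ (\sum_(l < n)
      (B ^+ 2 * (((l : nat) == i) + ((l : nat) == j) + ((l : nat) == k))%:R))).
    by apply: ler_sum => l _; exact: bound.
  rewrite -mulr_sumr ler_wpM2l ?exprn_ge0// -natr_sum ler_nat.
  by rewrite !big_split/= -[3%N]/(1 + 1 + 1)%N !leq_add.
rewrite sumr_const card_ord -mulr_natr.
have nR : n%:R != 0 :> R by rewrite pnatr_eq0 -lt0n.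
by rewrite le_eqVlt; apply/orP; left; apply/eqP; field.
Qed.

End second_moment.

(** * Powers of an integral operator and their Hilbert-Schmidt norms *)

Section kernel_algebra.
Context d (T : measurableType d) (R : realType) (P : probability T R).
Implicit Types a b g : T -> T -> R.

Definition bker a := bmeas (fun u : T * T => a u.1 u.2).

Definition kcomp a b : T -> T -> R := fun x y => \int[P]_z (a x z * b z y).

(** The exponent is shifted: kpow g n is the kernel of the (n+1)-st power. *)
Fixpoint kpow g n := if n is n'.+1 then kcomp g (kpow g n') else g.

(** The squared Hilbert-Schmidt norm of the operator with kernel a. *)
Definition hs2 a : R := \int[P]_x \int[P]_y a x y ^+ 2.

Lemma bker_comp d' (U : measurableType d') a (f1 f2 : U -> T) : bker a ->
  measurable_fun setT f1 -> measurable_fun setT f2 ->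
  bmeas (fun u => a (f1 u) (f2 u)).
Proof.
move=> ba m1 m2; apply: (bmeas_comp (h := fun u => (f1 u, f2 u)) ba).
exact: measurable_fun_pair.
Qed.

Lemma bker_row a x : bker a -> bmeas (a x).
Proof. by move=> ba; exact: (bmeas_section1 x ba). Qed.

Lemma bker_col a y : bker a -> bmeas (a^~ y).
Proof. by move=> ba; exact: (bmeas_section2 y ba). Qed.

Let mf1 : measurable_fun setT (fun u : (T * T) * T => u.1.1).
Proof. by apply: measurableT_comp => //; exact: measurable_fst. Qed.

Let mf2 : measurable_fun setT (fun u : (T * T) * T => u.1.2).
Proof. by apply: (measurableT_comp measurable_snd); exact: measurable_fst. Qed.

Lemma bker_kcomp a b : bker a -> bker b -> bker (kcomp a b).
Proof.
move=> ba bb.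
apply: (bmeas_expect2 P (f := fun u => a u.1.1 u.2 * b u.2 u.1.2)).
by apply: bmeasM; apply: bker_comp.
Qed.

Lemma bker_kpow g n : bker g -> bker (kpow g n).
Proof. by move=> bg; elim: n => //= n IH; exact: bker_kcomp. Qed.

Lemma kcompA a b c : bker a -> bker b -> bker c ->
  kcomp a (kcomp b c) = kcomp (kcomp a b) c.
Proof.
move=> ba bb bc; apply/funext => x; apply/funext => y; rewrite /kcomp.
transitivity (\int[P]_z \int[P]_t (a x z * (b z t * c t y))).
  apply: eq_Rintegral => z _; rewrite expectZ//.
  by apply: bmeasM; [exact: bker_row|exact: bker_col].
rewrite (expect_fubini P P (f := fun u => a x u.1 * (b u.1 u.2 * c u.2 y))); last first.
  apply: bmeasM; first by apply: (bmeas_comp (bker_row x ba)); exact: measurable_fst.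
  by apply: bmeasM => //; apply: (bmeas_comp (bker_col y bc)); exact: measurable_snd.
apply: eq_Rintegral => t _ /=.
under eq_Rintegral do rewrite mulrA.
rewrite expectZr//.
by apply: bmeasM; [exact: bker_row|exact: bker_col].
Qed.

Lemma kpowD g p q : bker g -> kcomp (kpow g p) (kpow g q) = kpow g (p + q).+1.
Proof.
move=> bg; elim: p => //= p IH.
by rewrite -kcompA ?IH//; exact: bker_kpow.
Qed.

Lemma kpow_sym g n : bker g -> (forall x y, g x y = g y x) ->
  forall x y, kpow g n x y = kpow g n y x.
Proof.
move=> bg sg; elim: n => //= n IH x y.
have gC : kcomp g (kpow g n) = kcomp (kpow g n) g.
  by rewrite (kpowD 0 n bg) (kpowD n 0 bg) addn0.
rewrite {1}gC /kcomp.
by apply: eq_Rintegral => z _; rewrite IH sg mulrC.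
Qed.

Lemma hs2_ge0 a : 0 <= hs2 a.
Proof. by do 2 (apply: expect_ge0 => ?); exact: sqr_ge0. Qed.

Lemma bker_sqr a : bker a -> bker (fun x y => a x y ^+ 2).
Proof. exact: bmeasX. Qed.

Lemma bmeas_expect_row a : bker a -> bmeas (fun x => \int[P]_y a x y).
Proof. exact: bmeas_expect2. Qed.

(** Cauchy-Schwarz in y, then in x for the L2-norms of the rows. *)
Lemma kernel_CauchySchwarz a b : bker a -> bker b ->
  (\int[P]_x \int[P]_y (a x y * b x y)) ^+ 2 <= hs2 a * hs2 b.
Proof.
move=> ba bb.
pose f x := \int[P]_y (a x y * b x y).
pose A x := Num.sqrt (\int[P]_y a x y ^+ 2).
pose B x := Num.sqrt (\int[P]_y b x y ^+ 2).
have sq0 k x : 0 <= \int[P]_y (k x y ^+ 2 : R) by apply: expect_ge0 => ?; exact: sqr_ge0.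
have bsqrt k : bker k -> bmeas (fun x => Num.sqrt (\int[P]_y k x y ^+ 2)).
  move=> bk; have [mk [K kK]] := bmeas_expect_row (bker_sqr bk).
  split; first by apply: (measurableT_comp (f := @Num.sqrt R)) => //; apply: continuous_measurable_fun; exact: sqrt_continuous.
  exists (Num.sqrt K) => x; rewrite ger0_norm ?sqrtr_ge0// ler_wsqrtr//.
  by rewrite (le_trans _ (kK x))// ler_norm.
have bA : bmeas A by exact: bsqrt.
have bB : bmeas B by exact: bsqrt.
have bf : bmeas f by apply: bmeas_expect_row; exact: bmeasM.
apply: (@le_trans _ _ ((\int[P]_x (A x * B x)) ^+ 2)).
  rewrite -ler_sqrt ?sqr_ge0// !sqrtr_sqr [leRHS]ger0_norm; last first.
    by apply: expect_ge0 => x; rewrite mulr_ge0 ?sqrtr_ge0.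
  rewrite (le_trans (le_normr_Rintegral _ _))//; first exact: bmeas_integrable.
  apply: le_expect; [exact: bmeas_norm|exact: bmeasM|move=> x].
  rewrite -sqrtrM// -sqrtr_sqr ler_wsqrtr//.
  by apply: expect_CauchySchwarz; exact: bker_row.
apply: le_trans (expect_CauchySchwarz P bA bB) _.
rewrite le_eqVlt; apply/orP; left; apply/eqP; congr (_ * _);
  by apply: eq_Rintegral => x _; rewrite sqr_sqrtr.
Qed.

Lemma hs2_kcomp a b : bker a -> bker b -> hs2 (kcomp a b) <= hs2 a * hs2 b.
Proof.
move=> ba bb.
pose al x := \int[P]_z a x z ^+ 2; pose be y := \int[P]_z b z y ^+ 2.
have bal : bmeas al by apply: bmeas_expect_row; exact: bker_sqr.
have bbe : bmeas be.
  apply: (bmeas_expect_row (a := fun y z => b z y ^+ 2)); apply: bmeasX.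
  by exact: bker_comp.
have -> : hs2 b = \int[P]_y be y.
  by rewrite /hs2 (expect_fubini P P (f := fun u => b u.1 u.2 ^+ 2))//; exact: bker_sqr.
have -> : hs2 a = \int[P]_x al x by [].
have b2 := bker_sqr (bker_kcomp ba bb).
rewrite -expectZr//; apply: le_expect; first exact: bmeas_expect_row.
  by apply: bmeasM => //; exact: bmeas_cst.
move=> x; rewrite -expectZ//; apply: le_expect; first exact: (bker_row x b2).
  by apply: bmeasM => //; exact: bmeas_cst.
by move=> y; apply: expect_CauchySchwarz; [exact: bker_row|exact: bker_col].
Qed.

Section powers.
Context (g : T -> T -> R) (bg : bker g) (sg : forall x y, g x y = g y x).

Definition ktrace n : R := \int[P]_x kpow g n x x.

(** For symmetric g the Hilbert-Schmidt inner product of two powers is the trace of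
    their product. *)
Lemma kpow_inner p q :
  \int[P]_x \int[P]_y (kpow g p x y * kpow g q x y) = ktrace (p + q).+1.
Proof.
rewrite /ktrace -(kpowD p q bg); apply: eq_Rintegral => x _.
by apply: eq_Rintegral => y _; rewrite (kpow_sym q bg sg x y).
Qed.

Lemma hs2_kpow p : hs2 (kpow g p) = ktrace (p + p).+1.
Proof.
by rewrite -kpow_inner; apply: eq_Rintegral => x _; apply: eq_Rintegral => y _; rewrite expr2.
Qed.

(** Cauchy-Schwarz for the powers p + 1 and p + 3. *)
Lemma hs2_kpow_logconvex p :
  hs2 (kpow g p.+1) ^+ 2 <= hs2 (kpow g p) * hs2 (kpow g p.+2).
Proof.
rewrite hs2_kpow.
have -> : (p.+1 + p.+1 = p + p.+2)%N by rewrite !addnS addSn.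
by rewrite -kpow_inner; apply: kernel_CauchySchwarz; exact: bker_kpow.
Qed.

Lemma hs2_kpow_submul p q :
  hs2 (kpow g (p + q).+1) <= hs2 (kpow g p) * hs2 (kpow g q).
Proof. by rewrite -kpowD//; apply: hs2_kcomp; exact: bker_kpow. Qed.

End powers.

End kernel_algebra.

Section logconvex_submultiplicative.
Context (R : realType) (c : nat -> R).
Hypothesis c_gt0 : forall p, 0 < c p.
Hypothesis logconvex : forall p, c p.+1 ^+ 2 <= c p * c p.+2.
Hypothesis submul : forall p q, c (p + q).+1 <= c p * c q.

Let r p := c p.+1 / c p.

Let r_gt0 p : 0 < r p. Proof. exact: divr_gt0. Qed.

Let r_nd : nondecreasing_seq r.
Proof.
apply/nondecreasing_seqP => p; rewrite /r ler_pdivrMr// mulrAC ler_pdivlMr// -expr2 mulrC.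
exact: logconvex.
Qed.

Let r_ub p : r p <= c 0.
Proof. by rewrite /r ler_pdivrMr//; have := submul 0 p; rewrite add0n. Qed.

Let L := sup (range r).

Let r_has_sup : has_sup (range r).
Proof. by split; [exists (r 0), 0%N|exists (c 0) => _ [p _ <-]]. Qed.

Let r_le p : r p <= L.
Proof. by apply: sup_upper_bound => //; exists p. Qed.

Let L_gt0 : 0 < L. Proof. exact: lt_le_trans (r_gt0 0) (r_le 0). Qed.

Let b p := c p / L ^+ p.+1.

Let b_gt0 p : 0 < b p. Proof. by rewrite divr_gt0// exprn_gt0. Qed.

Let bS p : b p.+1 = b p * (r p / L).
Proof.
rewrite /b /r exprS; have cp := c_gt0 p; have Lp := exprn_gt0 p.+1 L_gt0.
by field; rewrite !gt_eqF.
Qed.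

Let b_ni p : b p.+1 <= b p.
Proof. by rewrite bS; apply: ler_piMr; [exact: ltW|rewrite ler_pdivrMr// mul1r]. Qed.

Let b_submul p q : b (p + q).+1 <= b p * b q.
Proof.
have -> : b p * b q = c p * c q / L ^+ (p + q).+2.
  by rewrite /b mulrACA -invfM -exprD addSn addnS.
by rewrite ler_wpM2r// invr_ge0 exprn_ge0// ltW.
Qed.

Lemma pow_lt_eps (x e : R) : 0 <= x -> x < 1 -> 0 < e ->
  exists N, forall n, (N <= n)%N -> x ^+ n < e.
Proof.
move=> x0 x1 e0; have : (fun n => x ^+ n) @ \oo --> (0 : R).
  by apply: cvg_expr; rewrite ger0_norm.
move=> /cvgrPdist_lt/(_ _ e0)[N _ HN]; exists N => n /HN.
by rewrite sub0r normrN ger0_norm ?exprn_ge0.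
Qed.

(** Were b p = rho < 1, submultiplicativity would force geometric decay of b,
    but the ratios b (j+1) / b j tend to 1. *)
Let b_ge1 p : 1 <= b p.
Proof.
rewrite leNgt; apply/negP => rho1; set rho := b p in rho1.
have rho0 : 0 < rho by exact: b_gt0.
(* A ratio s = 1 - x so close to 1 that rho < s^(p+1), by Bernoulli. *)
pose x := (1 - rho) / (2 * p.+1%:R).
have p0 : 0 < p.+1%:R :> R by rewrite ltr0n.
have x0 : 0 < x by rewrite divr_gt0 ?subr_gt0 ?mulr_gt0.
have x1 : x < 1.
  rewrite ltr_pdivrMr ?mulr_gt0// mul1r.
  have : 1 <= p.+1%:R :> R by rewrite ler1n.
  lra.
pose s := 1 - x.
have s0 : 0 < s by rewrite subr_gt0.
have bern n : 1 - n%:R * x <= s ^+ n.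
  elim: n => [|n IH]; first by rewrite mul0r subr0 expr0.
  rewrite exprS -natr1.
  have : 0 <= n%:R * x * x by apply: mulr_ge0; [apply: mulr_ge0; [exact: ler0n|exact: ltW]|exact: ltW].
  have : s * (1 - n%:R * x) <= s * s ^+ n by rewrite ler_wpM2l// ltW.
  rewrite /s; nra.
have srho : rho < s ^+ p.+1.
  apply: lt_le_trans (bern p.+1).
  rewrite /x; have -> : p.+1%:R * ((1 - rho) / (2 * p.+1%:R)) = (1 - rho) / 2.
    by field; rewrite gt_eqF.
  lra.
have [_ [j0 _ <-] rj0] : exists2 y, range r y & s * L < y.
  have : s * L < L by rewrite gtr_pMl// /s; lra.
  move=> sL; have := sup_adherent (eps := L - s * L) _ r_has_sup.
  rewrite subr_gt0 => /(_ sL)[y ry H]; exists y => //.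
  by move: H; rewrite -/L opprB addrCA subrr addr0.
(* From j0 on b decays no faster than s^k, but along the progression p + (p+1) q
   at least as fast as rho^(q+1). *)
have b_lo k : b j0 * s ^+ k <= b (j0 + k)%N.
  elim: k => [|k IH]; first by rewrite mulr1 addn0.
  rewrite addnS bS exprSr [leLHS]mulrA; apply: ler_pM => //.
  - by apply: mulr_ge0; [exact/ltW/b_gt0|apply: exprn_ge0; exact: ltW].
  - exact: ltW.
  by rewrite ler_pdivlMr// (le_trans (ltW rj0))// r_nd// leq_addr.
have b_hi q : b (p + p.+1 * q)%N <= rho ^+ q.+1.
  elim: q => [|q IH]; first by rewrite muln0 addn0 expr1.
  rewrite mulnS addSn addnS exprS.
  apply: le_trans (b_submul p (p + p.+1 * q)) _.
  by apply: ler_wpM2l; first exact: ltW.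
have t1 : rho / s ^+ p.+1 < 1 by rewrite ltr_pdivrMr ?mul1r ?exprn_gt0.
have t0 : 0 <= rho / s ^+ p.+1 by rewrite divr_ge0 ?ltW ?exprn_gt0.
have [N HN] := pow_lt_eps t0 t1 (b_gt0 j0).
pose q := maxn N j0.
have := HN q.+1; rewrite leqW ?leq_maxl// => /(_ isT); apply/negP; rewrite -leNgt.
rewrite expr_div_n -exprM ler_pdivlMr ?exprn_gt0//.
have kq : (j0 <= p + p.+1 * q)%N.
  by rewrite (leq_trans (leq_maxr N j0))// (leq_trans (leq_pmull q (ltn0Sn p)))// leq_addl.
apply: le_trans (b_hi q); rewrite -(subnKC kq); apply: le_trans (b_lo _).
apply: ler_wpM2l; first exact: ltW.
apply: ler_wiXn2l; [exact: ltW|by rewrite lerBlDr lerDl ltW|].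
by rewrite (leq_trans (leq_subr _ _))// mulnS leq_add2r.
Qed.

(** Log-convexity makes the ratios c (p+1) / c p nondecreasing, submultiplicativity
    bounds them by c 0; their limit L is the exact growth rate of c. *)
Lemma logconvex_submul_growth : exists2 L : R, 0 < L &
  forall p, c p.+1 / L ^+ p.+2 <= c p / L ^+ p.+1 /\ 1 <= c p / L ^+ p.+1.
Proof. by exists L => // p; split; [exact: b_ni|exact: b_ge1]. Qed.

End logconvex_submultiplicative.

Section top_eigenkernel.
Context d (T : measurableType d) (R : realType) (P : probability T R).
Context (g : T -> T -> R) (bg : bker g) (sg : forall x y, g x y = g y x).
Local Notation kpow := (kpow P).
Local Notation hs2 := (hs2 P).
Local Notation kcomp := (kcomp P).

Lemma hs2B a b : bker a -> bker b -> hs2 (fun x y => a x y - b x y) =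
  hs2 a - (\int[P]_x \int[P]_y (a x y * b x y)) *+ 2 + hs2 b.
Proof.
move=> ba bb; have bab : bker (fun x y => a x y * b x y) by exact: bmeasM.
have ba2 := bker_sqr ba; have bb2 := bker_sqr bb.
have ba2' : bker (fun x y => a x y ^+ 2 - 2 * (a x y * b x y)).
  by apply: bmeasB => //; apply: bmeasM => //; exact: bmeas_cst.
have b2' : bker (fun x y => 2 * (a x y * b x y)) by apply: bmeasM => //; exact: bmeas_cst.
transitivity (\int[P]_x \int[P]_y (a x y ^+ 2 - 2 * (a x y * b x y) + b x y ^+ 2)).
  by apply: eq_Rintegral => x _; apply: eq_Rintegral => y _; ring.
have -> : (\int[P]_x \int[P]_y (a x y ^+ 2 - 2 * (a x y * b x y) + b x y ^+ 2)) =
   \int[P]_x ((\int[P]_y a x y ^+ 2 - 2 * \int[P]_y (a x y * b x y)) + \int[P]_y b x y ^+ 2).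
  apply: eq_Rintegral => x _.
  by rewrite (expectD P (bker_row x ba2') (bker_row x bb2))
    (expectB P (bker_row x ba2) (bker_row x b2')) (expectZ P _ (bker_row x bab)).
have e1 := bmeas_expect_row P ba2; have e2 := bmeas_expect_row P bb2.
have e3 := bmeas_expect_row P bab.
have e3' : bmeas (fun x => 2 * \int[P]_y (a x y * b x y)).
  by apply: bmeasM => //; exact: bmeas_cst.
by rewrite (expectD P (bmeasB e1 e3') e2) (expectB P e1 e3') (expectZ P 2 e3) mulr_natl.
Qed.

(** Cauchy-Schwarz against the constant kernel 1. *)
Lemma norm_expect2_le a : bker a -> `|\int[P]_x \int[P]_y a x y| <= Num.sqrt (hs2 a).
Proof.
move=> ba; rewrite -sqrtr_sqr ler_wsqrtr//.
have b1 : bker (fun _ _ : T => 1 : R) by exact: bmeas_cst.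
have := kernel_CauchySchwarz P ba b1.
have -> : hs2 (fun _ _ => 1) = 1.
  rewrite /hs2; under eq_Rintegral do (under eq_Rintegral do rewrite expr1n; rewrite expect_cst).
  by rewrite expect_cst.
rewrite mulr1; apply: le_trans.
rewrite le_eqVlt; apply/orP; left; apply/eqP; congr (_ ^+ 2).
by apply: eq_Rintegral => x _; apply: eq_Rintegral => y _; rewrite mulr1.
Qed.

Lemma kcomp3E a (x y : T) : bker a ->
  kcomp g (kcomp a g) x y = \int[P]_u \int[P]_v (g x u * (a u v * g v y)).
Proof.
move=> ba; apply: eq_Rintegral => u _; rewrite -expectZ//.
by apply: bmeasM; [exact: bker_row|exact: bker_col].
Qed.

(** Composing with g on both sides turns Hilbert-Schmidt convergence of kernels
    into uniform convergence. *)
Lemma kcomp3_sup a B : bker a -> (forall x y, `|g x y| <= B) ->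
  forall x y, `|kcomp g (kcomp a g) x y| <= B ^+ 2 * Num.sqrt (hs2 a).
Proof.
move=> ba gB x y; have B0 : 0 <= B := le_trans (normr_ge0 _) (gB x x).
rewrite kcomp3E//.
have bx : bmeas (fun z : T * T => g x z.1).
  by apply: (bmeas_comp (bker_row x bg)); exact: measurable_fst.
have by' : bmeas (fun z : T * T => g z.2 y).
  by apply: (bmeas_comp (bker_col y bg)); exact: measurable_snd.
have bk : bker (fun u v => g x u * (a u v * g v y)).
  by apply: bmeasM => //; apply: bmeasM.
apply: le_trans (norm_expect2_le bk) _.
have -> : B ^+ 2 * Num.sqrt (hs2 a) = Num.sqrt (B ^+ 4 * hs2 a).
  by rewrite sqrtrM ?exprn_ge0// -[4%N]/(2 * 2)%N exprM sqrtr_sqr ger0_norm// exprn_ge0.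
rewrite ler_wsqrtr//.
have bk2 := bker_sqr bk; have ba2 := bker_sqr ba.
have bB : bker (fun u v => B ^+ 4 * a u v ^+ 2) by apply: bmeasM => //; exact: bmeas_cst.
have -> : B ^+ 4 * hs2 a = \int[P]_u \int[P]_v (B ^+ 4 * a u v ^+ 2).
  rewrite -expectZ; last exact: bmeas_expect_row.
  by apply: eq_Rintegral => u _; rewrite -expectZ//; exact: bker_row ba2.
apply: le_expect; [exact: bmeas_expect_row|exact: bmeas_expect_row|move=> u].
apply: le_expect; [exact: bker_row bk2|exact: bker_row bB|move=> v].
rewrite !exprMn.
have sq z t : g z t ^+ 2 <= B ^+ 2 by rewrite -[leLHS]real_normK ?num_real// lerXn2r ?nnegrE.
have := sq x u; have := sq v y; have := sqr_ge0 (a u v); have := sqr_ge0 (g x u).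
have := sqr_ge0 (g v y) => h1 h2 h3 h4 h5.
have -> : g x u ^+ 2 * (a u v ^+ 2 * g v y ^+ 2) =
  (g x u ^+ 2 * g v y ^+ 2) * a u v ^+ 2 by ring.
have -> : B ^+ 4 = B ^+ 2 * B ^+ 2 by ring.
by rewrite ler_wpM2r// ler_pM.
Qed.

Lemma kcompZr a b s : bker a -> bker b ->
  kcomp a (fun x y => b x y * s) = fun x y => kcomp a b x y * s.
Proof.
move=> ba bb; apply/funext => x; apply/funext => y; rewrite /kcomp -expectZr.
  by apply: eq_Rintegral => z _; rewrite mulrA.
by apply: bmeasM; [exact: bker_row|exact: bker_col].
Qed.

Lemma kcompZl a b s : bker a -> bker b ->
  kcomp (fun x y => a x y * s) b = fun x y => kcomp a b x y * s.
Proof.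
move=> ba bb; apply/funext => x; apply/funext => y; rewrite /kcomp -expectZr.
  by apply: eq_Rintegral => z _; rewrite mulrAC.
by apply: bmeasM; [exact: bker_row|exact: bker_col].
Qed.

Lemma kcompBl a b c : bker a -> bker b -> bker c ->
  kcomp (fun x y => a x y - b x y) c = fun x y => kcomp a c x y - kcomp b c x y.
Proof.
move=> ba bb bc; apply/funext => x; apply/funext => y; rewrite /kcomp -expectB.
- by apply: eq_Rintegral => z _; rewrite mulrBl.
- by apply: bmeasM; [exact: bker_row|exact: bker_col].
- by apply: bmeasM; [exact: bker_row|exact: bker_col].
Qed.

Lemma kcompBr a b c : bker a -> bker b -> bker c ->
  kcomp c (fun x y => a x y - b x y) = fun x y => kcomp c a x y - kcomp c b x y.
Proof.
move=> ba bb bc; apply/funext => x; apply/funext => y; rewrite /kcomp -expectB.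
- by apply: eq_Rintegral => z _; rewrite mulrBr.
- by apply: bmeasM; [exact: bker_row|exact: bker_col].
- by apply: bmeasM; [exact: bker_row|exact: bker_col].
Qed.

Section growth.
Context (L : R) (L_gt0 : 0 < L).
Local Notation c p := (hs2 (kpow g p)).
Hypothesis c_ni : forall p, c p.+1 / L ^+ p.+2 <= c p / L ^+ p.+1.
Hypothesis c_ge1 : forall p, 1 <= c p / L ^+ p.+1.

Let E p : T -> T -> R := fun x y => kpow g (p + p).+1 x y / L ^+ p.+1.

Let bE p : bker (E p).
Proof. by apply: bmeasM; [exact: bker_kpow|exact: bmeas_cst]. Qed.

Let E_inner p q : \int[P]_x \int[P]_y (E p x y * E q x y) =
  c (p + q).+1 / L ^+ (p + q).+2.
Proof.
have -> : (L ^+ (p + q).+2)^-1 = (L ^+ p.+1)^-1 * (L ^+ q.+1)^-1.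
  by rewrite -invfM -exprD addSn addnS.
rewrite hs2_kpow// (_ : ((p + q).+1 + (p + q).+1 = (p + p).+1 + (q + q).+1)%N); last first.
  by rewrite !addSn !addnS addnACA.
rewrite -kpow_inner// mulrC.
have bk := bmeasM (bker_kpow P (p + p).+1 bg) (bker_kpow P (q + q).+1 bg).
rewrite -expectZ; last exact: (bmeas_expect_row P bk).
apply: eq_Rintegral => x _; rewrite -expectZ; last exact: (bmeas_section1 x bk).
by apply: eq_Rintegral => y _; rewrite /E mulrACA mulrC.
Qed.

Let hs2_E p : hs2 (E p) = c (p + p).+1 / L ^+ (p + p).+2.
Proof.
rewrite -E_inner.
by apply: eq_Rintegral => x _; apply: eq_Rintegral => y _; rewrite expr2.
Qed.

Let b p := c p / L ^+ p.+1.

Let E_step p : kcomp g (kcomp (E p) g) = fun x y => L * E p.+1 x y.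
Proof.
have bk := bker_kpow P (p + p).+1 bg.
rewrite (kcompZl _ bk bg) (kcompZr _ bg (bker_kcomp P bk bg)).
have -> : kcomp (kpow g (p + p).+1) g = kpow g (p + p).+2 by rewrite (kpowD P _ 0 bg) addn0.
rewrite -[kcomp g _]/(kpow g (p + p).+3); apply/funext => x; apply/funext => y.
rewrite /E addSn addnS [L ^+ p.+2]exprS; field.
by rewrite expf_neq0 ?gt_eqF.
Qed.

Let b_cvg : cvg (b @ \oo).
Proof.
apply: nonincreasing_is_cvgn; first by apply/nonincreasing_seqP => p; exact: c_ni.
by exists 1 => _ [p _ <-]; exact: c_ge1.
Qed.

Let E_cauchy_L2 e : 0 < e -> exists N, forall p q, (N <= p)%N -> (N <= q)%N ->
  hs2 (fun x y => E p x y - E q x y) <= e.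
Proof.
move=> e0; have e4 : 0 < e / 4 by rewrite divr_gt0.
have /cvgrPdist_le/(_ _ e4)[N _ HN] := b_cvg.
exists N => p q Np Nq.
have -> : hs2 (fun x y => E p x y - E q x y) =
    b (p + p).+1 - b (p + q).+1 *+ 2 + b (q + q).+1.
  by rewrite hs2B// !hs2_E E_inner.
have NE m n : (N <= m)%N -> `|lim (b @ \oo) - b (m + n).+1| <= e / 4.
  by move=> Nm; apply: HN; rewrite /= leqW// (leq_trans Nm)// leq_addr.
have := NE p p Np; have := NE p q Np; have := NE q q Nq.
move: (lim _) (b (p + p).+1) (b (p + q).+1) (b (q + q).+1) => l x y z.
rewrite !ler_norml -mulr_natr => /andP[h1 h2] /andP[h3 h4] /andP[h5 h6].
lra.
Qed.

Let E_cauchy_sup e : 0 < e -> exists N, forall p q, (N <= p)%N -> (N <= q)%N ->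
  forall x y, `|E p x y - E q x y| <= e.
Proof.
move=> e0; have [B gB] := bg.2.
have {}gB x y : `|g x y| <= `|B| + 1.
  by rewrite (le_trans (gB (x, y)))// (le_trans (ler_norm _))// lerDl.
set B1 := `|B| + 1 in gB; have B1_gt0 : 0 < B1 by rewrite ltr_pwDr.
pose eta := (e * L / B1 ^+ 2) ^+ 2.
have eta0 : 0 < eta by rewrite exprn_gt0// divr_gt0 ?mulr_gt0 ?exprn_gt0.
have [N HN] := E_cauchy_L2 eta0.
exists N.+1 => -[//|p] [//|q]; rewrite !ltnS => Np Nq x y.
have bpq : bker (fun x y => E p x y - E q x y) by exact: (bmeasB (bE p) (bE q)).
have := kcomp3_sup bpq gB x y.
have -> : kcomp g (kcomp (fun x y => E p x y - E q x y) g) x y =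
   L * (E p.+1 x y - E q.+1 x y).
  rewrite mulrBr -(congr1 (fun f => f x y) (E_step p)) -(congr1 (fun f => f x y) (E_step q)).
  rewrite kcompBl// kcompBr//; exact: bker_kcomp.
rewrite normrM gtr0_norm// => H; rewrite -(ler_pM2l L_gt0) (le_trans H)//.
have -> : L * e = B1 ^+ 2 * Num.sqrt eta.
  rewrite sqrtr_sqr ger0_norm; last by rewrite divr_ge0 ?mulr_ge0 ?exprn_ge0 ?ltW.
  by field; rewrite gt_eqF.
apply: ler_wpM2l; first by apply: exprn_ge0; exact: ltW.
by apply: ler_wsqrtr; exact: HN.
Qed.

(** The powers of g^2 / L are Cauchy for the Hilbert-Schmidt norm, because the
    inner product of two of them depends only on the sum of the exponents and
    converges along that sum; kcomp3_sup makes the convergence uniform.  The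
    limit is fixed by g^2 / L, and it is nonzero since all norms are at least 1. *)
Lemma top_eigenkernel : exists F : T -> T -> R, [/\ bker F,
  forall x y, kcomp (kpow g 1) F x y = L * F x y & 0 < hs2 F].
Proof.
have cE x y : cvg ((fun p => E p x y) @ \oo).
  apply/cauchy_cvgP; apply: cauchy_exP => e e0.
  have e20 : 0 < e / 2 by rewrite divr_gt0.
  have [N HN] := E_cauchy_sup e20; exists (E N x y); exists N => // p /= Np.
  rewrite /ball/= (le_lt_trans (HN _ _ _ _ _ _))//.
  by rewrite ltr_pdivrMr// ltr_pMr// ltr1n.
pose F x y := lim ((fun p => E p x y) @ \oo).
have EF e : 0 < e -> exists N, forall p, (N <= p)%N -> forall x y, `|E p x y - F x y| <= e.
  move=> e0; have [N HN] := E_cauchy_sup e0; exists N => p Np x y.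
  have : (fun q => `|E p x y - E q x y|) @ \oo --> `|E p x y - F x y|.
    by apply: cvg_norm; apply: cvgB; [exact: cvg_cst|exact: cE].
  move=> /cvgr_to_le; apply.
  by exists N => // q /= Nq; exact: HN.
have bF : bker F.
  have [N /(_ N (leqnn N)) HN] := EF 1 ltr01.
  have [_ [B EB]] := bE N.
  apply: (@bmeas_cvg _ (T * T)%type _ (fun p u => E p u.1 u.2) _ (B + 1)) => [p|u|u].
  - exact: bE.
  - have -> : F u.1 u.2 = E N u.1 u.2 - (E N u.1 u.2 - F u.1 u.2) by ring.
    by rewrite (le_trans (ler_normB _ _))// lerD.
  - exact: cE.
have bB p : bker (fun x y => E p x y - F x y) by exact: (bmeasB (bE p) bF).
exists F; split => //.
  have bk1 := bker_kpow P 1 bg.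
  have [_ [B kB]] := bk1; have {}kB x y : `|kpow g 1 x y| <= B by exact: (kB (x, y)).
  have E2 p x y : kcomp (kpow g 1) (E p) x y = L * E p.+1 x y.
    rewrite kcompZr//; last exact: bker_kpow.
    have -> : kcomp (kpow g 1) (kpow g (p + p).+1) = kpow g (p + p).+3 by rewrite kpowD.
    rewrite /E addSn addnS [L ^+ p.+2]exprS; field.
    by rewrite expf_neq0 ?gt_eqF.
  move=> x y; have B0 : 0 <= B := le_trans (normr_ge0 _) (kB x y).
  apply/eqP; rewrite -subr_eq0 -normr_le0; apply/ler_addgt0Pl => e e0; rewrite addr0.
  have BL : 0 < B + L by rewrite ltr_wpDl.
  have e10 : 0 < e / (B + L) by rewrite divr_gt0.
  have [N HN] := EF _ e10.
  have -> : kcomp (kpow g 1) F x y - L * F x y =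
      - (kcomp (kpow g 1) (E N) x y - kcomp (kpow g 1) F x y) +
      L * (E N.+1 x y - F x y).
    by rewrite E2; ring.
  rewrite (le_trans (ler_normD _ _))// normrN normrM (gtr0_norm L_gt0).
  have -> : e = B * (e / (B + L)) + L * (e / (B + L)) by field; rewrite gt_eqF.
  apply: lerD; last by apply: ler_wpM2l; [exact: ltW|apply: HN; exact: leqW].
  rewrite /kcomp -expectB; [|by apply: bmeasM; [exact: bker_row|exact: bker_col]..].
  apply: norm_expect_le => [|z].
    by apply: bmeasB; apply: bmeasM; [exact: bker_row|exact: bker_col|exact: bker_row|exact: bker_col].
  by rewrite -mulrBr normrM ler_pM// HN.
have [N /(_ N (leqnn N)) HN] := EF (4^-1) ltac:(by rewrite invr_gt0).
have : 1 <= hs2 (E N) by rewrite hs2_E; exact: c_ge1.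
have bF2 := bker_sqr bF; have bEN2 := bker_sqr (bE N).
have : hs2 (E N) <= 2 * hs2 F + 8^-1.
  have bR : bker (fun x y => 2 * F x y ^+ 2 + 8^-1).
    by apply: bmeasD; [apply: bmeasM => //|]; exact: bmeas_cst.
  have -> : 2 * hs2 F + 8^-1 = \int[P]_x \int[P]_y (2 * F x y ^+ 2 + 8^-1).
    rewrite -expectZ; last exact: bmeas_expect_row.
    rewrite -[8^-1 in LHS](expect_cst P) -expectD; first last.
    - exact: bmeas_cst.
    - by apply: bmeasM; [exact: bmeas_cst|exact: bmeas_expect_row].
    apply: eq_Rintegral => x _.
    rewrite expectD ?expectZ ?expect_cst//; [exact: (bker_row x bF2)| |exact: bmeas_cst].
    by apply: bmeasM; [exact: bmeas_cst|exact: (bker_row x bF2)].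
  apply: le_expect; [exact: bmeas_expect_row|exact: bmeas_expect_row|move=> x].
  apply: le_expect; [exact: (bker_row x bEN2)|exact: (bker_row x bR)|move=> y].
  have h1 : (E N x y - F x y) ^+ 2 <= 4^-1 ^+ 2.
    by rewrite -[leLHS]real_normK ?num_real// lerXn2r ?nnegrE// invr_ge0.
  have h2 := sqr_ge0 (E N x y - 2 * F x y).
  move: h1 h2; move: (E N x y) (F x y) => u v h1 h2.
  have -> : u ^+ 2 = 2 * v ^+ 2 + 2 * (u - v) ^+ 2 - (u - 2 * v) ^+ 2 by ring.
  lra.
by move=> h1 h2; lra.
Qed.

End growth.

(** A spectral radius formula.  Let L be the growth rate of the squared norms.
    From a kernel F with g^2 F = L F one gets eigenfunctions of g for L^(1/2) (the
    columns of g F + L^(1/2) F) or, should these vanish, for - L^(1/2) (the columns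
    of F).  Hence L <= t^2 when g has no eigenvalue outside [0, t]. *)
Lemma hs2_kpow_small (t s eta : R) : 0 <= t -> t < s -> 0 < eta ->
  (forall (mu : R) f, bmeas f -> mu < 0 \/ t < mu ->
    {ae P, forall x, \int[P]_z (g x z * f z) = mu * f x} ->
    \int[P]_x f x ^+ 2 = 0) ->
  exists N, forall p, (N <= p)%N -> hs2 (kpow g p) <= eta * (s ^+ 2) ^+ p.+1.
Proof.
move=> t0 ts eta0 noeig; have s0 : 0 < s by exact: le_lt_trans ts.
have [[p0 cp0]|] := pselect (exists p, hs2 (kpow g p) = 0).
  exists p0.+1 => p pp0.
  apply: (@le_trans _ _ 0); last by rewrite mulr_ge0 ?exprn_ge0 ?ltW.
  have := hs2_kpow_submul P bg p0 (p - p0.+1); rewrite cp0 mul0r.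
  by rewrite -addSn subnKC.
move=> /forallNP cn0.
have c_gt0 p : 0 < hs2 (kpow g p).
  by rewrite lt_neqAle hs2_ge0 andbT eq_sym; apply/eqP; exact: cn0.
have [L L0 Lc] := logconvex_submul_growth c_gt0 (hs2_kpow_logconvex P bg sg)
  (hs2_kpow_submul P bg).
have [F [bF GF F0]] := top_eigenkernel L0 (fun p => (Lc p).1) (fun p => (Lc p).2).
pose l := Num.sqrt L.
have l0 : 0 < l by rewrite sqrtr_gt0.
have lL : l ^+ 2 = L by rewrite sqr_sqrtr// ltW.
have lt : l <= t.
  rewrite leNgt; apply/negP => tl.
  suff F_eq0 : hs2 F = 0 by rewrite F_eq0 ltxx in F0.
  rewrite /hs2 (expect_fubini P P (f := fun u => F u.1 u.2 ^+ 2)); last exact: bker_sqr.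
  transitivity (\int[P]_y 0); last by rewrite expect_cst.
  apply: eq_Rintegral => y _ /=.
  have bGF := bker_kcomp P bg bF.
  have bFy := bker_col y bF; have bGFy := bker_col y bGF.
  (* An eigenfunction for l, as (g + l) F satisfies (g - l) (g + l) F = 0. *)
  pose f x := kcomp g F x y + l * F x y.
  have bf : bmeas f by apply: bmeasD => //; apply: bmeasM => //; exact: bmeas_cst.
  have f0 : \int[P]_x f x ^+ 2 = 0.
    apply: (noeig l) => //; first by right.
    apply: aeW => x.
    have -> : l * f x = kcomp (kpow g 1) F x y + l * kcomp g F x y.
      by rewrite /f mulrDr mulrA -expr2 lL GF addrC.
    rewrite -kcompA//.
    have -> : kcomp g (kcomp g F) x y = \int[P]_z (g x z * kcomp g F z y) by [].
    rewrite -expectZ; last first.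
      by apply: bmeasM => //; exact: bker_row.
    rewrite -expectD; first by apply: eq_Rintegral => z _; rewrite /f; ring.
      by apply: bmeasM => //; exact: bker_row.
    by apply: bmeasM; [exact: bmeas_cst|apply: bmeasM => //; exact: bker_row].
  apply: (noeig (- l)) => //; first by left; rewrite oppr_lt0.
  apply: filterS (expect_sqr0 bf f0) => x.
  by rewrite /f -/(kcomp g F x y) => /eqP; rewrite addr_eq0 mulNr => /eqP.
have Ls : L / s ^+ 2 < 1.
  rewrite ltr_pdivrMr ?exprn_gt0// mul1r -lL ltrXn2r// ?nnegrE ?ltW//.
  exact: le_lt_trans ts.
pose C := hs2 g / L ^+ 1.
have C0 : 0 < C by rewrite divr_gt0 ?exprn_gt0// (c_gt0 0).
have cC p : hs2 (kpow g p) <= C * L ^+ p.+1.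
  rewrite -ler_pdivrMr ?exprn_gt0//; elim: p => [//|p IH].
  exact: le_trans (Lc p).1 IH.
have Ls0 : 0 <= L / s ^+ 2 by rewrite divr_ge0 ?exprn_ge0 ?ltW.
have [N HN] := pow_lt_eps Ls0 Ls (divr_gt0 eta0 C0).
exists N => p Np; apply: le_trans (cC p) _.
have := HN p.+1 (leqW Np); rewrite expr_div_n => H.
have s2 : 0 < (s ^+ 2) ^+ p.+1 by do 2 apply: exprn_gt0.
by move: H; rewrite ltr_pdivrMr// mulrAC ltr_pdivlMr// mulrC => /ltW.
Qed.

End top_eigenkernel.

(** * Eigenvalues of symmetric matrices for the empirical inner product *)

Section emp_inner_theory.
Context (R : realType) (n : nat).
Implicit Types (u v w : 'cV[R]_n) (A B : 'M[R]_n).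

Lemma emp_innerC u v : emp_inner u v = emp_inner v u.
Proof. by congr (_ * _); apply: eq_bigr => i _; rewrite mulrC. Qed.

Lemma emp_innerDl u v w : emp_inner (u + v) w = emp_inner u w + emp_inner v w.
Proof.
rewrite /emp_inner -mulrDr -big_split/=; congr (_ * _).
by apply: eq_bigr => i _; rewrite mxE mulrDl.
Qed.

Lemma emp_innerZl c u w : emp_inner (c *: u) w = c * emp_inner u w.
Proof.
rewrite /emp_inner [RHS]mulrCA; congr (_ * _); rewrite mulr_sumr.
by apply: eq_bigr => i _; rewrite mxE mulrA.
Qed.

Lemma emp_inner0l w : emp_inner 0 w = 0.
Proof. by rewrite -[0](scale0r 0) emp_innerZl mul0r. Qed.

Lemma emp_innerZr c u w : emp_inner u (c *: w) = c * emp_inner u w.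
Proof. by rewrite emp_innerC emp_innerZl emp_innerC. Qed.

Lemma emp_innerDr u v w : emp_inner w (u + v) = emp_inner w u + emp_inner w v.
Proof. by rewrite !(emp_innerC w) emp_innerDl. Qed.

Lemma emp_innerBr u v w : emp_inner w (u - v) = emp_inner w u - emp_inner w v.
Proof. by rewrite emp_innerDr -scaleN1r emp_innerZr mulN1r. Qed.

Lemma emp_inner_suml I (s : seq I) (p : pred I) (F : I -> 'cV[R]_n) w :
  emp_inner (\sum_(i <- s | p i) F i) w = \sum_(i <- s | p i) emp_inner (F i) w.
Proof. by elim/big_rec2: _ => [|i x y _ <-]; rewrite ?emp_inner0l ?emp_innerDl. Qed.

Lemma emp_inner_sumr I (s : seq I) (p : pred I) (F : I -> 'cV[R]_n) w :
  emp_inner w (\sum_(i <- s | p i) F i) = \sum_(i <- s | p i) emp_inner w (F i).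
Proof. by rewrite emp_innerC emp_inner_suml; apply: eq_bigr => i _; rewrite emp_innerC. Qed.

Lemma emp_inner_ge0 u : 0 <= emp_inner u u.
Proof. by rewrite mulr_ge0// sumr_ge0// => i _; rewrite -expr2 sqr_ge0. Qed.

Lemma emp_inner_mulmxl A u v : emp_inner (A *m u) v = emp_inner u (A^T *m v).
Proof.
congr (_ * _).
under eq_bigr do rewrite mxE mulr_suml.
rewrite exchange_big; apply: eq_bigr => i _ /=.
rewrite mxE mulr_sumr; apply: eq_bigr => j _.
by rewrite mxE mulrCA mulrA.
Qed.

(** The quadratic form of s u + t v is nonnegative for all s and t. *)
Lemma emp_CauchySchwarz u v : emp_inner u v ^+ 2 <= emp_inner u u * emp_inner v v.
Proof.
have key s t : 0 <= s ^+ 2 * emp_inner u u + s * t * emp_inner u v *+ 2 + t ^+ 2 * emp_inner v v.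
  have := emp_inner_ge0 (s *: u + t *: v).
  rewrite !emp_innerDl !emp_innerDr !emp_innerZl !emp_innerZr (emp_innerC v u).
  move: (emp_inner u u) (emp_inner u v) (emp_inner v v) => a b c.
  by move=> H; apply: le_trans H _; rewrite le_eqVlt; apply/orP; left; apply/eqP; ring.
have a0 := emp_inner_ge0 u; have b0 := emp_inner_ge0 v.
move: key a0 b0; move: (emp_inner u u) (emp_inner v v) (emp_inner u v) => F a b key F0 a0.
have [a_eq0|a_neq0] := eqVneq a 0.
  have [->|b_neq0] := eqVneq b 0; first by rewrite expr0n mulr_ge0.
  have := key b (- (F + 1)); rewrite a_eq0.
  have b2 : 0 < b ^+ 2 by rewrite exprn_even_gt0.
  nra.
have a_gt0 : 0 < a by rewrite lt_neqAle eq_sym a_neq0.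
have := key a (- b); nra.
Qed.

Definition frob2 A : R := \sum_(i < n) \sum_(j < n) A i j ^+ 2.

Lemma frob2_ge0 A : 0 <= frob2 A.
Proof. by do 2 apply: sumr_ge0 => ? _; exact: sqr_ge0. Qed.

Lemma emp_inner_frob A u : emp_inner (A *m u) (A *m u) <= frob2 A * emp_inner u u.
Proof.
rewrite {1}/emp_inner [leRHS]mulrCA ler_wpM2l// /frob2 mulr_suml ler_sum// => i _.
rewrite mxE -expr2.
have n0 : (0 < n)%N := leq_ltn_trans (leq0n i) (ltn_ord i).
have nR : 0 < n%:R :> R by rewrite ltr0n.
pose a : 'cV[R]_n := \col_j A i j.
have := emp_CauchySchwarz a u.
have -> : emp_inner a u = n%:R^-1 * \sum_j A i j * u j 0.
  by congr (_ * _); apply: eq_bigr => j _; rewrite mxE.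
have -> : emp_inner a a = n%:R^-1 * \sum_j A i j ^+ 2.
  by congr (_ * _); apply: eq_bigr => j _; rewrite mxE -expr2.
rewrite /emp_inner; move: (\sum_j A i j * u j 0) (\sum_j A i j ^+ 2) (\sum_(i0 < n) u i0 0 * u i0 0) => x y z.
have n2 : 0 < n%:R^-1 ^+ 2 :> R by rewrite exprn_gt0// invr_gt0.
move: (n%:R^-1) n2 => b n2.
have -> : (b * x) ^+ 2 = b ^+ 2 * x ^+ 2 by ring.
have -> : b * y * (b * z) = b ^+ 2 * (y * z) by ring.
by rewrite ler_pM2l.
Qed.

Lemma emp_inner_frob_unit A u : emp_inner u u = 1 ->
  `|emp_inner u (A *m u)| <= Num.sqrt (frob2 A).
Proof.
move=> u1; rewrite -sqrtr_sqr ler_wsqrtr//.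
apply: le_trans (emp_CauchySchwarz _ _) _.
by rewrite u1 mul1r (le_trans (emp_inner_frob A u))// u1 mulr1.
Qed.

End emp_inner_theory.

(** N + 1 vectors of length N are linearly dependent. *)
Lemma unit_left_kernel (R : rcfType) (N : nat) (A : 'M[R]_(N.+1, N)) :
  exists2 c : 'rV[R]_N.+1, c *m A = 0 & \sum_j c 0 j ^+ 2 = 1.
Proof.
have : kermx A != 0.
  rewrite kermx_eq0; apply/negP => /eqP rk.
  by have := rank_leq_col A; rewrite rk ltnn.
case/rowV0Pn => b /sub_kermxP bA b0.
pose S := \sum_j b 0 j ^+ 2.
have S0 : 0 < S.
  rewrite lt_neqAle sumr_ge0 ?andbT => [|j _]; last exact: sqr_ge0.
  apply: contra b0; rewrite eq_sym psumr_eq0 => [/allP b0|j _]; last exact: sqr_ge0.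
  apply/eqP/rowP => j; rewrite mxE; have := b0 j (mem_index_enum _).
  by rewrite /= sqrf_eq0 => /eqP.
exists ((Num.sqrt S)^-1 *: b); first by rewrite -scalemxAl bA scaler0.
under eq_bigr do rewrite mxE exprMn exprVn sqr_sqrtr ?(ltW S0)//.
by rewrite -mulr_sumr mulVf// gt_eqF.
Qed.

Section eigenbasis.
Context (R : realType) (n : nat) (H : 'M[R]_n).
Context (lam : 'I_n -> R) (v : 'I_n -> 'cV[R]_n).
Hypothesis Hsym : H^T = H.
Hypothesis Hv : forall k, H *m v k = lam k *: v k.
Hypothesis lam_ni : forall k l : 'I_n, (k <= l)%N -> lam l <= lam k.
Hypothesis ov : forall k l, emp_inner (v k) (v l) = (k == l)%:R.

Lemma eigenbasis_expand u : u = \sum_k emp_inner (v k) u *: v k.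
Proof.
pose V : 'M[R]_n := \matrix_(i, k) v k i 0.
have VV : (n%:R^-1 *: V^T) *m V = 1%:M.
  apply/matrixP => k l; rewrite !mxE -ov /emp_inner mulr_sumr.
  by apply: eq_bigr => i _; rewrite !mxE mulrA.
have := mulmx1C VV => VV'.
rewrite -[LHS]mul1mx -VV' -mulmxA; apply/colP => i.
rewrite mxE summxE; apply: eq_bigr => k _; rewrite !mxE mulrC; congr (_ * _).
rewrite /emp_inner mulr_sumr; apply: eq_bigr => j _; rewrite !mxE mulrA//.
Qed.

Lemma eigenbasis_inner u w :
  emp_inner u w = \sum_k emp_inner (v k) u * emp_inner (v k) w.
Proof.
rewrite {1}(eigenbasis_expand u) emp_inner_suml.
by apply: eq_bigr => k _; rewrite emp_innerZl.
Qed.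

Lemma eigenbasis_parseval u : emp_inner u u = \sum_k emp_inner (v k) u ^+ 2.
Proof. by rewrite eigenbasis_inner; apply: eq_bigr => k _; rewrite expr2. Qed.

Lemma eigenbasis_mul k u : emp_inner (v k) (H *m u) = lam k * emp_inner (v k) u.
Proof. by rewrite emp_innerC emp_inner_mulmxl Hsym Hv emp_innerZr emp_innerC. Qed.

Lemma eigenbasis_quadratic u :
  emp_inner u (H *m u) = \sum_k lam k * emp_inner (v k) u ^+ 2.
Proof.
rewrite eigenbasis_inner; apply: eq_bigr => k _.
by rewrite eigenbasis_mul mulrCA expr2.
Qed.

(** Since <v_k, H f - mu f> = (lam k - mu) <v_k, f>, an almost eigenvector for mu
    has small components along the v_k with lam k far from mu. *)
Lemma residual_bound (p : pred 'I_n) (m mu : R) f : 0 < m ->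
  (forall k, p k -> m <= `|lam k - mu|) ->
  \sum_(k | p k) emp_inner (v k) f ^+ 2 <=
  (m ^+ 2)^-1 * emp_inner (H *m f - mu *: f) (H *m f - mu *: f).
Proof.
move=> m0 gap; rewrite eigenbasis_parseval mulr_sumr.
rewrite [leRHS](bigID p)/= ler_wpDr//.
  by apply: sumr_ge0 => k _; rewrite mulr_ge0 ?sqr_ge0// invr_ge0 exprn_ge0// ltW.
apply: ler_sum => k pk.
rewrite emp_innerBr eigenbasis_mul emp_innerZr -mulrBl [((_ - _) * _) ^+ 2]exprMn mulrA.
rewrite ler_peMl ?sqr_ge0// mulrC ler_pdivlMr ?exprn_gt0// mul1r.
by rewrite -[leRHS]real_normK ?num_real// lerXn2r ?nnegrE//; [exact: ltW|exact: gap].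
Qed.

(** Courant-Fischer, lower bound: a unit combination u of the almost orthonormal
    almost eigenvectors f_0, ..., f_k can be chosen orthogonal to v_0, ..., v_(k-1),
    so that <u, H u> <= lam k <u, u>. *)
Lemma eigenval_lower (k : 'I_n) (f : 'I_k.+1 -> 'cV[R]_n) (l : 'I_k.+1 -> R) (del a : R) :
  (forall i j, `|emp_inner (f i) (f j) - (i == j)%:R| <= del) ->
  (forall i j, `|emp_inner (f i) (H *m f j) - l j * (i == j)%:R| <= del) ->
  (forall i, a <= l i) -> k.+1%:R ^+ 2 * del < a ->
  a - k.+1%:R ^+ 2 * del <= lam k * (1 + k.+1%:R ^+ 2 * del).
Proof.
move=> ff fHf al ka.
have widen (j : 'I_k) : (j < n)%N := ltn_trans (ltn_ord j) (ltn_ord k).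
pose vv (j : 'I_k) := v (Ordinal (widen j)).
have [c cA c1] := unit_left_kernel (\matrix_(i < k.+1, j < k) emp_inner (f i) (vv j)).
pose u := \sum_i c 0 i *: f i.
(* An entrywise error del in a form of size k + 1 costs (k + 1)^2 del on unit
   vectors. *)
have quad (B : 'I_k.+1 -> 'I_k.+1 -> R) (e : 'I_k.+1 -> R) :
    (forall i j, `|B i j - e j * (i == j)%:R| <= del) ->
    `|\sum_i \sum_j c 0 i * c 0 j * B i j - \sum_i e i * c 0 i ^+ 2| <= k.+1%:R ^+ 2 * del.
  move=> Bd.
  have -> : \sum_i e i * c 0 i ^+ 2 = \sum_i \sum_j c 0 i * c 0 j * (e j * (i == j)%:R).
    apply: eq_bigr => i _; rewrite (bigD1 i)//= eqxx big1 ?addr0 => [|j ji].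
      by rewrite mulr1 mulrC expr2.
    by rewrite eq_sym (negbTE ji) !mulr0.
  rewrite -sumrB; have -> : k.+1%:R ^+ 2 * del = \sum_(i < k.+1) \sum_(j < k.+1) del.
    by rewrite !sumr_const !card_ord -mulrnA -[RHS]mulr_natl natrM expr2.
  rewrite (le_trans (ler_norm_sum _ _ _))// ler_sum// => i _.
  rewrite -sumrB (le_trans (ler_norm_sum _ _ _))// ler_sum// => j _.
  rewrite -mulrBr normrM (le_trans _ (Bd i j))// ler_piMl// normrM.
  have cle1 (q : 'I_k.+1) : `|c 0 q| <= 1.
    rewrite -[leRHS]sqrtr1 -sqrtr_sqr ler_wsqrtr// -c1 (bigD1 q)//= lerDl.
    by apply: sumr_ge0 => ? _; exact: sqr_ge0.
  by rewrite mulr_ile1.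
have uu : emp_inner u u = \sum_i \sum_j c 0 i * c 0 j * emp_inner (f i) (f j).
  rewrite emp_inner_suml; apply: eq_bigr => i _; rewrite emp_innerZl emp_inner_sumr mulr_sumr.
  by apply: eq_bigr => j _; rewrite emp_innerZr mulrA.
have uHu : emp_inner u (H *m u) = \sum_i \sum_j c 0 i * c 0 j * emp_inner (f i) (H *m f j).
  rewrite emp_inner_suml; apply: eq_bigr => i _.
  rewrite emp_innerZl mulmx_sumr emp_inner_sumr mulr_sumr.
  by apply: eq_bigr => j _; rewrite -scalemxAr emp_innerZr mulrA.
have uv (j : 'I_n) : (j < k)%N -> emp_inner (v j) u = 0.
  move=> jk; have := congr1 (fun A : 'rV[R]_k => A 0 (Ordinal jk)) cA.
  rewrite !mxE => <-; rewrite emp_innerC emp_inner_suml; apply: eq_bigr => i _.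
  rewrite emp_innerZl mxE; congr (_ * emp_inner _ (v _)).
  exact: val_inj.
have upper : emp_inner u (H *m u) <= lam k * emp_inner u u.
  rewrite eigenbasis_quadratic eigenbasis_parseval mulr_sumr ler_sum// => j _.
  have [jk|kj] := ltnP j k; first by rewrite uv// expr0n !mulr0.
  by rewrite ler_wpM2r ?sqr_ge0// lam_ni.
have := quad (fun i j => emp_inner (f i) (f j)) (fun=> 1).
rewrite -uu => /(_ _)/wrap[|q1]; first by move=> i j; rewrite mul1r.
have := quad _ l fHf; rewrite -uHu => q2.
have la : a <= \sum_i l i * c 0 i ^+ 2.
  rewrite -[a]mulr1 -c1 mulr_sumr ler_sum// => i _.
  by rewrite ler_wpM2r ?sqr_ge0.
have {}q1 : `|emp_inner u u - 1| <= k.+1%:R ^+ 2 * del.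
  by move: q1; under eq_bigr do rewrite mul1r; rewrite c1.
have := emp_inner_ge0 u.
move: upper q1 q2 la ka; move: (emp_inner u u) (emp_inner u (H *m u)) (\sum_i l i * _) (k.+1%:R ^+ 2 * del) (lam k).
move=> U V S K lk upper; rewrite !ler_norml => /andP[a1 a2] /andP[a3 a4] aS Ka U0.
have V0 : 0 < V by lra.
have lk0 : 0 < lk.
  rewrite ltNge; apply/negP => lk0.
  by have := mulr_le0_ge0 lk0 U0; rewrite leNgt (lt_le_trans V0 upper).
apply: (@le_trans _ _ V); first lra.
by apply: le_trans upper _; rewrite ler_pM2l//; lra.
Qed.

(** Courant-Fischer, upper bound: a unit vector of the span of v_0, ..., v_N can be
    chosen orthogonal to the N vectors f_i. *)
Lemma eigenval_upper (N : 'I_n) (f : 'I_N -> 'cV[R]_n) :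
  exists u, [/\ emp_inner u u = 1, forall i, emp_inner (f i) u = 0 &
    lam N <= emp_inner u (H *m u)].
Proof.
have widen (j : 'I_N.+1) : (j < n)%N := leq_trans (ltn_ord j) (ltn_ord N).
pose vv (j : 'I_N.+1) := v (Ordinal (widen j)).
have [c cA c1] := unit_left_kernel (\matrix_(j < N.+1, i < N) emp_inner (vv j) (f i)).
pose u := \sum_j c 0 j *: vv j.
have vu (j : 'I_n) : emp_inner (v j) u = if insub (j : nat) is Some j' then c 0 j' else 0.
  rewrite emp_inner_sumr; case: insubP => [j' _ jj'|/= jN].
    rewrite (bigD1 j')//= big1 ?addr0 => [|i ij]; rewrite emp_innerZr ov.
      by rewrite -val_eqE /= jj' eqxx mulr1.
    by rewrite -val_eqE /= -jj' eq_sym (inj_eq val_inj) (negbTE ij) mulr0.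
  rewrite big1// => i _; rewrite emp_innerZr ov.
  case: eqP => [ji|_]; last by rewrite mulr0.
  by move: jN; rewrite ji /= ltn_ord.
have vvu j : emp_inner (vv j) u = c 0 j.
  by rewrite vu; case: insubP => [j' _ /val_inj ->//|/=]; rewrite ltn_ord.
have uu : emp_inner u u = 1.
  rewrite emp_inner_suml -c1; apply: eq_bigr => j _.
  by rewrite emp_innerZl vvu expr2.
exists u; split => //.
  move=> i; have := congr1 (fun A : 'rV[R]_N => A 0 i) cA.
  rewrite !mxE => <-; rewrite emp_inner_sumr; apply: eq_bigr => j _.
  by rewrite emp_innerZr mxE emp_innerC.
rewrite eigenbasis_quadratic -[leLHS]mulr1 -uu eigenbasis_parseval mulr_sumr ler_sum// => j _.
rewrite vu; case: insubP => [j' jN _|_]; last by rewrite expr0n !mulr0.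
by rewrite ler_wpM2r ?sqr_ge0// lam_ni.
Qed.

End eigenbasis.

(** By Cauchy-Schwarz <u, A u>^2 <= <u, A^2 u>; iterating this r times bounds the
    quadratic form of A_0 by the 2^r-th root of the norm of A_r when each A_(i+1)
    is close to the square of A_i.  The factor 1 + eta survives squaring because
    (1 + eta)^2 >= (1 + eta) + eta. *)
Lemma quadratic_squaring (R : realType) (n : nat) (A : nat -> 'M[R]_n) (u : 'cV[R]_n)
    (t eta : R) (r : nat) : 0 < t -> 0 <= eta ->
  (forall i, (A i)^T = A i) -> emp_inner u u = 1 ->
  (forall i, (i < r)%N -> Num.sqrt (frob2 (A i *m A i - A i.+1)) <= eta * t ^+ (2 ^ i.+1)) ->
  Num.sqrt (frob2 (A r)) < (1 + eta) * t ^+ (2 ^ r) ->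
  emp_inner u (A 0%N *m u) < (1 + eta) * t.
Proof.
move=> t0 eta0 Asym u1 AA Ar; rewrite ltNge; apply/negP => q0.
have q i : (i <= r)%N -> (1 + eta) * t ^+ (2 ^ i) <= emp_inner u (A i *m u).
  elim: i => [_|i IH ir]; first by rewrite expn0 expr1.
  have {}IH := IH (ltnW ir).
  have q2 : emp_inner u (A i *m u) ^+ 2 <= emp_inner u (A i.+1 *m u) + eta * t ^+ (2 ^ i.+1).
    apply: le_trans (emp_CauchySchwarz _ _) _; rewrite u1 mul1r.
    rewrite emp_inner_mulmxl Asym mulmxA.
    have -> : A i *m A i = A i.+1 + (A i *m A i - A i.+1) by rewrite addrC subrK.
    rewrite mulmxDl emp_innerDr lerD2l (le_trans (ler_norm _))//.
    by rewrite (le_trans (emp_inner_frob_unit _ u1))// AA.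
  have tt : t ^+ (2 ^ i.+1) = t ^+ (2 ^ i) * t ^+ (2 ^ i) by rewrite expnS mul2n -addnn exprD.
  move: IH q2; rewrite tt; have := exprn_gt0 (2 ^ i) t0.
  move: (t ^+ _) (emp_inner u (A i *m u)) (emp_inner u (A i.+1 *m u)) => s x y s0 IH q2.
  have : ((1 + eta) * s) ^+ 2 <= x ^+ 2 by rewrite lerXn2r ?nnegrE ?mulr_ge0 ?addr_ge0// ?ltW// (lt_le_trans _ IH)// mulr_gt0// ltr_wpDr.
  have : 0 <= eta ^+ 2 * (s * s) by rewrite mulr_ge0 ?sqr_ge0// mulr_ge0// ltW.
  rewrite !exprMn; nra.
have := q r (leqnn r); rewrite leNgt => /negP; apply.
apply: le_lt_trans Ar; apply: le_trans (ler_norm _) _.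
exact: emp_inner_frob_unit.
Qed.

(** * The Gaussian law: affine images, stability and moments *)

Section lebesgue_affine.
Context (R : realType).
Local Notation mu := (@lebesgue_measure R).

Lemma lebesgue_affine_itv (c m a b : R) : c != 0 -> a <= b ->
  mu ((fun x => c * x + m) @^-1` `]a, b]%classic) = (`|c|^-1 * (b - a))%:E.
Proof.
move=> c0 ab; have [cgt0|clt0|ceq0] := ltgtP 0 c.
- have -> : (fun x => c * x + m) @^-1` `]a, b]%classic =
    `](a - m) / c, (b - m) / c]%classic.
    apply/seteqP; split => x /=; rewrite !in_itv/= ltr_pdivrMr// ler_pdivlMr// mulrC;
      by rewrite ltrBlDr lerBrDr.
  rewrite lebesgue_measure_itv/= lte_fin ltr_pM2r ?invr_gt0// ltrD2r.
  rewrite gtr0_norm//; case: ifPn => [_|].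
    by rewrite -EFinB -mulrBl mulrC; congr ((_ * _)%:E); ring.
  by rewrite -leNgt => ba; have -> : a = b by [apply/eqP; rewrite eq_le ab ba]; rewrite subrr mulr0.
- have -> : (fun x => c * x + m) @^-1` `]a, b]%classic =
    `[(b - m) / c, (a - m) / c[%classic.
    apply/seteqP; split => x /=; rewrite !in_itv/= ltr_ndivlMr// ler_ndivrMr// mulrC;
      by rewrite ltrBlDr lerBrDr andbC.
  rewrite lebesgue_measure_itv/= lte_fin ltr_nM2r ?invr_lt0// ltrD2r.
  rewrite ltr0_norm//; case: ifPn => [_|].
    by rewrite -EFinB -mulrBl mulrC invrN; congr (_%:E); ring.
  by rewrite -leNgt => ba; have -> : a = b by [apply/eqP; rewrite eq_le ab ba]; rewrite subrr mulr0.
- by rewrite ceq0 eqxx in c0.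
Qed.

Lemma measurable_affine (c m : R) : measurable_fun [set: R] (fun x => c * x + m).
Proof. by apply: measurable_funD => //; exact: measurable_funM. Qed.

(** |c| times the image of Lebesgue measure under x |-> c x + m agrees with Lebesgue
    measure on intervals. *)
Lemma integral_lebesgue_affine (c m : R) (f : R -> \bar R) : c != 0 ->
  measurable_fun setT f -> (forall x, 0 <= f x)%E ->
  (\int[mu]_x f x = `|c|%:E * \int[mu]_x f (c * x + m)%R)%E.
Proof.
move=> c0 mf f0.
pose aff (x : measurableTypeR R) : measurableTypeR R := c * x + m.
have maff : measurable_fun setT aff by exact: measurable_affine.
have nc : 0 <= `|c| by [].
pose nu := mscale (NngNum nc) (pushforward mu aff).
transitivity (\int[nu maff]_x f x)%E.
  apply: eq_measure_integral => A mA _.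
  apply: (lebesgue_measure_unique (mu := nu maff)) => // _ [[a b] /= _ <-].
  have [ab|ba] := leP a b; last by rewrite set_itv_ge ?bnd_simp -?leNgt ?ltW// !measure0.
  rewrite /nu /mscale /= [pushforward _ _ _]lebesgue_affine_itv//.
  rewrite lebesgue_measure_itv/= -EFinM mulrA divff ?normr_eq0// mul1r lte_fin EFinB.
  case: ifPn => //; rewrite -leNgt => ba.
  have -> : a = b by apply/eqP; rewrite eq_le ab ba.
  by rewrite subee.
rewrite ge0_integral_mscale//; congr (_ * _)%E.
by rewrite ge0_integral_pushforward.
Qed.

End lebesgue_affine.

Section normal.
Context (R : realType).
Local Notation mu := (@lebesgue_measure R).
Local Notation gam := (@normal_prob R 0 1).
Implicit Types (f : R -> \bar R) (m s x z : R).

(** Almost everywhere, the density is the Radon-Nikodym derivative with respect to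
    Lebesgue measure. *)
Lemma ge0_integral_normal m s f : measurable_fun setT f -> (forall x, 0 <= f x)%E ->
  (\int[normal_prob m s]_x f x = \int[mu]_x (f x * (normal_pdf m s x)%:E))%E.
Proof.
move=> mf f0; have dom := normal_prob_dominates m s.
rewrite -(Radon_Nikodym_SigmaFinite.change_of_variables dom f0)//.
apply: ae_eq_integral => //.
- apply: emeasurable_funM => //.
  exact: (measurable_int mu (Radon_Nikodym_SigmaFinite.f_integrable dom)).
- apply: emeasurable_funM => //; apply/measurable_EFinP; exact: measurable_normal_pdf.
- have : ae_eq mu setT (Radon_Nikodym_SigmaFinite.f (normal_prob m s) mu)
     (fun x => (normal_pdf m s x)%:E).
    apply: integral_ae_eq => //.
    + exact: Radon_Nikodym_SigmaFinite.f_integrable.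
    + by apply/measurable_EFinP; exact: measurable_normal_pdf.
    + by move=> E _ mE; rewrite -Radon_Nikodym_SigmaFinite.f_integral.
  by apply: filterS => x /= H /H ->.
Qed.

Lemma normal_peakM s : 0 < s -> s * normal_peak s = normal_peak 1 :> R.
Proof.
move=> s0; rewrite /normal_peak expr1n mul1r -mulrnAr sqrtrM ?sqr_ge0// sqrtr_sqr.
by rewrite gtr0_norm// invfM mulrA divff ?gt_eqF// mul1r.
Qed.

Lemma normal_pdf_affine m s x : 0 < s ->
  s * normal_pdf m s (s * x + m) = normal_pdf 0 1 x.
Proof.
move=> s0; rewrite !normal_pdfE ?gt_eqF// mulrA normal_peakM//; congr (_ * _).
rewrite /normal_fun; congr expR; rewrite expr1n addrK subr0 -(mulr_natr (s ^+ 2)) -(mulr_natr 1).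
by field; rewrite gt_eqF.
Qed.

Lemma ge0_integral_normal_affine m s f : 0 < s -> measurable_fun setT f ->
  (forall x, 0 <= f x)%E ->
  (\int[normal_prob m s]_x f x = \int[gam]_x f (s * x + m)%R)%E.
Proof.
move=> s0 mf f0; have sn0 : s != 0 by rewrite gt_eqF.
have mg : measurable_fun setT (fun x => f x * (normal_pdf m s x)%:E)%E.
  by apply: emeasurable_funM => //; apply/measurable_EFinP; exact: measurable_normal_pdf.
have mfa : measurable_fun setT (fun x => f (s * x + m)%R).
  by apply: (measurableT_comp mf); exact: measurable_affine.
have pdf0 (m' s' x : R) : (0 <= (normal_pdf m' s' x)%:E)%E by rewrite lee_fin normal_pdf_ge0.
rewrite (ge0_integral_normal m s mf f0) (ge0_integral_normal 0 1 mfa (fun x => f0 _)).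
rewrite (integral_lebesgue_affine m sn0 mg (fun x => mule_ge0 (f0 x) (pdf0 _ _ _))).
have mga : measurable_fun setT (fun x => f (s * x + m)%R * (normal_pdf m s (s * x + m)%R)%:E)%E.
  by apply: (measurableT_comp mg); exact: measurable_affine.
have s0' : (0 <= `|s|%:E)%E by rewrite lee_fin.
rewrite -(ge0_integralZl mu measurableT mga (fun x _ => mule_ge0 (f0 _) (pdf0 _ _ _)) s0').
apply: eq_integral => x _; rewrite muleCA -EFinM gtr0_norm//.
by rewrite normal_pdf_affine.
Qed.

Lemma normal_prob_affine m s (A : set R) : 0 < s -> measurable A ->
  normal_prob m s A = gam ((fun x => s * x + m) @^-1` A).
Proof.
move=> s0 mA.
have mf : measurable_fun setT (fun x : R => (\1_A x : R)%:E) by apply/measurable_EFinP; exact: measurable_indic.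
have mB : measurable ((fun x => s * x + m) @^-1` A).
  by rewrite -[X in measurable X]setTI; apply: measurable_affine.
have f0 (x : R) : (0 <= (\1_A x : R)%:E)%E by rewrite lee_fin.
have := ge0_integral_normal_affine m s0 mf f0.
rewrite (integral_indic (normal_prob m s) measurableT mA) setIT => ->.
have := integral_indic gam measurableT mB; rewrite setIT => <-.
by apply: eq_integral.
Qed.

Lemma ge0_integral_normal_sym f : measurable_fun setT f -> (forall x, 0 <= f x)%E ->
  (\int[gam]_x f x = \int[gam]_x f (- x)%R)%E.
Proof.
move=> mf f0; have N0 : -1 != 0 :> R by rewrite oppr_eq0 oner_eq0.
have mfN : measurable_fun setT (fun x => f (- x)%R) by exact: measurableT_comp.
have pdf0 (m' s' x : R) : (0 <= (normal_pdf m' s' x)%:E)%E by rewrite lee_fin normal_pdf_ge0.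
rewrite (ge0_integral_normal 0 1 mf f0) (ge0_integral_normal 0 1 mfN (fun x => f0 _)).
have mg : measurable_fun setT (fun x => f x * (normal_pdf 0 1 x)%:E)%E.
  by apply: emeasurable_funM => //; apply/measurable_EFinP; exact: measurable_normal_pdf.
rewrite (integral_lebesgue_affine 0 N0 mg (fun x => mule_ge0 (f0 x) (pdf0 _ _ _))).
rewrite normrN1 mul1e; apply: eq_integral => x _.
rewrite addr0 mulN1r; congr (_ * _%:E)%E.
by rewrite !normal_pdfE ?oner_eq0//; congr (_ * expR _); rewrite !subr0 sqrrN.
Qed.

(** If (x, y) is standard Gaussian and z = a x + b y, the joint density of (x, z) is
    written as the law of x times that of z given x, and conversely. *)
Lemma normal_pdf_complete_square a b c x z : 0 < b -> 0 < c ->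
  a ^+ 2 + b ^+ 2 = c ^+ 2 ->
  normal_pdf (a * x) b z * normal_pdf 0 1 x =
  normal_pdf 0 c z * normal_pdf (a * z / c ^+ 2) (b / c) x.
Proof.
move=> b0 c0 abc; have bc0 : 0 < b / c by rewrite divr_gt0.
rewrite !normal_pdfE ?gt_eqF// mulrACA [RHS]mulrACA; congr (_ * _).
  have peakE s : 0 < s -> normal_peak s = normal_peak 1 / s.
    by move=> s0; rewrite -(normal_peakM s0) mulrAC divff ?mul1r ?gt_eqF.
  rewrite (peakE b)// (peakE c)// (peakE (b / c))//.
  by field; rewrite !gt_eqF.
rewrite /normal_fun -!expRD; congr expR.
rewrite expr_div_n -abc !subr0 expr1n -(mulr_natr (b ^+ 2)) -(mulr_natr 1).
rewrite -(mulr_natr (a ^+ 2 + b ^+ 2)) -(mulr_natr (b ^+ 2 / _)).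
have d0 : a ^+ 2 + b ^+ 2 != 0 by rewrite abc expf_neq0// gt_eqF.
by field; rewrite d0 gt_eqF.
Qed.

Lemma measurable_normal_pdf2 a s : s != 0 ->
  measurable_fun setT (fun u : R * R => normal_pdf (a * u.1) s u.2).
Proof.
move=> s0; rewrite (_ : (fun u => _) = fun u : R * R => normal_peak s *
    expR (- (u.2 - a * u.1) ^+ 2 / (s ^+ 2 *+ 2))); last first.
  by apply/funext => u; rewrite normal_pdfE.
apply: measurable_funM => //; apply: measurableT_comp => //.
apply: measurable_funM => //; apply: measurableT_comp => //.
by apply: measurable_funX; apply: measurable_funB => //; exact: measurable_funM.
Qed.

(** After completing the square the joint density of (a x + b y, x) factors through
    the density of a x + b y, and the remaining factor is a probability density. *)
Lemma ge0_integral_normal_stable a b c f : 0 < b -> 0 < c ->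
  a ^+ 2 + b ^+ 2 = c ^+ 2 -> measurable_fun setT f -> (forall x, 0 <= f x)%E ->
  (\int[gam]_x \int[gam]_y f (a * x + b * y)%R = \int[gam]_z f (c * z)%R)%E.
Proof.
move=> b0 c0 abc mf f0.
have pdf0 (m' s' x : R) : (0 <= (normal_pdf m' s' x)%:E)%E by rewrite lee_fin normal_pdf_ge0.
have mpdf m' s' : measurable_fun setT (fun x => (normal_pdf m' s' x)%:E : \bar R).
  by apply/measurable_EFinP; exact: measurable_normal_pdf.
pose k (u : R * R) : \bar R :=
  (f u.2 * (normal_pdf (a * u.1) b u.2)%:E * (normal_pdf 0 1 u.1)%:E)%E.
have mf2 : measurable_fun setT (fun u : R * R => f u.2 * (normal_pdf (a * u.1) b u.2)%:E)%E.
  apply: emeasurable_funM; first exact: (measurableT_comp mf).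
  by apply/measurable_EFinP; apply: measurable_normal_pdf2; rewrite gt_eqF.
have mk : measurable_fun setT k.
  by apply: emeasurable_funM => //; exact: (measurableT_comp (mpdf 0 1)).
have k0 u : (0 <= k u)%E by rewrite /k !mule_ge0.
have inner x : (\int[gam]_y f (a * x + b * y)%R = \int[mu]_z (f z * (normal_pdf (a * x) b z)%:E))%E.
  rewrite -(ge0_integral_normal (a * x) b mf f0) (ge0_integral_normal_affine (a * x) b0 mf f0).
  by apply: eq_integral => y _; rewrite addrC.
under eq_integral do rewrite inner.
have mF : measurable_fun setT (fun x => \int[mu]_z (f z * (normal_pdf (a * x) b z)%:E))%E.
  by apply: (measurable_fun_fubini_tonelli_F (m2 := mu) _ mf2) => [u]; exact: mule_ge0.
have F0 x : (0 <= \int[mu]_z (f z * (normal_pdf (a * x) b z)%:E))%E.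
  by apply: integral_ge0 => z _; rewrite mule_ge0.
rewrite (ge0_integral_normal 0 1 mF F0).
transitivity (\int[mu]_x \int[mu]_z k (x, z))%E.
  apply: eq_integral => x _; have mx := measurableT_comp mf2 (pair1_measurable x).
  by rewrite -(ge0_integralZr mu measurableT mx (fun z _ => mule_ge0 (f0 z) (pdf0 _ _ _)) (pdf0 _ _ _)).
rewrite (fubini_tonelli (m1 := mu) (m2 := mu) _ mk k0).
transitivity (\int[mu]_z (f z * (normal_pdf 0 c z)%:E))%E.
  apply: eq_integral => z _; rewrite /k/=.
  under eq_integral do rewrite -muleA -EFinM (normal_pdf_complete_square _ _ b0 c0 abc) EFinM muleA.
  rewrite (ge0_integralZl mu measurableT (mpdf _ _) (fun x _ => pdf0 _ _ x) (mule_ge0 (f0 z) (pdf0 _ _ _))).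
  by rewrite integral_normal_pdf mule1.
rewrite -(ge0_integral_normal 0 c mf f0) (ge0_integral_normal_affine 0 c0 mf f0).
by apply: eq_integral => y _; rewrite addr0.
Qed.

Lemma expect_normal_stable a b c (f : R -> R) : 0 <= a -> 0 <= b -> 0 <= c ->
  a ^+ 2 + b ^+ 2 = c ^+ 2 -> bmeas f ->
  \int[gam]_x \int[gam]_y f (a * x + b * y) = \int[gam]_z f (c * z).
Proof.
move=> a0 b0 c0 abc bf.
have [b_eq0|b_neq0] := eqVneq b 0.
  have -> : c = a.
    by move: abc; rewrite b_eq0 expr0n addr0 => /eqP; rewrite eqrXn2// => /eqP.
  apply: eq_Rintegral => x _; transitivity (\int[gam]_y f (a * x)); last by rewrite expect_cst.
  by apply: eq_Rintegral => y _; rewrite b_eq0 mul0r addr0.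
have b_gt0 : 0 < b by rewrite lt_neqAle eq_sym b_neq0.
have c_gt0 : 0 < c.
  rewrite lt_neqAle c0 andbT eq_sym -sqrf_eq0 -abc paddr_eq0 ?sqr_ge0//.
  by apply/nandP; right; rewrite sqrf_eq0.
have [mf [B fB]] := bf.
pose g x := f x + B.
have bg : bmeas g by apply: bmeasD => //; exact: bmeas_cst.
have g0 x : (0 <= (g x)%:E)%E.
  by rewrite lee_fin /g; have := fB x; rewrite ler_norml => /andP[+ _]; rewrite -lerBlDr sub0r.
have maff : measurable_fun setT (fun u : R * R => a * u.1 + b * u.2).
  by apply: measurable_funD; exact: measurable_funM.
have mc : measurable_fun setT (fun z : R => c * z) by exact: measurable_funM.
have bf2 : bmeas (fun u : R * R => f (a * u.1 + b * u.2)) by exact: (bmeas_comp bf maff).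
have bg2 : bmeas (fun u : R * R => g (a * u.1 + b * u.2)) by exact: (bmeas_comp bg maff).
have bfc := bmeas_comp bf mc; have bgc := bmeas_comp bg mc.
have mg : measurable_fun setT (fun x => (g x)%:E) by apply/measurable_EFinP; exact: bg.1.
suff : \int[gam]_x \int[gam]_y g (a * x + b * y) = \int[gam]_z g (c * z).
  rewrite /g (expectD gam bfc (bmeas_cst _ B)) expect_cst.
  have -> : \int[gam]_x \int[gam]_y (f (a * x + b * y) + B) =
      \int[gam]_x \int[gam]_y f (a * x + b * y) + B.
    rewrite -[B in RHS](expect_cst gam) -(expectD gam (bmeas_expect2 gam bf2) (bmeas_cst _ _)).
    apply: eq_Rintegral => x _.
    by rewrite (expectD gam (bmeas_section1 x bf2) (bmeas_cst _ _)) expect_cst.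
  by move/addIr.
apply: EFin_inj; rewrite RintegralEfin; last exact: (bmeas_expect2 gam bg2).
rewrite RintegralEfin// -(ge0_integral_normal_stable b_gt0 c_gt0 abc mg g0).
by apply: eq_integral => x _; rewrite RintegralEfin//; exact: (bmeas_section1 x bg2).
Qed.

(** |x|^3 <= 1 + 64 exp (x^2 / 4), and exp (x^2 / 4) times the standard normal density
    is a multiple of the density of variance 2. *)
Lemma integrable_normal_cube : gam.-integrable setT (fun x => (`|x| ^+ 3)%:E).
Proof.
have m3 : measurable_fun setT (fun x : R => `|x| ^+ 3).
  by apply: measurable_funX; exact: normr_measurable.
apply/integrableP; split; first exact/measurable_EFinP.
pose s : R := Num.sqrt 2.
have s0 : 0 < s by rewrite sqrtr_gt0.
have s2 : s ^+ 2 = 2 by rewrite sqr_sqrtr.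
have mD : measurable_fun setT (fun x : R => (1 + 64 * expR (x ^+ 2 / 4))%:E).
  apply/measurable_EFinP; apply: measurable_funD => //; apply: measurable_funM => //.
  by apply: measurableT_comp => //; apply: measurable_funM => //; exact: measurable_funX.
apply: (@le_lt_trans _ _ (\int[gam]_x (1 + 64 * expR (x ^+ 2 / 4))%:E)%E).
  apply: ge0_le_integral => //.
  - by do 2 apply: measurableT_comp => //; exact/measurable_EFinP.
  - move=> x _; rewrite gee0_abs; last by rewrite lee_fin exprn_ge0.
    have e0 : (1 + x ^+ 2 / 8) ^+ 2 <= expR (x ^+ 2 / 4).
      have -> : expR (x ^+ 2 / 4) = expR (x ^+ 2 / 8) ^+ 2.
        by rewrite -expRM_natl; congr expR; field.
      by rewrite lerXn2r ?nnegrE ?expR_ge0 ?expR_ge1Dx// addr_ge0// divr_ge0 ?sqr_ge0.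
    rewrite lee_fin; apply: (@le_trans _ _ (1 + 64 * (1 + x ^+ 2 / 8) ^+ 2)); last first.
      by rewrite lerD2l ler_pM2l.
    rewrite -[x ^+ 2]real_normK ?num_real//; move: (normr_ge0 x); move: (`|x|) => y y0.
    clear -y0; have [y1|/ltW y1] := leP y 1.
      apply: (@le_trans _ _ 1); first by rewrite exprn_ile1.
      by rewrite lerDl mulr_ge0// sqr_ge0.
    have y4 : y ^+ 3 <= y ^+ 4 by rewrite [leRHS]exprS; apply: ler_peMl => //; exact: exprn_ge0.
    have -> : 64 * (1 + y ^+ 2 / 8) ^+ 2 = 64 + 16 * y ^+ 2 + y ^+ 4 by field.
    by rewrite (le_trans y4)// addrA lerDr addr_ge0// ?addr_ge0// mulr_ge0// sqr_ge0.
have mh : measurable_fun setT (fun x : R => (64 * expR (x ^+ 2 / 4))%:E).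
  apply/measurable_EFinP; apply: measurable_funM => //.
  by apply: measurableT_comp => //; apply: measurable_funM => //; exact: measurable_funX.
have h0 x : (0 <= (64 * expR (x ^+ 2 / 4))%:E)%E by rewrite lee_fin mulr_ge0// expR_ge0.
have -> : (\int[gam]_x (1 + 64 * expR (x ^+ 2 / 4))%:E =
    \int[gam]_x 1%:E + \int[gam]_x (64 * expR (x ^+ 2 / 4))%:E)%E.
  by rewrite -ge0_integralD//; try exact: mh; move=> *; exact: h0.
rewrite integral_cst//= probability_setT mule1 lte_add_pinfty ?ltry//.
rewrite (ge0_integral_normal 0 1 mh h0).
have -> : (fun x => (64 * expR (x ^+ 2 / 4))%:E * (normal_pdf 0 1 x)%:E)%E =
   (fun x => (64 * s)%:E * (normal_pdf 0 s x)%:E)%E.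
  apply/funext => x; rewrite -!EFinM; congr (_%:E).
  rewrite !normal_pdfE ?gt_eqF// -(normal_peakM s0) /normal_fun !subr0 expr1n s2.
  have -> : expR (- x ^+ 2 / (2 *+ 2)) = expR (x ^+ 2 / 4) * expR (- x ^+ 2 / (1 *+ 2)).
    by rewrite -expRD; congr expR; field.
  by ring.
rewrite integralZl//; last exact: integrable_normal_pdf.
by rewrite integral_normal_pdf mule1 ltry.
Qed.

End normal.

Section normal_moments.
Context (R : realType).
Local Notation gam := (@normal_prob R 0 1).

Lemma integrable_normal_le (f : R -> R) (C : R) : measurable_fun setT f ->
  (forall x, `|f x| <= C + `|x| ^+ 3) -> gam.-integrable setT (EFin \o f).
Proof.
move=> mf fC.
have i3 : gam.-integrable setT (fun x : R => (C + `|x| ^+ 3)%:E).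
  have := integrableD measurableT (bmeas_integrable gam (bmeas_cst _ C)) (integrable_normal_cube R).
  by apply: eq_integrable.
apply: le_integrable i3 => //; first exact/measurable_EFinP.
by move=> x _; rewrite /= lee_fin (le_trans (fC x))// ler_norm.
Qed.

Lemma integrable_normal_id : gam.-integrable setT (fun x : R => x%:E).
Proof.
apply: (@integrable_normal_le id 1) => // x.
have [x1|x1] := leP `|x| 1; first by rewrite (le_trans x1)// lerDl exprn_ge0.
rewrite (le_trans (_ : _ <= `|x| ^+ 3)) ?lerDr//.
by rewrite exprS ler_peMr// exprn_ege1// ltW.
Qed.

Lemma integrable_normal_sqr : gam.-integrable setT (fun x : R => (x ^+ 2)%:E).
Proof.
apply: (@integrable_normal_le (fun x => x ^+ 2) 1) => [|x]; first exact: measurable_funX.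
rewrite ger0_norm ?sqr_ge0// -(real_normK (num_real x)).
have [x1|x1] := leP `|x| 1.
  by rewrite (@le_trans _ _ 1)// ?exprn_ile1// lerDl exprn_ge0.
rewrite (le_trans (_ : _ <= `|x| ^+ 3)) ?lerDr//.
by rewrite [leRHS]exprS ler_peMl ?exprn_ge0// ltW.
Qed.

Lemma integral_normal_id : (\int[gam]_x x%:E = 0)%E.
Proof.
have mE : measurable_fun setT (EFin : R -> \bar R) by exact/measurable_EFinP.
rewrite integralE (ge0_integral_normal_sym (f := (EFin : R -> \bar R)^\+%E)) => [|//|//]; last first.
  exact: measurable_funepos.
have -> : (\int[gam]_x (EFin : R -> \bar R)^\+%E (- x)%R = \int[gam]_x (EFin : R -> \bar R)^\-%E x)%E.
  by apply: eq_integral => x _; rewrite funeposE funenegE EFinN.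
rewrite subee//; apply: integrable_neg_fin_num => //; exact: integrable_normal_id.
Qed.

End normal_moments.

Section same_law.
Context d1 d2 d (T1 : measurableType d1) (T2 : measurableType d2) (U : measurableType d).
Context (R : realType) (m1 : probability T1 R) (m2 : probability T2 R).
Context (X : T1 -> U) (Y : T2 -> U).
Hypotheses (mX : measurable_fun setT X) (mY : measurable_fun setT Y).
Hypothesis XY : forall A, measurable A -> m1 (X @^-1` A) = m2 (Y @^-1` A).

Lemma ge0_integral_same_law (f : U -> \bar R) : measurable_fun setT f ->
  (forall x, 0 <= f x)%E -> (\int[m1]_x f (X x) = \int[m2]_x f (Y x))%E.
Proof.
move=> mf f0.
have := ge0_integral_pushforward mX m1 measurableT mf (fun x _ => f0 x).
have := ge0_integral_pushforward mY m2 measurableT mf (fun x _ => f0 x).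
rewrite /= => <- <-.
by apply: eq_measure_integral => A mA _; exact: XY.
Qed.

Lemma integrable_same_law (f : U -> R) : measurable_fun setT f ->
  m2.-integrable setT (fun x => (f (Y x))%:E) -> m1.-integrable setT (fun x => (f (X x))%:E).
Proof.
move=> mf /integrableP[_ iY]; apply/integrableP; split.
  by apply/measurable_EFinP; exact: measurableT_comp.
rewrite (ge0_integral_same_law (f := fun x => `|(f x)%:E|%E))//.
by do 2 apply: measurableT_comp => //.
Qed.

Lemma integral_same_law (f : U -> R) : measurable_fun setT f ->
  m2.-integrable setT (fun x => (f (Y x))%:E) ->
  (\int[m1]_x (f (X x))%:E = \int[m2]_x (f (Y x))%:E)%E.
Proof.
move=> mf iY; have iX := integrable_same_law mf iY.
have mfE : measurable_fun setT (EFin \o f) by exact/measurable_EFinP.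
have e1 := integral_pushforward mX mfE (D := setT) iX measurableT.
have e2 := integral_pushforward mY mfE (D := setT) iY measurableT.
rewrite -[LHS]e1 -[RHS]e2.
by apply: eq_measure_integral => A mA _; exact: XY.
Qed.

End same_law.

Section centered_gaussian.
Context (R : realType) d (Omega : measurableType d) (Pr : probability Omega R).
Context (Z : Omega -> R).
Local Notation gam := (@normal_prob R 0 1).

(** The case s = 0 is the Dirac mass, so degenerate and proper Gaussian laws are
    treated alike. *)
Lemma gaussian_rv_affine : gaussian_rv Pr Z -> exists m s : R, 0 <= s /\
  forall A, measurable A -> Pr (Z @^-1` A) = gam ((fun x => s * x + m) @^-1` A).
Proof.
move=> [_ [m [s [s0 lawZ]]]]; exists m, s; split => // A mA.
rewrite lawZ//; case: eqVneq => [->|sn0]; last first.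
  by rewrite normal_prob_affine// lt_neqAle eq_sym sn0.
have [Am|Am] := pselect (A m).
  rewrite (_ : _ @^-1` A = setT) ?probability_setT ?diracE ?mem_set//.
  by apply/seteqP; split => // x _ /=; rewrite mul0r add0r.
rewrite (_ : _ @^-1` A = set0) ?measure0 ?diracE ?memNset//.
by apply/seteqP; split => // x /=; rewrite mul0r add0r.
Qed.

Lemma centered_gaussian (v0 : R) : gaussian_rv Pr Z -> 'E_Pr[Z]%E = 0%E ->
  covariance Pr Z Z = v0%:E -> exists s : R, [/\ 0 <= s,
    s ^+ 2 * \int[gam]_x x ^+ 2 = v0 &
    forall f : R -> R, bmeas f -> \int[Pr]_w f (Z w) = \int[gam]_x f (s * x)].
Proof.
move=> gZ EZ covZ; have [mZ _] := gZ.
have [m [s [s0 lawZ]]] := gaussian_rv_affine gZ.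
have maff : measurable_fun setT (fun x : R => s * x + m) by exact: measurable_affine.
have iaff : gam.-integrable setT (fun x : R => (s * x + m)%:E).
  have := integrableD measurableT (integrableZl measurableT s (integrable_normal_id R))
     (bmeas_integrable gam (bmeas_cst _ m)).
  by apply: eq_integrable.
have m0 : m = 0.
  have := EZ; rewrite unlock (integral_same_law mZ maff lawZ (m2 := gam) (f := id))//.
  under eq_integral do rewrite EFinD EFinM.
  rewrite integralD//=; last 2 first.
  - exact: integrableZl (integrable_normal_id R).
  - exact: (bmeas_integrable gam (bmeas_cst _ m)).
  rewrite integralZl//; last exact: integrable_normal_id.
  rewrite integral_normal_id mule0 add0e integral_cst//= probability_setT mule1.
  by case.
exists s; split => //.
  apply: EFin_inj; rewrite -covZ.
  rewrite EFinM /Rintegral fineK; last first.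
    by apply: integrable_fin_num => //; exact: integrable_normal_sqr.
  rewrite -integralZl//; last exact: integrable_normal_sqr.
  transitivity (\int[Pr]_w (Z w * Z w)%:E)%E; last first.
    rewrite [in RHS]unlock EZ [in RHS]unlock; apply: eq_integral => w _ /=.
    by rewrite fctE /= !subr0.
  rewrite (ge0_integral_same_law mZ maff lawZ (m2 := gam) (f := fun x => (x * x)%:E))//.
  - apply: eq_integral => x _; rewrite -EFinM; congr (_%:E).
    by rewrite m0 addr0 -expr2 exprMn.
  - by apply/measurable_EFinP; exact: measurable_funM.
  - by move=> x; rewrite lee_fin -expr2 sqr_ge0.
move=> f bf; rewrite /Rintegral (integral_same_law mZ maff lawZ (m2 := gam) (f := f)).
- by congr fine; apply: eq_integral => x _; rewrite m0 addr0.
- exact: bf.1.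
- exact: (bmeas_integrable gam (bmeas_comp bf maff)).
Qed.

End centered_gaussian.

(** * Central limit theorem by exchange of summands *)

Section taylor_class.
Context (R : realType).
Local Notation gam := (@normal_prob R 0 1).
Implicit Types g : R -> R.

(** Second order Taylor expansion with a uniform cubic remainder; for smooth g the
    functions g1 and g2 are g' and g'' / 2. *)
Record taylor3 g g1 g2 (C : R) : Prop := {
  taylor3_0 : bmeas g ;
  taylor3_1 : bmeas g1 ;
  taylor3_2 : bmeas g2 ;
  taylor3_le : forall x u, `|g (x + u) - g x - g1 x * u - g2 x * u ^+ 2| <= C * `|u| ^+ 3 }.

(** Convolution of g with the law of tau times a standard Gaussian variable. *)
Definition gauss_smooth (tau : R) g : R -> R := fun x => \int[gam]_z g (x + tau * z).

Let maff (tau : R) : measurable_fun setT (fun u : R * R => u.1 + tau * u.2).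
Proof. by apply: measurable_funD => //; exact: measurable_funM. Qed.

Let maff1 (tau x : R) : measurable_fun setT (fun z : R => x + tau * z).
Proof. by apply: measurable_funD => //; exact: measurable_funM. Qed.

Let bshift (tau : R) g (x : R) : bmeas g -> bmeas (fun z : R => g (x + tau * z)).
Proof. by move=> bg; apply: (bmeas_comp bg). Qed.

Lemma bmeas_gauss_smooth tau g : bmeas g -> bmeas (gauss_smooth tau g).
Proof.
move=> bg; apply: (bmeas_expect2 gam (f := fun u : R * R => g (u.1 + tau * u.2))).
by apply: (bmeas_comp bg); exact: maff.
Qed.

Lemma gauss_smooth0 g : gauss_smooth 0 g = g.
Proof.
apply/funext => x; rewrite /gauss_smooth -[RHS](expect_cst gam).
by apply: eq_Rintegral => z _; rewrite mul0r addr0.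
Qed.

Lemma gauss_smoothD a b c g : 0 <= a -> 0 <= b -> 0 <= c ->
  a ^+ 2 + b ^+ 2 = c ^+ 2 -> bmeas g ->
  gauss_smooth a (gauss_smooth b g) = gauss_smooth c g.
Proof.
move=> a0 b0 c0 abc bg; apply/funext => x.
have bgx : bmeas (fun y => g (x + y)).
  by apply: (bmeas_comp bg); exact: measurable_funD.
rewrite /gauss_smooth -(expect_normal_stable a0 b0 c0 abc bgx).
by apply: eq_Rintegral => z _; apply: eq_Rintegral => y _; rewrite addrA.
Qed.

(** Convolution averages translates of the expansion of g. *)
Lemma taylor3_gauss_smooth tau g g1 g2 C : taylor3 g g1 g2 C ->
  taylor3 (gauss_smooth tau g) (gauss_smooth tau g1) (gauss_smooth tau g2) C.
Proof.
move=> [b0 b1 b2 gC]; split; [exact: bmeas_gauss_smooth..|].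
move=> x u; rewrite /gauss_smooth.
have bz g' y : bmeas g' -> bmeas (fun z => g' (y + tau * z)) by exact: bshift.
rewrite -(expectZr gam _ (bz _ x b1)) -(expectZr gam _ (bz _ x b2)).
have c1 := bmeasM (bz _ x b1) (bmeas_cst _ u).
have c2 := bmeasM (bz _ x b2) (bmeas_cst _ (u ^+ 2)).
rewrite -(expectB gam (bz _ (x + u) b0) (bz _ x b0)).
rewrite -(expectB gam (bmeasB (bz _ (x + u) b0) (bz _ x b0)) c1).
rewrite -(expectB gam (bmeasB (bmeasB (bz _ (x + u) b0) (bz _ x b0)) c1) c2).
apply: norm_expect_le => [|z]; first by do 2 (apply: bmeasB => //); apply: bmeasB; exact: bz.
by rewrite [x + u + _]addrAC; exact: gC.
Qed.

Lemma gauss_smooth_expand tau g g1 g2 C x : 0 <= tau -> taylor3 g g1 g2 C ->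
  `|gauss_smooth tau g x - g x - g2 x * (tau ^+ 2 * \int[gam]_z z ^+ 2)| <=
  C * tau ^+ 3 * \int[gam]_z (`|z| ^+ 3).
Proof.
move=> tau0 [b0 b1 b2 gC].
pose D z := g (x + tau * z) - g x - g1 x * (tau * z) - g2 x * (tau * z) ^+ 2.
have i0 := bmeas_integrable gam (bmeasB (bshift tau x b0) (bmeas_cst _ (g x))).
have i1 : gam.-integrable setT (EFin \o (fun z => (g1 x * tau) * z)).
  by have := integrableZl measurableT (g1 x * tau) (integrable_normal_id R); apply: eq_integrable.
have i2 : gam.-integrable setT (EFin \o (fun z => (g2 x * tau ^+ 2) * z ^+ 2)).
  by have := integrableZl measurableT (g2 x * tau ^+ 2) (integrable_normal_sqr R); apply: eq_integrable.
have i3 : gam.-integrable setT (EFin \o (fun z => (C * tau ^+ 3) * `|z| ^+ 3)).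
  by have := integrableZl measurableT (C * tau ^+ 3) (integrable_normal_cube R); apply: eq_integrable.
have i01 : gam.-integrable setT (EFin \o (fun z => g (x + tau * z) - g x - (g1 x * tau) * z)).
  by have := integrableB measurableT i0 i1; apply: eq_integrable.
have DE : D = fun z => g (x + tau * z) - g x - (g1 x * tau) * z - (g2 x * tau ^+ 2) * z ^+ 2.
  by apply/funext => z; rewrite /D exprMn !mulrA.
have iD : gam.-integrable setT (EFin \o D).
  by rewrite DE; have := integrableB measurableT i01 i2; apply: eq_integrable.
have m1 : \int[gam]_z z = 0 by rewrite /Rintegral integral_normal_id.
have -> : gauss_smooth tau g x - g x - g2 x * (tau ^+ 2 * \int[gam]_z z ^+ 2) = \int[gam]_z D z.
  rewrite DE RintegralB// RintegralB//.
  rewrite (RintegralZl _ measurableT (integrable_normal_id R)) m1 mulr0 subr0.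
  rewrite (RintegralZl _ measurableT (integrable_normal_sqr R)) -mulrA.
  rewrite (expectB gam (bshift tau x b0) (bmeas_cst _ (g x))) expect_cst.
  by [].
rewrite (le_trans (le_normr_Rintegral measurableT iD))//.
rewrite -(RintegralZl _ measurableT (integrable_normal_cube R)).
apply: le_Rintegral => //.
  by apply: integrable_norm; exact: iD.
move=> z _; apply: le_trans (gC x (tau * z)) _.
by rewrite normrM exprMn mulrA (ger0_norm tau0).
Qed.

End taylor_class.

Section lindeberg.
Context (R : realType) (M : pointedMetricType R).
Context (P : probability (borel M) R).
Context d (Omega : measurableType d) (Pr : probability Omega R) (X : nat -> Omega -> M).
Hypothesis hX : iid_sample Pr P (X : nat -> Omega -> borel M).
Local Notation gam := (@normal_prob R 0 1).

Context (psi : borel M -> R) (B sig2 s : R).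
Hypotheses (bpsi : bmeas psi) (psiB : forall x, `|psi x| <= B).
Hypotheses (psi0 : \int[P]_x psi x = 0) (psi2 : \int[P]_x psi x ^+ 2 = sig2).
Hypotheses (s_ge0 : 0 <= s) (s_var : s ^+ 2 * \int[gam]_x x ^+ 2 = sig2).

Let B_ge0 : 0 <= B. Proof. exact: le_trans (psiB point). Qed.

Lemma sample_step_expand g g1 g2 C x dl : 0 <= C -> 0 <= dl -> taylor3 g g1 g2 C ->
  `|\int[P]_z g (x + dl * psi z) - g x - g2 x * (dl ^+ 2 * sig2)| <= C * dl ^+ 3 * B ^+ 3.
Proof.
move=> C0 dl0 [b0 b1 b2 gC].
have bg : bmeas (fun z => g (x + dl * psi z)).
  apply: (bmeas_comp b0); apply: measurable_funD => //; apply: measurable_funM => //.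
  exact: bpsi.1.
have bp2 := bmeasX 2 bpsi.
have bc1 := bmeasM (bmeas_cst (borel M) (g1 x * dl)) bpsi.
have bc2 := bmeasM (bmeas_cst (borel M) (g2 x * dl ^+ 2)) bp2.
have b01 := bmeasB bg (bmeas_cst (borel M) (g x)).
have -> : \int[P]_z g (x + dl * psi z) - g x - g2 x * (dl ^+ 2 * sig2) =
  \int[P]_z (g (x + dl * psi z) - g x - (g1 x * dl) * psi z - (g2 x * dl ^+ 2) * psi z ^+ 2).
  rewrite (expectB P (bmeasB b01 bc1) bc2) (expectB P b01 bc1).
  rewrite (expectB P bg (bmeas_cst _ _)) expect_cst (expectZ P _ bpsi) (expectZ P _ bp2).
  by rewrite psi0 psi2 mulr0 subr0 mulrA.
apply: norm_expect_le => [|z]; first exact: (bmeasB (bmeasB b01 bc1) bc2).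
have := gC x (dl * psi z); rewrite exprMn (mulrA (g1 x)) (mulrA (g2 x)) => /le_trans; apply.
rewrite normrM exprMn (ger0_norm dl0) (mulrA C).
by rewrite ler_wpM2l ?mulr_ge0 ?exprn_ge0// lerXn2r ?nnegrE.
Qed.

Let Sn (dl : R) j w : R := dl * \sum_(i < j) psi (X i w).

Let bS dl j : bmeas (Sn dl j).
Proof.
apply: bmeasM; first exact: bmeas_cst.
by apply: bmeas_sum => i _; apply: (bmeas_sample hX (F := fun x => psi (x i))); exact: bmeas_coord.
Qed.

Let expect_Sn_fresh dl j g : bmeas g ->
  \int[Pr]_w g (Sn dl j.+1 w) = \int[Pr]_w \int[P]_z g (Sn dl j w + dl * psi z).
Proof.
move=> bg.
pose F (x : seqspace M) : R := g (dl * \sum_(i < j.+1) psi (x i)).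
have bF : bmeas F.
  apply: (bmeas_comp bg); apply: measurable_funM => //; apply: measurable_sum => i.
  by apply: measurableT_comp; [exact: bpsi.1|exact: measurable_coord].
have -> : \int[Pr]_w g (Sn dl j.+1 w) = \int[Pr]_w F (fun i => X i w) by [].
rewrite (expect_resample hX j bF).
apply: eq_Rintegral => w _; apply: eq_Rintegral => z _.
rewrite /F big_ord_recr/= /upd eqxx mulrDr; congr (g (_ * _ + _)).
by apply: eq_bigr => i _; rewrite ltn_eqF.
Qed.

(** Exchanging one summand for a Gaussian of the same mean and variance changes the
    expectation only in the cubic term of the Taylor expansion. *)
Lemma lindeberg_step g g1 g2 C dl j : 0 <= C -> 0 <= dl -> taylor3 g g1 g2 C ->
  `|\int[Pr]_w g (Sn dl j.+1 w) - \int[Pr]_w gauss_smooth (s * dl) g (Sn dl j w)| <=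
  C * (B ^+ 3 + s ^+ 3 * \int[gam]_z (`|z| ^+ 3)) * dl ^+ 3.
Proof.
move=> C0 dl0 tg; have [b0 b1 b2 gC] := tg.
rewrite expect_Sn_fresh//.
have bg2 : bmeas (fun u : R * borel M => g (u.1 + dl * psi u.2)).
  apply: (bmeas_comp b0); apply: measurable_funD; first exact: measurable_fst.
  apply: measurable_funM => //; apply: measurableT_comp; first exact: bpsi.1.
  exact: measurable_snd.
have bl : bmeas (fun w => \int[P]_z g (Sn dl j w + dl * psi z)).
  by apply: (bmeas_comp (bmeas_expect2 P bg2)); exact: (bS dl j).1.
have br : bmeas (fun w => gauss_smooth (s * dl) g (Sn dl j w)).
  by apply: (bmeas_comp (bmeas_gauss_smooth (s * dl) b0)); exact: (bS dl j).1.
rewrite -expectB//; apply: norm_expect_le => [|w]; first exact: bmeasB.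
set x := Sn dl j w.
have h1 := sample_step_expand x C0 dl0 tg.
have h2 := gauss_smooth_expand x (mulr_ge0 s_ge0 dl0) tg.
have -> : \int[P]_z g (x + dl * psi z) - gauss_smooth (s * dl) g x =
  (\int[P]_z g (x + dl * psi z) - g x - g2 x * (dl ^+ 2 * sig2)) -
  (gauss_smooth (s * dl) g x - g x - g2 x * ((s * dl) ^+ 2 * \int[gam]_z z ^+ 2)).
  by rewrite -s_var exprMn; ring.
apply: le_trans (ler_normB _ _) _; apply: le_trans (lerD h1 h2) _.
by rewrite exprMn le_eqVlt; apply/orP; left; apply/eqP; ring.
Qed.

Lemma lindeberg g g1 g2 C n : 0 <= C -> taylor3 g g1 g2 C -> (0 < n)%N ->
  `|\int[Pr]_w g ((Num.sqrt n%:R)^-1 * \sum_(i < n) psi (X i w)) -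
    \int[gam]_z g (s * z)| <=
  C * (B ^+ 3 + s ^+ 3 * \int[gam]_z (`|z| ^+ 3)) / Num.sqrt n%:R.
Proof.
move=> C0 tg n0.
have nR : 0 < n%:R :> R by rewrite ltr0n.
pose dl : R := (Num.sqrt n%:R)^-1.
have dl0 : 0 <= dl by rewrite invr_ge0 sqrtr_ge0.
have dl2 : dl ^+ 2 = n%:R^-1 by rewrite exprVn sqr_sqrtr// ltW.
set K := C * _.
(* The standard deviation of the n - j Gaussian summands still to be replaced: u j is
   the expectation with j sample terms, and the differences telescope. *)
pose tau j : R := s * (Num.sqrt (n - j)%:R * dl).
have tau0 j : 0 <= tau j by rewrite !mulr_ge0// sqrtr_ge0.
pose u j := \int[Pr]_w gauss_smooth (tau j) g (Sn dl j w).
have ustep j : (j < n)%N -> `|u j.+1 - u j| <= K * dl ^+ 3.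
  move=> jn; have tg' := taylor3_gauss_smooth (tau j.+1) tg.
  have := lindeberg_step j C0 dl0 tg'.
  rewrite (gauss_smoothD (c := tau j))//; first exact: mulr_ge0.
    rewrite /tau !exprMn !sqr_sqrtr ?ler0n// -mulrDr; congr (_ * _).
    by rewrite -[X in X + _]mul1r -mulrDl nat1r subnSK.
  exact: taylor3_0 tg.
have un : u n = \int[Pr]_w g (dl * \sum_(i < n) psi (X i w)).
  by rewrite /u /tau subnn sqrtr0 mul0r mulr0 gauss_smooth0.
have u0 : u 0%N = \int[gam]_z g (s * z).
  rewrite /u /tau subn0 divff ?gt_eqF ?sqrtr_gt0// mulr1.
  rewrite -[RHS](expect_cst Pr); apply: eq_Rintegral => w _.
  by rewrite /Sn big_ord0 mulr0; apply: eq_Rintegral => z _; rewrite add0r.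
rewrite -/dl -un -u0 -(telescope_sumr u (leq0n n)).
apply: le_trans (ler_norm_sum _ _ _) _.
apply: (@le_trans _ _ (\sum_(0 <= j < n) K * dl ^+ 3)).
  by rewrite !big_nat; apply: ler_sum => j /andP[_ jn]; exact: ustep.
have e : n%:R * (K * (n%:R^-1 * dl)) = K * dl by rewrite mulrCA [n%:R * _]mulrA mulfV ?mul1r// gt_eqF.
by rewrite sumr_const_nat subn0 -mulr_natl exprSr dl2 e.
Qed.

End lindeberg.

(** * Reduction of weak convergence to smooth test functions *)

Section averages.
Context (R : realType).
Local Notation mu := (@lebesgue_measure R).
Implicit Types (f : R -> R) (a e x u : R).

Definition avg (e : R) f : R -> R := fun x => e^-1 * \int[mu]_(t in `]x, x + e]) f t.

Lemma continuous_itv_integrable f a b : continuous f -> mu.-integrable `[a, b] (EFin \o f).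
Proof.
move=> cf; apply: continuous_compact_integrable; first exact: segment_compact.
exact: continuous_subspaceT.
Qed.

Let F f a x := \int[mu]_(t in `[a, x]) f t.

Let F_is_derive f a x : continuous f -> a < x -> is_derive x (1 : R) (F f a) (f x).
Proof.
move=> cf ax; have xu : x < x + 1 by rewrite ltrDl.
have [] := continuous_FTC1_closed xu (continuous_itv_integrable a (x + 1) cf) ax (cf x).
by move=> dF <-; rewrite derive1E; exact/derivableP.
Qed.

Let avgE f e a x : continuous f -> 0 < e -> a <= x ->
  avg e f x = e^-1 * (F f a (x + e) - F f a x).
Proof.
move=> cf e0 ax; congr (_ * _); rewrite /F Rintegral_itvB//.
- exact: continuous_itv_integrable.
- by rewrite bnd_simp lerDl ltW.
Qed.

Lemma is_derive_avg f e x : continuous f -> 0 < e ->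
  is_derive x (1 : R) (avg e f) ((f (x + e) - f x) / e).
Proof.
move=> cf e0; pose a := x - 1.
apply: (@near_eq_is_derive _ _ _ (fun y => e^-1 * (F f a (y + e) - F f a y))).
  near=> y; rewrite (avgE (a := a))//.
  by near: y; apply: (cvgr_ge x cvg_id); rewrite /a ltrBlDr ltrDl.
have ax : a < x by rewrite /a ltrBlDr ltrDl.
have axe : a < x + e by rewrite (lt_trans ax)// ltrDl.
have d1 := F_is_derive cf ax.
have d2 : is_derive x (1 : R) (fun y => F f a (y + e)) (f (x + e)).
  have dF := F_is_derive cf axe.
  have dy : is_derive x (1 : R) (fun y : R => y + e) (1 : R).
    by apply: is_derive_eq; rewrite addr0.
  by have := @is_derive1_comp _ (F f a) (fun y => y + e) x _ _ dF dy; rewrite mulr1.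
apply: is_derive_eq.
by rewrite /= -[RHS]mulrC.
Unshelve. all: by end_near.
Qed.

Lemma avg_mean_value f e x : continuous f -> 0 < e ->
  exists c, x <= c <= x + e /\ avg e f x = f c.
Proof.
move=> cf e0; pose a := x - 1.
have ax : a < x by rewrite /a ltrBlDr ltrDl.
have xe : x <= x + e by rewrite lerDl ltW.
have [| |c] := @MVT_segment R (F f a) f x (x + e) xe.
- move=> y; rewrite in_itv/= => /andP[xy _]; apply: F_is_derive => //.
  exact: lt_trans xy.
- apply: derivable_within_continuous => y; rewrite in_itv/= => /andP[xy _].
  by have [] := F_is_derive cf (lt_le_trans ax xy).
rewrite in_itv/= => xce Fc; exists c; split => //.
by rewrite (avgE (a := a) cf e0 (ltW ax)) Fc addrAC subrr add0r mulrC mulfK ?gt_eqF.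
Qed.

(** Mean value theorem between 0 and u. *)
Lemma zero_growth (D D1 : R -> R) (K : R) k : D 0 = 0 ->
  (forall u, is_derive u (1 : R) D (D1 u)) -> (forall u, `|D1 u| <= K * `|u| ^+ k) ->
  forall u, `|D u| <= K * `|u| ^+ k.+1.
Proof.
move=> D00 dD D1K u.
have cD a b : {within `[a, b], continuous D}.
  by apply: derivable_within_continuous => y _; have [] := dD y.
have K0 : 0 <= K by have := D1K 1; rewrite normr1 expr1n mulr1; exact: le_trans.
have bound c : `|c| <= `|u| -> `|D1 c| * `|u| <= K * `|u| ^+ k.+1.
  move=> cu; rewrite exprSr mulrA ler_wpM2r// (le_trans (D1K c))//.
  by rewrite ler_wpM2l// lerXn2r ?nnegrE.
have [u0|u0] := leP 0 u.
  have [c] := MVT_segment u0 (fun y _ => dD y) (cD 0 u).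
  rewrite in_itv/= D00 !subr0 => /andP[c0 cu] ->; rewrite normrM bound//.
  by rewrite !ger0_norm.
have [c] := MVT_segment (ltW u0) (fun y _ => dD y) (cD u 0).
rewrite in_itv/= D00 !sub0r => /andP[uc c0] Dc.
rewrite -normrN Dc normrM normrN bound//.
by rewrite ler0_norm// ltr0_norm// lerN2.
Qed.

Definition lipschitz_with (L : R) f := forall x y, `|f x - f y| <= L * `|x - y|.

Lemma lipschitz_with_continuous L f : lipschitz_with L f -> continuous f.
Proof.
move=> fL x; apply/cvgrPdist_le => e e0; near=> y.
apply: le_trans (fL x y) _.
have L1 : 0 < `|L| + 1 by rewrite ltr_wpDl.
apply: (@le_trans _ _ ((`|L| + 1) * `|x - y|)).
  by rewrite ler_wpM2r// (le_trans (ler_norm _))// lerDl.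
rewrite mulrC -ler_pdivlMr//; near: y.
by apply: cvgr_dist_le; [exact: cvg_id|rewrite divr_gt0].
Unshelve. all: by end_near.
Qed.

Lemma continuous_bounded_bmeas f (B : R) : continuous f -> (forall x, `|f x| <= B) -> bmeas f.
Proof. by move=> cf fB; split; [exact: continuous_measurable_fun|exists B]. Qed.

(** Averaging f twice over windows of length e gives a C^2 function whose second
    derivative is Lipschitz, and each average moves values by at most L e. *)
Lemma lipschitz_taylor3_approx (L B e : R) f : lipschitz_with L f ->
  (forall x, `|f x| <= B) -> 0 < e -> exists g g1 g2 C, [/\ 0 <= C, taylor3 g g1 g2 C &
    forall x, `|g x - f x| <= 2 * L * e].
Proof.
move=> fL fB e0.
have L0 : 0 <= L.
  by have := fL 0 1; rewrite sub0r normrN normr1 mulr1; exact: le_trans.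
have B0 : 0 <= B := le_trans (normr_ge0 _) (fB 0).
have cf := lipschitz_with_continuous fL.
pose h := avg e f; pose h1 x := (f (x + e) - f x) / e.
have dh x : is_derive x (1 : R) h (h1 x) by exact: is_derive_avg.
have is_derive_cont (k k1 : R -> R) : (forall x, is_derive x (1 : R) k (k1 x)) -> continuous k.
  by move=> dk x; apply/differentiable_continuous; rewrite -derivable1_diffP; have [] := dk x.
have ch : continuous h := is_derive_cont _ _ dh.
have hB x : `|h x| <= B by rewrite /h; have [c [_ ->]] := avg_mean_value x cf e0.
have hf x : `|h x - f x| <= L * e.
  rewrite /h; have [c [/andP[xc cx] ->]] := avg_mean_value x cf e0.
  rewrite (le_trans (fL c x))// ler_wpM2l// ger0_norm ?subr_ge0//.
  by rewrite lerBlDr addrC.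
pose g := avg e h; pose g1 x := (h (x + e) - h x) / e.
have dg x : is_derive x (1 : R) g (g1 x) by exact: is_derive_avg.
pose g2' x := (h1 (x + e) - h1 x) / e.
have shiftd (k k1 : R -> R) (s : R) : (forall x, is_derive x (1 : R) k (k1 x)) ->
    forall x, is_derive x (1 : R) (fun y => k (y + s)) (k1 (x + s)).
  move=> dk x; have dy : is_derive x (1 : R) (fun y : R => y + s) (1 : R).
    by apply: is_derive_eq; rewrite addr0.
  by have := @is_derive1_comp _ k (fun y => y + s) x _ _ (dk (x + s)) dy; rewrite mulr1.
have dg1 x : is_derive x (1 : R) g1 (g2' x).
  have d1 := shiftd _ _ e dh x; have d2 := dh x.
  rewrite (_ : g1 = fun y => e^-1 * (h (y + e) - h y)); last by apply/funext => y; rewrite /g1 mulrC.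
  by apply: is_derive_eq; rewrite /g2' [RHS]mulrC.
have cg : continuous g := is_derive_cont _ _ dg.
have cg1 : continuous g1 := is_derive_cont _ _ dg1.
pose K := 4 * L / e ^+ 2.
have K0 : 0 <= K by apply: divr_ge0; [exact: mulr_ge0|exact: sqr_ge0].
have h1L : lipschitz_with (2 * L / e) h1.
  move=> x y; rewrite /h1 -mulrBl normrM (gtr0_norm (_ : 0 < e^-1)) ?invr_gt0//.
  rewrite [leRHS]mulrAC ler_wpM2r ?invr_ge0 ?(ltW e0)//.
  have -> : f (x + e) - f x - (f (y + e) - f y) = (f (x + e) - f (y + e)) - (f x - f y) by ring.
  apply: le_trans (ler_normB _ _) _; rewrite -mulrA mulr2n mulrDl !mul1r lerD//.
  by have := fL (x + e) (y + e); rewrite opprD addrACA subrr addr0.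
have g2L : lipschitz_with K g2'.
  move=> x y; rewrite /g2' -mulrBl normrM (gtr0_norm (_ : 0 < e^-1)) ?invr_gt0//.
  have -> : K * `|x - y| = (2 * (2 * L / e) * `|x - y|) * e^-1.
    by rewrite /K; field; rewrite gt_eqF.
  rewrite ler_wpM2r ?invr_ge0 ?(ltW e0)//.
  have -> : h1 (x + e) - h1 x - (h1 (y + e) - h1 y) =
     (h1 (x + e) - h1 (y + e)) - (h1 x - h1 y) by ring.
  apply: le_trans (ler_normB _ _) _; rewrite -mulrA mulr2n mulrDl !mul1r lerD//.
  by have := h1L (x + e) (y + e); rewrite opprD addrACA subrr addr0.
have cg2 := lipschitz_with_continuous g2L.
have quot (k : R -> R) (b : R) : (forall x, `|k x| <= b) ->
    forall x, `|(k (x + e) - k x) / e| <= (b + b) / e.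
  move=> kb x; rewrite normrM (gtr0_norm (_ : 0 < e^-1)) ?invr_gt0//.
  by rewrite ler_wpM2r ?invr_ge0 ?(ltW e0)// (le_trans (ler_normB _ _))// lerD.
exists g, g1, (fun x => g2' x / 2), K; split => //.
- split.
  + by apply: (continuous_bounded_bmeas cg (B := B)) => x; rewrite /g; have [c [_ ->]] := avg_mean_value x ch e0.
  + exact: (continuous_bounded_bmeas cg1 (quot _ _ hB)).
  + apply: bmeasM; last exact: bmeas_cst.
    exact: (continuous_bounded_bmeas cg2 (quot _ _ (quot _ _ fB))).
  move=> x u.
  (* The Taylor remainder D and its derivatives D1 and D2: D2 is Lipschitz, and each
     integration from 0 gains one power of the increment. *)
  pose D2 v := g2' (x + v) - g2' x.
  pose D1 v := g1 (x + v) - g1 x - g2' x * v.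
  pose D v := g (x + v) - g x - g1 x * v - g2' x / 2 * v ^+ 2.
  have shiftd' (k k1 : R -> R) : (forall y, is_derive y (1 : R) k (k1 y)) ->
      forall v, is_derive v (1 : R) (fun w => k (x + w)) (k1 (x + v)).
    move=> dk v; have := shiftd _ _ x dk v; rewrite addrC.
    by rewrite (_ : (fun y => k (y + x)) = fun w => k (x + w))//; apply/funext => w; rewrite addrC.
  have dD1 v : is_derive v (1 : R) D1 (D2 v).
    have d1 := shiftd' _ _ dg1 v.
    by apply: is_derive_eq; rewrite /D2 /= subr0 /GRing.scale/= mulr1.
  have dD v : is_derive v (1 : R) D (D1 v).
    have d1 := shiftd' _ _ dg v.
    apply: is_derive_eq; rewrite /D1 /= subr0 /GRing.scale/= !mulr1; congr (_ - _).
    have -> : v + v = 2 * v by ring.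
    by rewrite mulrA divfK.
  have D20 : D1 0 = 0 by rewrite /D1 addr0 mulr0 !subrr.
  have D00 : D 0 = 0 by rewrite /D addr0 !mulr0 expr0n mulr0 !subrr.
  have D2K v : `|D2 v| <= K * `|v| ^+ 1.
    by rewrite expr1 (le_trans (g2L _ _))// addrAC subrr add0r.
  exact: (zero_growth D00 dD (zero_growth D20 dD1 D2K)).
- move=> x; have [c [/andP[xc cx] gc]] := avg_mean_value x ch e0.
  rewrite -/g in gc.
  have -> : g x - f x = (h c - f c) + (f c - f x) by rewrite gc addrA subrK.
  apply: le_trans (ler_normD _ _) _; rewrite -mulrA mulr2n mulrDl !mul1r lerD//.
  rewrite (le_trans (fL c x))// ler_wpM2l// ger0_norm ?subr_ge0//.
  by rewrite lerBlDr addrC.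
Qed.

End averages.

Lemma expect_cvg d (T : measurableType d) (R : realType) (mu : probability T R)
    (fk : nat -> T -> R) (f : T -> R) (B : R) :
  (forall k, bmeas (fk k)) -> (forall k x, `|fk k x| <= B) ->
  (forall x, fk ^~ x @ \oo --> f x) ->
  (fun k => \int[mu]_x fk k x) @ \oo --> \int[mu]_x f x.
Proof.
move=> bk kB kf.
have fB x : `|f x| <= B.
  have : (fun k => `|fk k x|) @ \oo --> `|f x| by apply: cvg_norm; exact: kf.
  by move=> /cvgr_to_le; apply; exact: nearW.
have bf : bmeas f by apply: (bmeas_cvg bk fB kf).
have bB := bmeas_cst T B.
apply: fine_cvg; rewrite RintegralEfin//.
have := @dominated_cvg _ _ _ mu setT measurableT (fun k w => (fk k w)%:E)
  (fun w => (f w)%:E) (cst B%:E).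
apply.
- by move=> k; apply/measurable_EFinP; exact: (bk k).1.
- by move=> x _; apply/fine_cvgP; split; [exact: nearW|exact: kf].
- by [].
- exact: (bmeas_integrable mu bB).
- by move=> k x _; rewrite /= lee_fin.
Qed.

Section weak_convergence.
Context (R : realType).
Implicit Types f : R -> R.

(** The largest function with Lipschitz constant k below f, when k >= 0. *)
Definition infconv (k : R) f : R -> R :=
  fun x => inf (range (fun y => f y + k * `|x - y|)).

Section infconv.
Context (f : R -> R) (B k : R) (fB : forall x, `|f x| <= B) (k0 : 0 <= k).

Let lo x y : - B <= f y + k * `|x - y|.
Proof.
have := fB y; rewrite ler_norml => /andP[h _].
by rewrite (le_trans h)// lerDl mulr_ge0.
Qed.

Let lbd x : has_lbound (range (fun y => f y + k * `|x - y|)).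
Proof. by exists (- B) => _ [y _ <-]. Qed.

Lemma infconv_le_at x y : infconv k f x <= f y + k * `|x - y|.
Proof. by apply: ge_inf => //; exists y. Qed.

Lemma infconv_le x : infconv k f x <= f x.
Proof. by have := infconv_le_at x x; rewrite subrr normr0 mulr0 addr0. Qed.

Lemma le_infconv x c : (forall y, c <= f y + k * `|x - y|) -> c <= infconv k f x.
Proof.
move=> H; apply: lb_le_inf; first by exists (f x + k * `|x - x|), x.
by move=> _ [y _ <-].
Qed.

Lemma infconv_bounded x : `|infconv k f x| <= B.
Proof.
rewrite ler_norml (le_infconv (lo x))/=; apply: le_trans (infconv_le x) _.
exact: le_trans (ler_norm _) (fB x).
Qed.

Lemma infconv_lipschitz : lipschitz_with k (infconv k f).
Proof.
have half x y : infconv k f x - infconv k f y <= k * `|x - y|.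
  rewrite lerBlDl -lerBlDr; apply: le_infconv => z.
  rewrite lerBlDr (le_trans (infconv_le_at x z))// -addrA lerD2l -mulrDr ler_wpM2l//.
  by rewrite [leRHS]addrC; exact: (ler_distD y).
move=> x y; rewrite ler_norml half andbT lerNl opprB.
by rewrite distrC; exact: half.
Qed.

End infconv.

(** Points y at distance dl or more from x do not compete in the infimum once
    n dl >= 2 B, and f is close to f x at the others. *)
Lemma infconv_cvg f B x : (forall x, `|f x| <= B) -> {for x, continuous f} ->
  (fun n : nat => infconv n%:R f x) @ \oo --> f x.
Proof.
move=> fB cfx; apply/cvgrPdist_le => e e0.
have /cvgrPdist_le/(_ _ e0)/nbhs_ballP[dl /= dl0 Hdl] := cfx.
have B0 : 0 <= B := le_trans (normr_ge0 _) (fB x).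
have [N HN] : exists N : nat, 2 * B / dl <= N%:R.
  by exists (Num.bound (2 * B / dl)); rewrite ltW// archi_boundP// divr_ge0 ?mulr_ge0// ltW.
exists N => // n /= Nn.
rewrite ger0_norm ?subr_ge0; last by apply: (infconv_le fB); exact: ler0n.
rewrite lerBlDl -lerBlDr; apply: le_infconv => y.
have [xy|xy] := ltP `|x - y| dl.
  have := Hdl y xy; rewrite ler_norml => /andP[_ h].
  have : 0 <= n%:R * `|x - y| by rewrite mulr_ge0.
  by rewrite lerBlDr; lra.
apply: (@le_trans _ _ (f y + 2 * B)).
  have := fB x; have := fB y; rewrite !ler_norml => /andP[h1 _] /andP[_ h2].
  by rewrite lerBlDr; lra.
rewrite lerD2l; apply: (@le_trans _ _ (N%:R * dl)); first by rewrite -ler_pdivrMr.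
by apply: ler_pM => //; [exact: ltW|rewrite ler_nat].
Qed.

Section portmanteau.
Context d (Omega : measurableType d) (Pr : probability Omega R) (T : nat -> Omega -> R).
Context d' (Omega' : measurableType d') (Pr' : probability Omega' R) (Z : Omega' -> R).
Hypothesis mZ : measurable_fun setT Z.
Hypothesis mT : exists N, forall n, (N <= n)%N -> measurable_fun setT (T n).

(** f is the increasing limit of its Lipschitz inf-convolutions, which bound
    liminf E f(T_n) from below; the same argument applies to - f. *)
Lemma weakly_converges_lipschitz :
  (forall f (B L : R), (forall x, `|f x| <= B) -> lipschitz_with L f -> forall e, 0 < e ->
    exists N, forall n, (N <= n)%N -> `|\int[Pr]_w f (T n w) - \int[Pr']_w f (Z w)| <= e) ->
  weakly_converges Pr T Pr' Z.
Proof.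
move=> H; have [N0 mTn] := mT.
have lower f : continuous f -> bounded_fun f -> forall e, 0 < e ->
   exists N, forall n, (N <= n)%N -> \int[Pr']_w f (Z w) - e <= \int[Pr]_w f (T n w).
  move=> cf [B0 [_ fB0]] e e0.
  have [B fB] : exists B, forall x, `|f x| <= B.
    by exists (B0 + 1) => x; apply: (fB0 (B0 + 1)) => //; rewrite ltrDl.
  have bf := continuous_bounded_bmeas cf fB.
  pose fk (k : nat) := infconv k%:R f.
  have fkB k x : `|fk k x| <= B by apply: infconv_bounded; [exact: fB|exact: ler0n].
  have fkL k : lipschitz_with k%:R (fk k) by apply: infconv_lipschitz; [exact: fB|exact: ler0n].
  have bfk k : bmeas (fk k).
    exact: (continuous_bounded_bmeas (lipschitz_with_continuous (fkL k)) (fkB k)).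
  have fkf k x : fk k x <= f x by apply: (infconv_le fB); exact: ler0n.
  have e20 : 0 < e / 2 by rewrite divr_gt0.
  have [k Hk] : exists k, \int[Pr']_w f (Z w) - e / 2 <= \int[Pr']_w fk k (Z w).
    have bkZ k := bmeas_comp (bfk k) mZ.
    have := expect_cvg (mu := Pr') bkZ (fun k w => fkB k (Z w)) (fun w => infconv_cvg fB (cf (Z w))).
    move=> /cvgrPdist_le/(_ _ e20)[k _ /(_ k (leqnn k))]; rewrite ler_norml => /andP[_ h].
    by exists k; rewrite lerBlDr addrC -lerBlDr.
  have [N1 HN] := H (fk k) B k%:R (fkB k) (fkL k) _ e20.
  exists (maxn N0 N1) => n; rewrite geq_max => /andP[n0 n1].
  have bT g : bmeas g -> bmeas (fun w => g (T n w)) by move=> bg; apply: (bmeas_comp bg); exact: mTn.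
  apply: (@le_trans _ _ (\int[Pr]_w fk k (T n w))); last first.
    by apply: le_expect => //; exact: bT.
  have := HN n n1; rewrite ler_norml => /andP[h _]; lra.
move=> f cf bf; apply/cvgrPdist_le => e e0.
have cNf : continuous (fun x => - f x) by move=> x; apply: cvgN; exact: cf.
have bNf : bounded_fun (fun x => - f x).
  by case: bf => B0 [B0r fB]; exists B0; split => // B B0B x _ /=; rewrite normrN; exact: fB.
have [N1 HN1] := lower f cf bf e e0.
have [N2 HN2] := lower _ cNf bNf e e0.
exists (maxn N0 (maxn N1 N2)) => // n /=; rewrite !geq_max => /and3P[n0 n1 n2].
have [B fB] : exists B, forall x, `|f x| <= B.
  by case: bf => B0 [_ fB0]; exists (B0 + 1) => x; apply: (fB0 (B0 + 1)) => //; rewrite ltrDl.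
have bmf := continuous_bounded_bmeas cf fB.
have bfT := bmeas_comp bmf (mTn n n0); have bfZ := bmeas_comp bmf mZ.
have NE d1 (T1 : measurableType d1) (m : probability T1 R) (Y : T1 -> R) :
    bmeas (fun w => f (Y w)) -> \int[m]_w - f (Y w) = - \int[m]_w f (Y w).
  by move=> bY; rewrite -mulN1r -expectZ//; apply: eq_Rintegral => w _; rewrite mulN1r.
have h1 := HN1 n n1; have h2 := HN2 n n2.
rewrite (NE _ _ Pr _ bfT) (NE _ _ Pr' _ bfZ) in h2.
by rewrite ler_norml; apply/andP; split; lra.
Qed.

End portmanteau.
End weak_convergence.

(** * Deflation of the kernel *)

Section kernel_operator_theory.
Context (R : realType) (M : pointedMetricType R).
Context (P : probability (borel M) R).

Lemma bmeas_in_L2 (f : M -> R) : bmeas (f : borel M -> R) -> in_L2 P f.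
Proof.
move=> bf; rewrite /in_L2; apply/andP; split; rewrite inE/=; first exact: bf.1.
rewrite /finite_norm unlock /Lnorm.
apply: poweR_lty.
have b2 := bmeasX 2 (bmeas_norm bf).
have -> : (\int[P]_x (`|(EFin \o f) x| `^ 2) = \int[P]_x (`|f x| ^+ 2)%:E)%E.
  by apply: eq_integral => x _; rewrite /= powR_mulrn.
by rewrite -RintegralEfin// ltry.
Qed.

Context (h : M -> M -> R) (lam : nat -> R) (phi : nat -> M -> R).
Hypothesis h_sym : forall x y, h x y = h y x.
Hypothesis bh : @bker _ (borel M) R h.
Hypothesis hphi : kernel_eigensystem P h lam phi.
Hypothesis bphi : forall k, 0 < lam k -> bmeas (phi k : borel M -> R).

(** What remains of the Mercer expansion of h after its first N terms; the filter
    only drops zero terms, whose phi i may be unbounded. *)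
Definition deflated (N : nat) : M -> M -> R :=
  fun x y => h x y - \sum_(i < N | 0 < lam i) lam i * (phi i x * phi i y).

Let defl N : borel M -> borel M -> R := deflated N.

Lemma deflated_sym N x y : deflated N x y = deflated N y x.
Proof.
rewrite /deflated h_sym; congr (_ - _).
by apply: eq_bigr => i _; rewrite [phi i x * _]mulrC.
Qed.

Lemma bker_deflated N : @bker _ (borel M) R (deflated N).
Proof.
apply: bmeasB => //; apply: bmeas_sum => i li.
apply: bmeasM; first exact: bmeas_cst.
by apply: bmeasM; apply: (bmeas_comp (bphi li)).
Qed.

Lemma deflated_apply N x f : bmeas (f : borel M -> R) ->
  \int[P]_z (deflated N x z * f z) = \int[P]_z (h x z * f z) -
    \sum_(i < N | 0 < lam i) lam i * phi i x * \int[P]_z (phi i z * f z).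
Proof.
move=> bf; have bhx : bmeas (h x : borel M -> R) := bker_row (x : borel M) bh.
have bi i : 0 < lam i -> bmeas (fun z : borel M => lam i * phi i x * (phi i z * f z)).
  by move=> li; apply: bmeasM; [exact: bmeas_cst|apply: bmeasM => //; exact: bphi].
transitivity (\int[P]_z (h x z * f z -
    \sum_(i < N | 0 < lam i) lam i * phi i x * (phi i z * f z))).
  apply: eq_Rintegral => z _; rewrite /deflated mulrBl mulr_suml; congr (_ - _).
  by apply: eq_bigr => i _; rewrite !mulrA.
rewrite expectB; [|exact: bmeasM|by apply: bmeas_sum => i; exact: bi].
rewrite expect_sum => [|i]; last exact: bi.
congr (_ - _); apply: eq_bigr => i li.
by rewrite expectZ//; apply: bmeasM => //; exact: bphi.
Qed.

Lemma deflated_phi0 N (i : 'I_N) : 0 < lam i ->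
  {ae P, forall x : borel M, \int[P]_z (deflated N x z * phi i z) = 0}.
Proof.
move=> li; apply: filterS (eigenfun_eq hphi i) => x Hx.
rewrite deflated_apply; last exact: bphi.
rewrite -[X in X - _]/(kernel_op P h (phi i) x) Hx.
rewrite (bigD1 i)//= big1 => [|j /andP[lj ji]].
  have := eigenfun_orthonormal hphi li li; rewrite eqxx /L2_inner => ->.
  by rewrite mulr1 addr0 subrr.
have := eigenfun_orthonormal hphi lj li; rewrite /L2_inner => ->.
by rewrite (_ : (_ == _) = false) ?mulr0//; apply/negbTE; apply: contra ji => /eqP ij; apply/eqP; exact: val_inj.
Qed.

(** An eigenfunction f of the deflated operator is orthogonal to the removed phi_i,
    hence an eigenfunction of h; completeness of the eigensystem then expresses f
    through phi_k with lam k = mu, all of which were removed, so that f is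
    orthogonal to itself. *)
Lemma deflated_no_eigen N mu f : bmeas (f : borel M -> R) -> mu < 0 \/ lam N < mu ->
  {ae P, forall x : borel M, \int[P]_z (deflated N x z * f z) = mu * f x} ->
  \int[P]_x f x ^+ 2 = 0.
Proof.
move=> bf mu_out fmu.
have mu0 : mu != 0.
  case: mu_out => [|lm]; first by move=> /lt_eqF ->.
  by rewrite gt_eqF// (le_lt_trans (eigenval_ge0 hphi N)).
have bd := bker_deflated N.
have ortho (i : 'I_N) : 0 < lam i -> \int[P]_z (phi i z * f z) = 0.
  move=> li; have bp := bphi li.
  (* The deflated operator is symmetric and kills phi i, so the two ways to evaluate
     this integral give mu <phi i, f> = 0. *)
  have e1 : \int[P]_x \int[P]_z (deflated N x z * f z * phi i x) = 0.
    rewrite (expect_fubini P P (f := fun u : borel M * borel M => deflated N u.1 u.2 * f u.2 * phi i u.1)); last first.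
      apply: bmeasM; last exact: (bmeas_comp bp measurable_fst).
      by apply: bmeasM => //; exact: (bmeas_comp bf measurable_snd).
    rewrite -[RHS](expect_cst P); apply: expect_ae.
    - apply: (bmeas_expect2 P (f := fun u : borel M * borel M => deflated N u.2 u.1 * f u.1 * phi i u.2)).
      apply: bmeasM; last exact: (bmeas_comp bp measurable_snd).
      by apply: bmeasM; [exact: bker_comp|exact: (bmeas_comp bf measurable_fst)].
    - exact: bmeas_cst.
    apply: filterS (deflated_phi0 li) => z Hz /=.
    transitivity (\int[P]_x (f z * (deflated N z x * phi i x))).
      by apply: eq_Rintegral => x _; rewrite deflated_sym -mulrA mulrCA.
    by rewrite expectZ ?Hz ?mulr0//; apply: bmeasM => //; exact: (bker_row z bd).
  have e2 : \int[P]_x \int[P]_z (deflated N x z * f z * phi i x) = mu * \int[P]_x (phi i x * f x).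
    rewrite -expectZ; last exact: bmeasM.
    have brow (x : borel M) : bmeas (fun z : borel M => deflated N x z * f z).
      by apply: bmeasM => //; exact: (bker_row x bd).
    apply: expect_ae.
    - apply: (bmeas_expect2 P (f := fun u : borel M * borel M => deflated N u.1 u.2 * f u.2 * phi i u.1)).
      apply: bmeasM; last exact: (bmeas_comp bp measurable_fst).
      by apply: bmeasM => //; exact: (bmeas_comp bf measurable_snd).
    - by apply: bmeasM; [exact: bmeas_cst|exact: bmeasM].
    by apply: filterS fmu => x Hx; rewrite expectZr// Hx -mulrA [f x * _]mulrC.
  by apply/eqP; move: e2; rewrite e1 => /esym/eqP; rewrite mulf_eq0 (negbTE mu0).
have fH : eigen_eq P h mu f.
  apply: filterS fmu => x; rewrite deflated_apply// big1 ?subr0//.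
  by move=> i li; rewrite ortho ?mulr0.
have [N' [c fc]] := eigenval_multiplicity hphi mu0 (bmeas_in_L2 bf) fH.
have lk k : lam k == mu -> 0 < lam k /\ (k < N)%N.
  move=> /eqP lk; case: mu_out; first by rewrite -lk ltNge (eigenval_ge0 hphi).
  rewrite -lk => lNk; split; first exact: le_lt_trans (eigenval_ge0 hphi N) lNk.
  by rewrite ltnNge; apply/negP => /(eigenval_nincr hphi); rewrite leNgt lNk.
have bk (k : 'I_N') : lam k == mu -> bmeas (fun x : borel M => c k * (phi k x * f x)).
  move=> /lk [l0 _]; apply: bmeasM; first exact: bmeas_cst.
  by apply: bmeasM => //; exact: bphi.
transitivity (\int[P]_x (\sum_(k < N' | lam k == mu) c k * (phi k x * f x))).
  apply: expect_ae; [exact: bmeasX|by apply: bmeas_sum => k; exact: bk|].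
  apply: filterS fc => x fx; rewrite expr2 {1}fx mulr_suml.
  by apply: eq_bigr => k _; rewrite mulrA.
rewrite expect_sum => [|k]; last exact: bk.
rewrite big1// => k lkm; have [l0 kN] := lk _ lkm.
rewrite expectZ; last by apply: bmeasM => //; exact: bphi.
by rewrite (ortho (Ordinal kN))// mulr0.
Qed.

(** The eigenvalues of the deflated kernel lie in [0, lam N]. *)
Lemma deflated_hs2_small N s eta : lam N < s -> 0 < eta ->
  exists N0, forall p, (N0 <= p)%N -> hs2 P (kpow P (defl N) p) <= eta * (s ^+ 2) ^+ p.+1.
Proof.
move=> Ns eta0.
apply: (hs2_kpow_small (bker_deflated N) (deflated_sym N) (eigenval_ge0 hphi N) Ns eta0).
move=> mu f; exact: deflated_no_eigen.
Qed.

End kernel_operator_theory.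

(** * Events of high probability *)

Lemma div_natr_le (R : realType) (C e : R) : 0 < e ->
  exists2 N, (0 < N)%N & forall n, (N <= n)%N -> C / n%:R <= e.
Proof.
move=> e0; exists (Num.bound (`|C| / e)).+1 => // n Nn.
have nR : 0 < n%:R :> R by rewrite ltr0n (leq_trans _ Nn).
have Ce : 0 <= `|C| / e by rewrite divr_ge0// ltW.
rewrite ler_pdivrMr// (le_trans (ler_norm _))// mulrC -ler_pdivrMr//.
by rewrite (le_trans (ltW (archi_boundP Ce)))// ler_nat (leq_trans _ Nn).
Qed.

Section likely_events.
Context (R : realType) d (Omega : measurableType d) (Pr : probability Omega R).
Implicit Types A B : nat -> Omega -> Prop.

(** The outer probability of the complement of A n tends to 0, witnessed by
    measurable functions V n which are at least 1 outside A n.  Stating it so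
    avoids measurability of A n, which may fail for events about eigenvectors. *)
Definition likely A : Prop := forall eta : R, 0 < eta ->
  exists (V : nat -> Omega -> R) (N : nat),
  [/\ forall n, bmeas (V n), forall n w, 0 <= V n w,
      forall n, (N <= n)%N -> \int[Pr]_w V n w <= eta &
      forall n w, (N <= n)%N -> V n w < 1 -> A n w].

Lemma likely_imp A B N0 : likely A ->
  (forall n w, (N0 <= n)%N -> A n w -> B n w) -> likely B.
Proof.
move=> lA AB eta eta0; have [V [N [bV V0 EV VA]]] := lA eta eta0.
exists V, (maxn N N0); split; [by []|by []| |].
  by move=> n; rewrite geq_max => /andP[Nn _]; exact: EV.
by move=> n w; rewrite geq_max => /andP[Nn N0n] V1; apply: AB => //; exact: VA.
Qed.

Lemma likely_and A B : likely A -> likely B -> likely (fun n w => A n w /\ B n w).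
Proof.
move=> lA lB eta eta0; have eta2 : 0 < eta / 2 by rewrite divr_gt0.
have [V [N [bV V0 EV VA]]] := lA _ eta2; have [W [N' [bW W0 EW WB]]] := lB _ eta2.
exists (fun n w => V n w + W n w), (maxn N N'); split.
- by move=> n; exact: bmeasD.
- by move=> n w; exact: addr_ge0.
- move=> n; rewrite geq_max => /andP[Nn N'n].
  by rewrite expectD// (splitr eta) lerD ?EV ?EW.
move=> n w; rewrite geq_max => /andP[Nn N'n] VW1; split.
  by apply: VA => //; apply: le_lt_trans VW1; rewrite lerDl.
by apply: WB => //; apply: le_lt_trans VW1; rewrite lerDr.
Qed.

Lemma likely_true A : (forall n w, A n w) -> likely A.
Proof.
move=> HA eta eta0; exists (fun _ _ => 0), 0%N; split => // [n|n _].
  exact: bmeas_cst.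
by rewrite expect_cst ltW.
Qed.

Lemma likely_all (I : eqType) (s : seq I) (A : I -> nat -> Omega -> Prop) :
  (forall i, i \in s -> likely (A i)) -> likely (fun n w => forall i, i \in s -> A i n w).
Proof.
elim: s => [_|i s IH H]; first exact: likely_true.
have l1 : likely (A i) by apply: H; rewrite mem_head.
have l2 : likely (fun n w => forall j, j \in s -> A j n w).
  by apply: IH => j js; apply: H; rewrite inE js orbT.
apply: (likely_imp (N0 := 0) (likely_and l1 l2)) => n w _ [Ai As] j.
by rewrite inE => /predU1P[->|/As].
Qed.

(** Markov's inequality, with Q n / del as majorant. *)
Lemma likely_markov (Q : nat -> Omega -> R) (C del : R) :
  (forall n, bmeas (Q n)) -> (forall n w, 0 <= Q n w) -> 0 < del ->
  (forall n, (0 < n)%N -> \int[Pr]_w Q n w <= C / n%:R) ->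
  likely (fun n w => Q n w <= del).
Proof.
move=> bQ Q0 del0 EQ eta eta0.
have [N N0 CN] := div_natr_le C (mulr_gt0 del0 eta0).
exists (fun n w => del^-1 * Q n w), N; split.
- by move=> n; apply: bmeasM => //; exact: bmeas_cst.
- by move=> n w; rewrite mulr_ge0// invr_ge0 ltW.
- move=> n Nn; have n0 : (0 < n)%N by exact: leq_trans Nn.
  by rewrite expectZ// ler_pdivrMl// (le_trans (EQ n n0))// CN.
move=> n w _; rewrite ltr_pdivrMl// mulr1; exact: ltW.
Qed.

End likely_events.

(** * Moments of Gram matrices and of residuals *)

Section empirical_moments.
Context (R : realType) (M : pointedMetricType R) (P : probability (borel M) R).
Context d (Omega : measurableType d) (Pr : probability Omega R) (X : nat -> Omega -> M).
Hypothesis hX : iid_sample Pr P (X : nat -> Omega -> borel M).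
Local Notation xs w := (fun i => X i w).
Local Notation bkerM a := (@bker _ (borel M) R a).

Lemma bmeas_X i (f : M -> R) : bmeas (f : borel M -> R) -> bmeas (fun w => f (X i w)).
Proof. by move=> bf; apply: (bmeas_sample hX (F := fun x => f (x i))); exact: bmeas_coord. Qed.

Lemma bmeas_XX i j (a : M -> M -> R) : bkerM a -> bmeas (fun w => a (X i w) (X j w)).
Proof.
move=> ba; apply: (bmeas_sample hX (F := fun x => a (x i) (x j))).
exact: (bmeas_coord2 i j ba).
Qed.

Lemma bker_bound (a : M -> M -> R) : bkerM a -> exists2 B, 0 <= B & forall x y, `|a x y| <= B.
Proof.
move=> [_ [B aB]]; exists B; first exact: le_trans (normr_ge0 _) (aB point).
by move=> x y; exact: (aB (x, y)).
Qed.

Lemma expect_XX i j (a : M -> M -> R) : bkerM a -> i != j ->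
  \int[Pr]_w a (X i w) (X j w) = \int[P]_x \int[P]_y a x y.
Proof.
move=> ba ij.
have bF : bmeas (fun x : seqspace M => a (x i) (x j)) by exact: (bmeas_coord2 i j ba).
rewrite (expect_resample hX j bF) /upd eqxx (negbTE ij).
exact: (expect_sample hX i (bmeas_expect_row P ba)).
Qed.

Lemma bmeas_gram_entry n (a : M -> M -> R) i j : bkerM a ->
  bmeas (fun w => gram a n (xs w) i j).
Proof.
move=> ba; rewrite (_ : (fun w => _) = fun w => a (X i w) (X j w) / n%:R).
  by apply: bmeasM; [exact: bmeas_XX|exact: bmeas_cst].
by apply/funext => w; rewrite mxE.
Qed.

Lemma gram_kcomp_entry n (a b : M -> M -> R) (x : nat -> M) i j :
  (gram a n x *m gram b n x - gram (kcomp P a b) n x) i j =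
  n%:R^-1 * (n%:R^-1 * \sum_(k < n) (a (x i) (x k) * b (x k) (x j) - kcomp P a b (x i) (x j))).
Proof.
have n0 : (0 < n)%N := leq_ltn_trans (leq0n i) (ltn_ord i).
have nR : n%:R != 0 :> R by rewrite pnatr_eq0 -lt0n.
transitivity (\sum_(k < n) a (x i) (x k) / n%:R * (b (x k) (x j) / n%:R) -
    kcomp P a b (x i) (x j) / n%:R).
  by rewrite !mxE; congr (_ - _); apply: eq_bigr => k _; rewrite !mxE.
rewrite sumrB sumr_const card_ord !mulrBr; congr (_ - _).
  by rewrite mulrA mulr_sumr; apply: eq_bigr => k _; rewrite mulrACA mulrC.
by rewrite mulrC; congr (_ * _); rewrite -[kcomp _ _ _ _ _ *+ n]mulr_natl mulKf.
Qed.

(** Each entry of the difference is 1/n times a centered average of a (X_i, X_k) *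
    b (X_k, X_j) over k; its second moment is O(n^-3), and there are n^2 entries. *)
Lemma gram_kcomp_moment (a b : M -> M -> R) : bkerM a -> bkerM b ->
  (forall n, bmeas (fun w => frob2 (gram a n (xs w) *m gram b n (xs w) - gram (kcomp P a b) n (xs w)))) /\
  exists C, forall n, (0 < n)%N ->
    \int[Pr]_w frob2 (gram a n (xs w) *m gram b n (xs w) - gram (kcomp P a b) n (xs w)) <= C / n%:R.
Proof.
move=> ba bb; have bab := bker_kcomp P ba bb.
have [A A0 aA] := bker_bound ba; have [B B0 bB] := bker_bound bb.
have [K K0 kK] := bker_bound bab.
pose eta (u : (borel M * borel M) * borel M) :=
  a u.1.1 u.2 * b u.2 u.1.2 - kcomp P a b u.1.1 u.1.2.
have m11 : measurable_fun setT (fun u : (borel M * borel M) * borel M => u.1.1).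
  by apply: measurableT_comp => //; exact: measurable_fst.
have m12 : measurable_fun setT (fun u : (borel M * borel M) * borel M => u.1.2).
  by apply: (measurableT_comp measurable_snd); exact: measurable_fst.
have beta : bmeas eta.
  by apply: bmeasB; [apply: bmeasM; exact: bker_comp|exact: (bker_comp bab m11 m12)].
have etaB u : `|eta u| <= A * B + K.
  by rewrite (le_trans (ler_normB _ _))// lerD// normrM ler_pM.
have eta0 x y : \int[P]_z eta ((x, y), z) = 0.
  rewrite /eta/= expectB ?expect_cst ?subrr//; last exact: bmeas_cst.
  by apply: bmeasM; [exact: (bker_row (x : borel M) ba)|exact: (bker_col (y : borel M) bb)].
have entryE n w i j : (gram a n (xs w) *m gram b n (xs w) - gram (kcomp P a b) n (xs w)) i j ^+ 2 =
    n%:R^-1 ^+ 2 * (n%:R^-1 * \sum_(k < n) eta ((X i w, X j w), X k w)) ^+ 2.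
  by rewrite gram_kcomp_entry exprMn.
have bq n (i j : 'I_n) : bmeas (fun w => (n%:R^-1 * \sum_(k < n) eta ((X i w, X j w), X k w)) ^+ 2).
  apply: bmeasX; apply: bmeasM; first exact: bmeas_cst.
  apply: bmeas_sum => k _.
  by apply: (bmeas_sample hX (F := fun x => eta ((x i, x j), x k))); exact: bmeas_coord3.
have be n (i j : 'I_n) : bmeas (fun w =>
    (gram a n (xs w) *m gram b n (xs w) - gram (kcomp P a b) n (xs w)) i j ^+ 2).
  rewrite (_ : (fun w => _) = fun w => n%:R^-1 ^+ 2 *
      (n%:R^-1 * \sum_(k < n) eta ((X i w, X j w), X k w)) ^+ 2); last exact/funext.
  by apply: bmeasM => //; exact: bmeas_cst.
split; first by move=> n; apply: bmeas_sum => i _; apply: bmeas_sum => j _.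
exists (3 * (A * B + K) ^+ 2) => n n0; have nR : n%:R != 0 :> R by rewrite pnatr_eq0 -lt0n.
rewrite /frob2 expect_sum => [|i _]; last by apply: bmeas_sum => j _.
apply: (@le_trans _ _ (\sum_(i < n) \sum_(j < n) n%:R^-1 ^+ 2 * (3 * (A * B + K) ^+ 2 / n%:R))).
  apply: ler_sum => i _; rewrite expect_sum//; apply: ler_sum => j _.
  under eq_Rintegral do rewrite entryE.
  rewrite expectZ//; apply: ler_wpM2l; first exact: sqr_ge0.
  by apply: (second_moment_le hX) => //; apply: aeW => w; exact: eta0.
rewrite !sumr_const !card_ord -!mulrnA -[_ *+ _]mulr_natl natrM.
by rewrite mulrA exprVn -expr2 divff ?mul1r// expf_neq0.
Qed.

(** The squares of the n^2 - n off-diagonal entries have expectation hs2 a / n^2, and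
    those of the n diagonal ones are O(n^-2). *)
Lemma gram_frob2_moment (a : M -> M -> R) : bkerM a ->
  (forall n, bmeas (fun w => frob2 (gram a n (xs w)))) /\
  exists C, forall n, (0 < n)%N ->
    \int[Pr]_w frob2 (gram a n (xs w)) <= hs2 P (a : borel M -> borel M -> R) + C / n%:R.
Proof.
move=> ba; have [A A0 aA] := bker_bound ba.
have be n (i j : 'I_n) : bmeas (fun w => gram a n (xs w) i j ^+ 2).
  by apply: bmeasX; exact: bmeas_gram_entry.
split; first by move=> n; apply: bmeas_sum => i _; apply: bmeas_sum => j _.
exists (A ^+ 2) => n n0; have nR : n%:R != 0 :> R by rewrite pnatr_eq0 -lt0n.
set H := hs2 _ _; have H0 : 0 <= H by exact: hs2_ge0.
rewrite /frob2 expect_sum => [|i _]; last by apply: bmeas_sum => j _.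
apply: (@le_trans _ _ (\sum_(i < n) \sum_(j < n)
    n%:R^-1 ^+ 2 * (H + (j == i)%:R * A ^+ 2))).
  apply: ler_sum => i _; rewrite expect_sum//; apply: ler_sum => j _.
  have -> : \int[Pr]_w gram a n (xs w) i j ^+ 2 =
      n%:R^-1 ^+ 2 * \int[Pr]_w (a (X i w) (X j w) ^+ 2).
    rewrite -expectZ; last by apply: bmeasX; exact: bmeas_XX.
    by apply: eq_Rintegral => w _; rewrite mxE exprMn mulrC.
  apply: ler_wpM2l; first exact: sqr_ge0.
  have [ji|ji] := eqVneq j i.
    rewrite mul1r (le_trans (_ : _ <= A ^+ 2)) ?lerDr//.
    apply: (le_trans (ler_norm _)); apply: norm_expect_le => [|w].
      by apply: bmeasX; exact: bmeas_XX.
    by rewrite normrX lerXn2r ?nnegrE.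
  rewrite mul0r addr0 (expect_XX (a := fun x y => a x y ^+ 2))//.
    exact: (bker_sqr ba).
  by rewrite eq_sym.
have -> : \sum_(i < n) \sum_(j < n) n%:R^-1 ^+ 2 * (H + (j == i)%:R * A ^+ 2) =
   n%:R^-1 ^+ 2 * \sum_(i < n) (n%:R * H + A ^+ 2).
  rewrite mulr_sumr; apply: eq_bigr => i _; rewrite -mulr_sumr big_split/=.
  rewrite sumr_const card_ord mulr_natl (bigD1 i)//= eqxx mul1r big1 ?addr0// => j ji.
  by rewrite (negbTE ji) mul0r.
rewrite sumr_const card_ord -[_ *+ n]mulr_natl.
by rewrite le_eqVlt; apply/orP; left; apply/eqP; field.
Qed.

End empirical_moments.

Section eigenfunction_moments.
Context (R : realType) (M : pointedMetricType R) (P : probability (borel M) R).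
Context d (Omega : measurableType d) (Pr : probability Omega R) (X : nat -> Omega -> M).
Hypothesis hX : iid_sample Pr P (X : nat -> Omega -> borel M).
Local Notation xs w := (fun i => X i w).
Local Notation bkerM a := (@bker _ (borel M) R a).

(** The law of large numbers in L2. *)
Lemma sample_mean_moment (f : M -> R) (c : R) : bmeas (f : borel M -> R) ->
  \int[P]_x f x = c ->
  exists C, forall n, (0 < n)%N ->
    \int[Pr]_w (n%:R^-1 * \sum_(k < n) f (X k w) - c) ^+ 2 <= C / n%:R.
Proof.
move=> bf fc; have [_ [B fB]] := bf.
pose eta (u : (borel M * borel M) * borel M) := f u.2 - c.
have beta : bmeas eta.
  by apply: bmeasB; [apply: (bmeas_comp bf); exact: measurable_snd|exact: bmeas_cst].
have etaB u : `|eta u| <= B + `|c| by rewrite (le_trans (ler_normB _ _))// lerD.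
exists (3 * (B + `|c|) ^+ 2) => n n0.
have nR : n%:R != 0 :> R by rewrite pnatr_eq0 -lt0n.
have -> : \int[Pr]_w (n%:R^-1 * \sum_(k < n) f (X k w) - c) ^+ 2 =
    \int[Pr]_w (n%:R^-1 * \sum_(k < n) eta ((X 0%N w, X 0%N w), X k w)) ^+ 2.
  apply: eq_Rintegral => w _; congr (_ ^+ 2).
  by rewrite sumrB sumr_const card_ord mulrBr -[c *+ n]mulr_natl mulKf.
apply: (second_moment_le hX) => //; apply: aeW => w; rewrite /eta/=.
by rewrite expectB ?expect_cst ?fc ?subrr//; exact: bmeas_cst.
Qed.

Lemma emp_inner_sample n (x : nat -> M) (f g : M -> R) :
  emp_inner (sample_vec n x f) (sample_vec n x g) = n%:R^-1 * \sum_(k < n) (f (x k) * g (x k)).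
Proof. by congr (_ * _); apply: eq_bigr => k _; rewrite !mxE. Qed.

Lemma bmeas_emp_inner n (u v : Omega -> 'cV[R]_n) :
  (forall i, bmeas (fun w => u w i 0)) -> (forall i, bmeas (fun w => v w i 0)) ->
  bmeas (fun w => emp_inner (u w) (v w)).
Proof.
move=> bu bv; apply: bmeasM; first exact: bmeas_cst.
by apply: bmeas_sum => i _; exact: bmeasM.
Qed.

Lemma bmeas_sample_vec n (f : M -> R) i : bmeas (f : borel M -> R) ->
  bmeas (fun w => sample_vec n (xs w) f i 0).
Proof.
move=> bf; rewrite (_ : (fun w => _) = fun w => f (X i w)); first exact: (bmeas_X hX).
by apply/funext => w; rewrite mxE.
Qed.

Lemma sample_inner_moment (f g : M -> R) (c : R) : bmeas (f : borel M -> R) ->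
  bmeas (g : borel M -> R) -> \int[P]_x (f x * g x) = c ->
  exists C, forall n, (0 < n)%N ->
    \int[Pr]_w (emp_inner (sample_vec n (xs w) f) (sample_vec n (xs w) g) - c) ^+ 2 <= C / n%:R.
Proof.
move=> bf bg fgc; have [C EC] := sample_mean_moment (bmeasM bf bg) fgc.
exists C => n n0; rewrite (le_trans _ (EC n n0))//.
by under eq_Rintegral do rewrite emp_inner_sample.
Qed.

(** The error made when the values of f at the sample are treated as an eigenvector
    of the Gram matrix. *)
Definition gram_residual (h : M -> M -> R) (mu : R) (f : M -> R) n (x : nat -> M) : 'cV[R]_n :=
  gram h n x *m sample_vec n x f - mu *: sample_vec n x f.

Lemma gram_residualE h mu f n x i : gram_residual h mu f n x i 0 =
  n%:R^-1 * \sum_(k < n) (h (x i) (x k) * f (x k) - mu * f (x i)).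
Proof.
have n0 : (0 < n)%N := leq_ltn_trans (leq0n i) (ltn_ord i).
have nR : n%:R != 0 :> R by rewrite pnatr_eq0 -lt0n.
rewrite !mxE sumrB sumr_const card_ord mulrBr; congr (_ - _).
  by rewrite mulr_sumr; apply: eq_bigr => k _; rewrite !mxE mulrAC mulrC.
by rewrite -[_ * f _ *+ n]mulr_natl mulKf.
Qed.

Lemma bmeas_gram_residual h mu f n i : bkerM h -> bmeas (f : borel M -> R) ->
  bmeas (fun w => gram_residual h mu f n (xs w) i 0).
Proof.
move=> bh bf; rewrite (_ : (fun w => _) = fun w =>
    n%:R^-1 * \sum_(k < n) (h (X i w) (X k w) * f (X k w) - mu * f (X i w))).
  apply: bmeasM; [exact: bmeas_cst|apply: bmeas_sum => k _; apply: bmeasB].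
    by apply: bmeasM; [exact: (bmeas_XX hX)|exact: (bmeas_X hX)].
  by apply: bmeasM; [exact: bmeas_cst|exact: (bmeas_X hX)].
by apply/funext => w; rewrite gram_residualE.
Qed.

(** Each entry is an average of variables that are centered given X_i, by the
    eigenvalue equation. *)
Lemma gram_residual_moment h mu f : bkerM h -> bmeas (f : borel M -> R) ->
  {ae P, forall x : borel M, \int[P]_y (h x y * f y) = mu * f x} ->
  exists C, forall n, (0 < n)%N ->
    \int[Pr]_w emp_inner (gram_residual h mu f n (xs w)) (gram_residual h mu f n (xs w))
      <= C / n%:R.
Proof.
move=> bh bf hf; have [_ [F fF]] := bf; have [H H0 hH] := bker_bound bh.
pose eta (u : (borel M * borel M) * borel M) := h u.1.1 u.2 * f u.2 - mu * f u.1.1.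
have m11 : measurable_fun setT (fun u : (borel M * borel M) * borel M => u.1.1).
  by apply: measurableT_comp => //; exact: measurable_fst.
have bf2 : bmeas (fun u : (borel M * borel M) * borel M => f u.2).
  by apply: (bmeas_comp bf); exact: measurable_snd.
have beta : bmeas eta.
  apply: bmeasB; apply: bmeasM => //; first exact: (bker_comp bh).
    exact: bmeas_cst.
  exact: (bmeas_comp bf m11).
have F0 : 0 <= F := le_trans (normr_ge0 _) (fF point).
have etaB u : `|eta u| <= H * F + `|mu| * F.
  by rewrite (le_trans (ler_normB _ _))// !normrM lerD// ?ler_pM// ler_wpM2l.
exists (3 * (H * F + `|mu| * F) ^+ 2) => n n0.
have nR : n%:R != 0 :> R by rewrite pnatr_eq0 -lt0n.
have be (i : 'I_n) : bmeas (fun w => (gram_residual h mu f n (xs w) i 0) ^+ 2).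
  by apply: bmeasX; exact: bmeas_gram_residual.
have -> : \int[Pr]_w emp_inner (gram_residual h mu f n (xs w)) (gram_residual h mu f n (xs w)) =
    n%:R^-1 * \sum_(i < n) \int[Pr]_w (gram_residual h mu f n (xs w) i 0) ^+ 2.
  rewrite -expect_sum// -expectZ; last exact: bmeas_sum.
  by apply: eq_Rintegral => w _; congr (_ * _); apply: eq_bigr => i _; rewrite expr2.
apply: (@le_trans _ _ (n%:R^-1 * \sum_(i < n) (3 * (H * F + `|mu| * F) ^+ 2 / n%:R))).
  rewrite ler_wpM2l//; apply: ler_sum => i _.
  under eq_Rintegral do rewrite gram_residualE.
  apply: (second_moment_le hX (eta := eta) (i := i) (j := i)) => //.
  have := ae_sample hX i hf; apply: filterS => w hw; rewrite /eta/=.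
  rewrite expectB ?expect_cst ?hw ?subrr//; last exact: bmeas_cst.
  by apply: bmeasM => //; exact: (bker_row (X i w : borel M) bh).
by rewrite sumr_const card_ord; move: (3 * _ / _) => c; rewrite -[c *+ n]mulr_natl mulKf.
Qed.

End eigenfunction_moments.

(** * Consistency of the empirical eigenvalues *)

Lemma norm_le_of_sqr (R : realType) (x del : R) : 0 <= del -> x ^+ 2 <= del ^+ 2 -> `|x| <= del.
Proof. by move=> del0; rewrite -[x ^+ 2]real_normK ?num_real// ler_pXn2r ?nnegrE. Qed.

Lemma gram_sym (R : realType) (M : pointedMetricType R) (g : M -> M -> R) n x :
  (forall x y, g x y = g y x) -> (gram g n x)^T = gram g n x.
Proof. by move=> sg; apply/matrixP => i j; rewrite !mxE sg. Qed.

Section eigenvalue_consistency.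
Context (R : realType) (M : pointedMetricType R) (P : probability (borel M) R).
Context d (Omega : measurableType d) (Pr : probability Omega R) (X : nat -> Omega -> M).
Hypothesis hX : iid_sample Pr P (X : nat -> Omega -> borel M).
Context (h : M -> M -> R) (lam : nat -> R) (phi : nat -> M -> R).
Hypothesis h_sym : forall x y, h x y = h y x.
Hypothesis bh : @bker _ (borel M) R h.
Hypothesis hphi : kernel_eigensystem P h lam phi.
Hypothesis bphi : forall k, 0 < lam k -> bmeas (phi k : borel M -> R).
Local Notation xs w := (fun i => X i w).
Local Notation fvec n w k := (sample_vec n (xs w) (phi k)).
Local Notation res n w k := (gram_residual h (lam k) (phi k) n (xs w)).

Lemma orthonormal_likely i j del : 0 < lam i -> 0 < lam j -> 0 < del ->
  likely Pr (fun n w => `|emp_inner (fvec n w i) (fvec n w j) - (i == j)%:R| <= del).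
Proof.
move=> li lj del0.
have [C EC] := sample_inner_moment hX (bphi li) (bphi lj) (eigenfun_orthonormal hphi li lj).
have l2 := likely_markov _ _ (exprn_gt0 2 del0) EC.
apply: (likely_imp (N0 := 0) (l2 _ _)) => [n|n w|n w _].
- apply: bmeasX; apply: bmeasB; last exact: bmeas_cst.
  by apply: bmeas_emp_inner => k; apply: (bmeas_sample_vec hX); exact: bphi.
- exact: sqr_ge0.
- by apply: norm_le_of_sqr; exact: ltW.
Qed.

Lemma residual_emp_inner_bmeas k n : 0 < lam k ->
  bmeas (fun w => emp_inner (res n w k) (res n w k)).
Proof.
move=> lk; have bf := bphi lk.
by apply: bmeas_emp_inner => i; exact: (bmeas_gram_residual hX).
Qed.

Lemma residual_likely k del : 0 < lam k -> 0 < del ->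
  likely Pr (fun n w => emp_inner (res n w k) (res n w k) <= del).
Proof.
move=> lk del0.
have [C EC] := gram_residual_moment hX bh (bphi lk) (eigenfun_eq hphi k).
apply: (likely_markov _ _ del0 EC) => [n|n w]; first exact: residual_emp_inner_bmeas.
exact: emp_inner_ge0.
Qed.

(** With high probability the vectors of values of phi_0, ..., phi_k are nearly
    orthonormal and nearly eigenvectors, so eigenval_lower applies. *)
Lemma eigenval_lower_likely k e : 0 < lam k -> 0 < e ->
  likely Pr (fun n w => forall l v, gram_eigensystem h (xs w) l v ->
    forall kk : 'I_n, kk = k :> nat -> lam k - e <= l kk).
Proof.
move=> lk e0; set a := lam k in lk *.
(* kap bounds the total error of the two quadratic forms; a - kap <= x (1 + kap)
   implies a - e <= x because kap (1 + a) <= e. *)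
pose kap := Num.min (e / (1 + a)) (a / 2).
have kap0 : 0 < kap by rewrite lt_min !divr_gt0// addr_gt0.
have kapa : kap < a by rewrite gt_min [a / 2 < a]ltr_pdivrMr// ltr_pMr// ltr1n orbT.
have kape : kap * (1 + a) <= e by rewrite -ler_pdivlMr ?addr_gt0// ge_min lexx.
pose K : R := k.+1%:R ^+ 2; have K0 : 0 < K by rewrite exprn_gt0.
pose del := kap / K; have del0 : 0 < del by rewrite divr_gt0.
have L0 : 0 <= lam 0%N := eigenval_ge0 hphi 0.
pose del1 := Num.min 1 (Num.min del (del / (2 * (1 + lam 0%N)))).
have L1 : 0 < 2 * (1 + lam 0%N) by rewrite mulr_gt0// ltr_pwDl.
have del1_0 : 0 < del1 by rewrite !lt_min ltr01 del0 divr_gt0.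
have del1_1 : del1 <= 1 by rewrite ge_min lexx.
have del1_del : del1 <= del by rewrite !ge_min lexx orbT.
have del1_L : lam 0%N * del1 <= del / 2.
  have : del1 <= del / (2 * (1 + lam 0%N)) by rewrite !ge_min lexx !orbT.
  by rewrite ler_pdivlMr// => H; nra.
pose del2 := del ^+ 2 / 8.
have del2_0 : 0 < del2 by rewrite divr_gt0// exprn_gt0.
have lpos i : (i < k.+1)%N -> a <= lam i by move=> ik; exact: (eigenval_nincr hphi).
have lp i : i \in iota 0 k.+1 -> 0 < lam i.
  by rewrite mem_iota => ik; exact: lt_le_trans (lpos _ ik).
have evR := likely_all (fun i ik => residual_likely (lp i ik) del2_0).
have evO := likely_all (fun i ik => likely_all (fun j jk =>
  orthonormal_likely (lp i ik) (lp j jk) del1_0)).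
apply: (likely_imp (N0 := 0) (likely_and evR evO)) => n w _ [hR hO] l v [Hv lni ov] kk kkE.
have mi (i : 'I_kk.+1) : (i : nat) \in iota 0 k.+1.
  by rewrite mem_iota -kkE /=; exact: ltn_ord.
have ff (i j : 'I_kk.+1) : `|emp_inner (fvec n w i) (fvec n w j) - (i == j)%:R| <= del1.
  exact: hO.
have fHf (i j : 'I_kk.+1) : `|emp_inner (fvec n w i) (gram h n (xs w) *m fvec n w j)
    - lam j * (i == j)%:R| <= del.
  have -> : emp_inner (fvec n w i) (gram h n (xs w) *m fvec n w j) - lam j * (i == j)%:R =
      emp_inner (fvec n w i) (res n w j) +
      lam j * (emp_inner (fvec n w i) (fvec n w j) - (i == j)%:R).
    by rewrite /gram_residual emp_innerBr emp_innerZr mulrBr addrA subrK.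
  have p1 : `|emp_inner (fvec n w i) (res n w j)| <= del / 2.
    apply: norm_le_of_sqr; first by rewrite divr_ge0// ltW.
    apply: le_trans (emp_CauchySchwarz _ _) _.
    have fi2 : emp_inner (fvec n w i) (fvec n w i) <= 2.
      have := ff i i; rewrite eqxx => /(le_trans (ler_norm _)).
      by rewrite lerBlDr => /le_trans -> //; rewrite -[leRHS]/(1 + 1) lerD.
    have r2 := hR _ (mi j).
    apply: (@le_trans _ _ (2 * del2)); first by rewrite ler_pM ?emp_inner_ge0.
    by rewrite le_eqVlt; apply/orP; left; apply/eqP; rewrite /del2; move: (del) => z; field.
  have p2 : `|lam j * (emp_inner (fvec n w i) (fvec n w j) - (i == j)%:R)| <= del / 2.
    rewrite normrM (ger0_norm (eigenval_ge0 hphi j)); apply: le_trans del1_L.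
    by rewrite ler_pM ?(eigenval_ge0 hphi)// (eigenval_nincr hphi).
  by rewrite (le_trans (ler_normD _ _))// (splitr del) lerD.
have KE : kk.+1%:R ^+ 2 * del = kap by rewrite kkE /del mulrC divfK// gt_eqF.
have := @eigenval_lower R n _ _ _ (gram_sym n (xs w) h_sym) Hv lni ov kk
  (fun i => fvec n w i) (fun i => lam i) del a.
rewrite KE => /(_ (fun i j => le_trans (ff i j) del1_del) fHf) low.
have {}low : a - kap <= l kk * (1 + kap).
  by apply: low => // i; apply: lpos; rewrite -kkE.
rewrite leNgt; apply/negP => lt.
have : l kk * (1 + kap) < (a - e) * (1 + kap) by rewrite ltr_pM2r// addr_gt0.
move: low kape kap0 e0; clearbody kap a; move: (l kk) => y ? ? ? ? ?.
by nra.
Qed.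

(** The removed rank one terms vanish on vectors orthogonal to the values of the
    phi_i. *)
Lemma gram_deflated_mul n (x : nat -> M) N (u : 'cV[R]_n) :
  (forall i, (i < N)%N -> emp_inner (sample_vec n x (phi i)) u = 0) ->
  gram (deflated h lam phi N) n x *m u = gram h n x *m u.
Proof.
move=> fu; apply/matrixP => a b; rewrite !mxE.
transitivity (\sum_(j < n) (h (x a) (x j) / n%:R * u j b) -
    \sum_(i < N | 0 < lam i) lam i * phi i (x a) * emp_inner (sample_vec n x (phi i)) u).
  rewrite (eq_bigr (fun j : 'I_n => h (x a) (x j) / n%:R * u j b -
      \sum_(i < N | 0 < lam i) lam i * phi i (x a) * (n%:R^-1 * (phi i (x j) * u j 0)))).
    rewrite sumrB; congr (_ - _); rewrite exchange_big; apply: eq_bigr => i _.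
    rewrite /emp_inner !mulr_sumr; apply: eq_bigr => j _.
    by rewrite !mxE.
  move=> j _; rewrite (ord1 b) !mxE /deflated !mulrBl !mulr_suml; congr (_ - _).
  by apply: eq_bigr => i _; rewrite !mulrA; congr (_ * _); rewrite mulrAC.
rewrite [X in _ - X]big1 ?subr0; last by move=> i _; rewrite fu ?mulr0.
by apply: eq_bigr => j _; rewrite !mxE.
Qed.

Lemma gram_power_likely (g : M -> M -> R) (t eta : R) i : @bker _ (borel M) R g ->
  0 < t -> 0 < eta ->
  likely Pr (fun n w => Num.sqrt (frob2 (gram (kpow P g (2 ^ i).-1) n (xs w) *m
      gram (kpow P g (2 ^ i).-1) n (xs w) - gram (kpow P g (2 ^ i.+1).-1) n (xs w)))
    <= eta * t ^+ (2 ^ i.+1)).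
Proof.
move=> bg t0 eta0; have bp p := @bker_kpow _ _ _ P g p bg.
have pE : kcomp P (kpow P g (2 ^ i).-1) (kpow P g (2 ^ i).-1) = kpow P g (2 ^ i.+1).-1.
  by rewrite kpowD// expnS; congr (kpow P g _); have := expn_gt0 2 i; lia.
have et0 : 0 < eta * t ^+ (2 ^ i.+1) by rewrite mulr_gt0// exprn_gt0.
have [bq [C EC]] := gram_kcomp_moment hX (bp (2 ^ i).-1) (bp (2 ^ i).-1).
have l2 := likely_markov bq (fun n w => frob2_ge0 _) (exprn_gt0 2 et0) EC.
apply: (likely_imp (N0 := 0) l2) => n w _; rewrite pE => H.
by rewrite -(ger0_norm (ltW et0)) -sqrtr_sqr ler_wsqrtr.
Qed.

(** Take a unit vector orthogonal to the values of phi_0, ..., phi_(N-1) whose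
    quadratic form dominates l_N.  On it the Gram matrix of h may be replaced by that of
    the deflated kernel g, and repeated squaring reduces the claim to a bound on the
    Gram matrix of g^(2^r), which holds in mean for large r. *)
Lemma eigenval_upper_likely N e : 0 < e ->
  likely Pr (fun n w => forall l v, gram_eigensystem h (xs w) l v ->
    forall kk : 'I_n, kk = N :> nat -> l kk <= lam N + e).
Proof.
move=> e0; pose t := lam N + e / 2; pose g := deflated h lam phi N.
have Nt : lam N < t by rewrite ltrDl divr_gt0.
have t0 : 0 < t := le_lt_trans (eigenval_ge0 hphi N) Nt.
pose eta := e / (2 * t); have eta0 : 0 < eta by rewrite divr_gt0// mulr_gt0.
have tE : (1 + eta) * t = lam N + e.
  by rewrite mulrDl mul1r /eta invfM mulrA divfK ?gt_eqF// /t -addrA -splitr.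
have bg : @bker _ (borel M) R g := bker_deflated bh bphi N.
have bp p := @bker_kpow _ _ _ P g p bg.
have sg := deflated_sym lam phi h_sym N.
move=> zeta zeta0.
have zeta4 : 0 < zeta / 4 by rewrite divr_gt0.
have [N0 hsN0] := deflated_hs2_small h_sym bh hphi bphi Nt zeta4.
have rN0 : (N0 <= (2 ^ N0).-1)%N by have := ltn_expl N0 (isT : (1 < 2)%N); lia.
have evD := likely_all (s := iota 0 N0) (fun i _ => gram_power_likely i bg t0 eta0).
have [V [N1 [bV V0 EV VD]]] := evD _ (divr_gt0 zeta0 (ltr0n _ 2)).
(* The threshold for the squared norm; r = N0 squarings are enough since N0 < 2^N0. *)
pose D := ((1 + eta) * t ^+ (2 ^ N0)) ^+ 2.
have Dp : 0 < (1 + eta) * t ^+ (2 ^ N0) by rewrite mulr_gt0 ?exprn_gt0// addr_gt0.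
have D0 : 0 < D by rewrite exprn_gt0.
have [bq [C EC]] := gram_frob2_moment hX (bp (2 ^ N0).-1).
have hsD : hs2 P (kpow P g (2 ^ N0).-1) <= zeta / 4 * D.
  apply: le_trans (hsN0 _ rN0) _; rewrite ler_wpM2l ?(ltW zeta4)//.
  have -> : (t ^+ 2) ^+ (2 ^ N0).-1.+1 = (t ^+ (2 ^ N0)) ^+ 2.
    by rewrite prednK ?expn_gt0// -!exprM mulnC.
  rewrite /D [leRHS]exprMn ler_peMl ?exprn_ge0 ?(ltW t0)//.
  by apply: exprn_ege1; rewrite lerDl ltW.
have zD : 0 < zeta / 4 * D by exact: mulr_gt0.
have [N2 N2_0 CN2] := @div_natr_le R C _ zD.
exists (fun n w => V n w + D^-1 * frob2 (gram (kpow P g (2 ^ N0).-1) n (xs w))), (maxn N1 N2).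
have bD n : bmeas (fun w => D^-1 * frob2 (gram (kpow P g (2 ^ N0).-1) n (xs w))).
  by apply: bmeasM; [exact: bmeas_cst|exact: bq].
have fD0 n w : 0 <= D^-1 * frob2 (gram (kpow P g (2 ^ N0).-1) n (xs w)).
  by rewrite mulr_ge0 ?frob2_ge0// invr_ge0 ltW.
split.
- by move=> n; apply: bmeasD.
- by move=> n w; rewrite addr_ge0.
- move=> n; rewrite geq_max => /andP[N1n N2n].
  have n0 : (0 < n)%N := leq_trans N2_0 N2n.
  rewrite expectD// (splitr zeta) lerD ?EV// expectZ// ler_pdivrMl//.
  apply: le_trans (EC n n0) _.
  have -> : D * (zeta / 2) = zeta / 4 * D + zeta / 4 * D by field.
  by rewrite lerD// CN2.
move=> n w; rewrite geq_max => /andP[N1n N2n] VW1 l v [Hv lni ov] kk kkE.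
have [u [u1 fu lu]] := @eigenval_upper R n _ _ _ (gram_sym n (xs w) h_sym) Hv lni ov kk
  (fun i => fvec n w i).
rewrite -tE; apply: le_trans lu _.
rewrite -(gram_deflated_mul (N := N)); last first.
  by rewrite -kkE => i ik; exact: (fu (Ordinal ik)).
have V1 : V n w < 1 by apply: le_lt_trans VW1; rewrite lerDl.
have D1 : frob2 (gram (kpow P g (2 ^ N0).-1) n (xs w)) < D.
  rewrite -[ltRHS]mulr1 -ltr_pdivrMl//; apply: le_lt_trans VW1; rewrite lerDr; exact: V0.
apply/ltW; apply: (quadratic_squaring (A := fun i => gram (kpow P g (2 ^ i).-1) n (xs w))
  (r := N0) t0 (ltW eta0)) => //.
- by move=> i; apply: gram_sym => x y; exact: (@kpow_sym _ (borel M) R P g _ bg sg x y).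
- by move=> i iN0; apply: VD => //; rewrite mem_iota.
- by rewrite -(ger0_norm (ltW Dp)) -sqrtr_sqr ltr_sqrt.
Qed.

(** Eigenvalues outside J stay at distance gamma / 2 from those in J: finitely
    many are handled one by one, and the rest by monotonicity from the first
    index beyond J. *)
Lemma gap_likely (J : {fset nat}) (g : R) : 0 < g ->
  (forall k l, k \in J -> l \notin J -> g <= `|lam k - lam l|) ->
  likely Pr (fun n w => forall l v, gram_eigensystem h (xs w) l v ->
    forall (k : 'I_n) j, (k : nat) \notin J -> j \in J -> g / 2 <= `|l k - lam j|).
Proof.
move=> g0 gapJ; pose K := (\max_(j <- J) j).+1.
have JK j : j \in J -> (j < K)%N by move=> jJ; rewrite ltnS; exact: leq_bigmax_seq.
have KJ : K \notin J by apply/negP => /JK; rewrite ltnn.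
have g2 : 0 < g / 2 by rewrite divr_gt0.
have evU := likely_all (s := iota 0 K.+1) (fun k _ => eigenval_upper_likely k g2).
have evL := likely_all (s := [seq k <- iota 0 K.+1 | 0 < lam k])
  (fun k ks => eigenval_lower_likely (k := k)
    (proj1 (andP (eq_ind _ is_true ks _ (mem_filter _ _ _)))) g2).
apply: (likely_imp (N0 := 0) (likely_and evU evL)) => n w _ [hU hL] l v E k j kJ jJ.
have below i (ii : 'I_n) : ii = i :> nat -> (i <= K)%N -> lam i <= lam j - g ->
    l ii <= lam j - g / 2.
  move=> iiE iK ij; have := hU i _ l v E ii iiE; rewrite mem_iota => /(_ iK) H.
  by apply: le_trans H _; rewrite lerBrDr -addrA -splitr -lerBrDr.
have done : l k <= lam j - g / 2 -> g / 2 <= `|l k - lam j|.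
  by move=> H; rewrite distrC (le_trans _ (ler_norm _))// lerBrDr -lerBrDl.
have [Kk|kK] := ltnP K k.
  have Kn : (K < n)%N := ltn_trans Kk (ltn_ord k).
  apply: done; apply: le_trans (gram_eigenval_nincr E (k := Ordinal Kn) (l := k) (ltnW Kk)) _.
  have Kj : lam K <= lam j by apply: (eigenval_nincr hphi); exact: ltnW (JK j jJ).
  apply: (below K) => //; have := gapJ j K jJ KJ.
  by rewrite ger0_norm ?subr_ge0// => H; rewrite lerBrDr addrC -lerBrDr.
have := gapJ j k jJ kJ; have [kj|jk] := leP (lam k) (lam j).
  rewrite ger0_norm ?subr_ge0// => H; apply: done; apply: (below k) => //.
  by rewrite lerBrDr addrC -lerBrDr.
rewrite distrC gtr0_norm ?subr_gt0// => H.
have lk : 0 < lam k by apply: le_lt_trans jk; exact: eigenval_ge0 hphi _.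
have := hL k _ l v E k erefl; rewrite mem_filter lk mem_iota/= ltnS => /(_ kK) H2.
by rewrite (le_trans _ (ler_norm _))// lerBrDr (le_trans _ H2)// lerBrDr -addrA -addrCA -splitr -lerBrDl.
Qed.

End eigenvalue_consistency.

(** * The limit theorem *)

Lemma div_sqrt_le (R : realType) (C e : R) : 0 < e ->
  exists2 N, (0 < N)%N & forall n, (N <= n)%N -> C / Num.sqrt n%:R <= e.
Proof.
move=> e0; have [N N0 CN] := div_natr_le (C ^+ 2) (exprn_gt0 2 e0).
exists N => // n Nn; apply: (le_trans (ler_norm _)); apply: norm_le_of_sqr; first exact: ltW.
by rewrite expr_div_n sqr_sqrtr// CN.
Qed.

Lemma norm_triangle_quarter (R : realType) (a b c x e : R) :
  `|a - b| <= e / 4 -> `|b - c| <= e / 2 -> `|x - c| <= e / 4 -> `|a - x| <= e.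
Proof. by rewrite !ler_norml => /andP[? ?] /andP[? ?] /andP[? ?]; apply/andP; split; lra. Qed.

Lemma shrink_factor_le (R : realFieldType) (L e : R) : 0 <= L -> 0 <= e ->
  2 * L * (e / (8 * (L + 1))) <= e / 4.
Proof.
move=> L0 e0; have L1 : 0 < L + 1 by rewrite ltr_wpDl.
have -> : 2 * L * (e / (8 * (L + 1))) = e / 4 * (L / (L + 1)) by field; rewrite gt_eqF.
by rewrite ler_piMr ?divr_ge0// ler_pdivrMr// mul1r lerDl.
Qed.

Section central_limit.
Context (R : realType) (M : pointedMetricType R) (P : probability (borel M) R).
Context d (Omega : measurableType d) (Pr : probability Omega R) (X : nat -> Omega -> M).
Hypothesis hX : iid_sample Pr P (X : nat -> Omega -> borel M).
Context d' (Omega' : measurableType d') (Pr' : probability Omega' R) (Z : Omega' -> R).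
Local Notation gam := (@normal_prob R 0 1).

Lemma bmeas_sample_sum n (c : R) (psi : borel M -> R) : bmeas psi ->
  bmeas (fun w => c * \sum_(i < n) psi (X i w)).
Proof.
move=> bpsi; apply: bmeasM; first exact: bmeas_cst.
by apply: bmeas_sum => i _; exact: (bmeas_X hX).
Qed.

(** Lindeberg's bound for a smooth function uniformly close to f. *)
Lemma lipschitz_clt (psi : borel M -> R) (f : R -> R) (B L e : R) : bmeas psi ->
  \int[P]_x psi x = 0 -> gaussian_rv Pr' Z -> 'E_Pr'[Z]%E = 0%E ->
  covariance Pr' Z Z = (\int[P]_x psi x ^+ 2)%:E ->
  (forall x, `|f x| <= B) -> lipschitz_with L f -> 0 < e ->
  exists N, forall n, (N <= n)%N ->
    `|\int[Pr]_w f ((Num.sqrt n%:R)^-1 * \sum_(i < n) psi (X i w)) - \int[Pr']_w f (Z w)| <= e.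
Proof.
move=> bpsi psi0 gZ EZ cZ fB fL e0; have [_ [A psiA]] := bpsi.
have [s [s0 s_var lawZ]] := centered_gaussian gZ EZ cZ.
have L0 : 0 <= L by have := fL 0 1; rewrite sub0r normrN normr1 mulr1; exact: le_trans.
have bf : bmeas f := continuous_bounded_bmeas (lipschitz_with_continuous fL) fB.
have K0 : 0 < 8 * (L + 1) by rewrite mulr_gt0// ltr_wpDl.
have e1 : 0 < e / (8 * (L + 1)) by rewrite divr_gt0.
have [g [g1 [g2 [C [C0 tg gf]]]]] := lipschitz_taylor3_approx fL fB e1.
have {}gf x : `|f x - g x| <= e / 4.
  rewrite distrC (le_trans (gf x))//.
  by rewrite shrink_factor_le// ltW.
have bg := taylor3_0 tg.
have [N N0 CN] := div_sqrt_le (C * (A ^+ 3 + s ^+ 3 * \int[gam]_z (`|z| ^+ 3)))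
  (divr_gt0 e0 (ltr0n R 2)).
exists N => n Nn; have n0 := leq_trans N0 Nn.
have bS := bmeas_sample_sum n (Num.sqrt n%:R)^-1 bpsi.
have mS := bS.1.
have ms : measurable_fun setT (fun z : R => s * z) by exact: measurable_funM.
rewrite lawZ//.
have t1 := norm_expectB_le Pr (bmeas_comp bf mS) (bmeas_comp bg mS) (bmeas_cst _ (e / 4))
   (fun w => gf _).
have t3 := norm_expectB_le gam (bmeas_comp bf ms) (bmeas_comp bg ms) (bmeas_cst _ (e / 4))
   (fun w => gf _).
have t2 := lindeberg hX bpsi psiA psi0 erefl s0 s_var C0 tg n0.
have {}t2 := le_trans t2 (CN n Nn).
by move: t1 t2 t3; rewrite !expect_cst; exact: norm_triangle_quarter.
Qed.

End central_limit.

Section perturbation.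
Context (R : realType) (M : pointedMetricType R) (P : probability (borel M) R).
Context d (Omega : measurableType d) (Pr : probability Omega R) (X : nat -> Omega -> M).
Hypothesis hX : iid_sample Pr P (X : nat -> Omega -> borel M).
Context (h : M -> M -> R) (lam : nat -> R) (phi : nat -> M -> R).
Hypothesis h_sym : forall x y, h x y = h y x.
Hypothesis bh : @bker _ (borel M) R h.
Hypothesis hphi : kernel_eigensystem P h lam phi.
Hypothesis bphi : forall k, 0 < lam k -> bmeas (phi k : borel M -> R).
Context (J : {fset nat}).
Hypothesis J_gt0 : forall k, k \in J -> 0 < lam k.
Local Notation xs w := (fun i => X i w).
Local Notation res n w k := (gram_residual h (lam k) (phi k) n (xs w)).

(** The statistic is a normalized sum of values of this function, up to a
    remainder that tends to 0. *)
Definition influence (x : M) : R := \sum_(k <- J) phi k x ^+ 2 - #|` J|%:R.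

Lemma bmeas_sum_sqr : bmeas (fun x : borel M => \sum_(k <- J) phi k x ^+ 2).
Proof.
rewrite (_ : (fun x => _) = fun x : borel M => \sum_(k <- J | k \in J) phi k x ^+ 2).
  by apply: bmeas_sum => k kJ; apply: bmeasX; apply: bphi; exact: J_gt0.
by apply/funext => x; rewrite big_seq.
Qed.

Lemma expect_sum_sqr : \int[P]_x (\sum_(k <- J) phi k x ^+ 2) = #|` J|%:R.
Proof.
transitivity (\int[P]_x (\sum_(k <- J | k \in J) phi k x ^+ 2)).
  by apply: eq_Rintegral => x _; rewrite big_seq.
rewrite expect_sum; last by move=> k kJ; apply: bmeasX; apply: bphi; exact: J_gt0.
rewrite -big_seq (eq_big_seq (fun _ => 1)) ?big_const_seq ?iter_addr_0 ?count_predT//.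
move=> k /J_gt0 lk; have := eigenfun_orthonormal hphi lk lk.
rewrite eqxx => H; transitivity (\int[P]_x (phi k x * phi k x)); last exact: H.
by apply: eq_Rintegral => x _; rewrite expr2.
Qed.

Lemma bmeas_influence : bmeas (influence : borel M -> R).
Proof. by apply: bmeasB; [exact: bmeas_sum_sqr|exact: bmeas_cst]. Qed.

Lemma expect_influence : \int[P]_x influence x = 0.
Proof.
rewrite /influence expectB ?expect_cst ?expect_sum_sqr ?subrr//.
  exact: bmeas_sum_sqr.
exact: bmeas_cst.
Qed.

Lemma expect_influence_sqr : \int[P]_x influence x ^+ 2 =
  \int[P]_x ((\sum_(k <- J) phi k x ^+ 2) * (\sum_(k <- J) phi k x ^+ 2)) -
  (\int[P]_x (\sum_(k <- J) phi k x ^+ 2)) * (\int[P]_x (\sum_(k <- J) phi k x ^+ 2)).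
Proof.
have bs := bmeas_sum_sqr; rewrite expect_sum_sqr; set c : R := #|` J|%:R.
pose F (x : borel M) := \sum_(k <- J) phi k x ^+ 2.
have -> : \int[P]_x influence x ^+ 2 = \int[P]_x (F x * F x - (c * F x + c * influence x)).
  apply: eq_Rintegral => x _; rewrite /influence -/(F x) -/c; ring.
have bi := bmeas_influence.
have b1 : bmeas (fun x => c * F x) by apply: bmeasM => //; exact: bmeas_cst.
have b2 : bmeas (fun x : borel M => c * influence x) by apply: bmeasM => //; exact: bmeas_cst.
rewrite expectB; [|exact: bmeasM|exact: bmeasD].
by rewrite expectD// !expectZ// expect_influence expect_sum_sqr mulr0 addr0.
Qed.

(** Parseval for the f_l in the eigenbasis: the components along v_k with k in J make up
    the statistic, all of them together make up the squared norm. *)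
Lemma stat_expand n (w : Omega) (v : 'I_n -> 'cV[R]_n) : (0 < n)%N ->
  (forall k l, emp_inner (v k) (v l) = (k == l)%:R) ->
  (Num.sqrt n%:R)^-1 * \sum_(i < n) influence (X i w) - eigenspace_stat J phi (xs w) v =
  Num.sqrt n%:R * \sum_(l <- J) \sum_(k < n | (k : nat) \notin J)
    emp_inner (v k) (sample_vec n (xs w) (phi l)) ^+ 2.
Proof.
move=> n0 ov; have nR : 0 < n%:R :> R by rewrite ltr0n.
have sn0 : Num.sqrt n%:R != 0 :> R by rewrite gt_eqF// sqrtr_gt0.
have -> : (Num.sqrt n%:R)^-1 * \sum_(i < n) influence (X i w) =
    Num.sqrt n%:R * (\sum_(l <- J) emp_inner (sample_vec n (xs w) (phi l))
      (sample_vec n (xs w) (phi l)) - #|` J|%:R).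
  have -> : (Num.sqrt n%:R)^-1 = Num.sqrt n%:R * n%:R^-1 :> R.
    by rewrite -[X in _ / X]sqr_sqrtr ?(ltW nR)// expr2 invfM mulrA mulfV// mul1r.
  rewrite -mulrA; congr (_ * _); rewrite sumrB sumr_const card_ord mulrBr.
  rewrite -[#|` J|%:R *+ n]mulr_natl mulKf ?gt_eqF//; congr (_ - _).
  rewrite exchange_big mulr_sumr; apply: eq_bigr => l _; rewrite emp_inner_sample.
  by congr (_ * _); apply: eq_bigr => i _; rewrite expr2.
rewrite /eigenspace_stat -mulrBr; congr (_ * _).
rewrite opprB addrA subrK exchange_big -sumrB; apply: eq_bigr => l _.
by rewrite (eigenbasis_parseval ov) (bigID (fun k : 'I_n => (k : nat) \in J))/= addrAC subrr add0r.
Qed.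

Lemma residual_sum_moment (s : seq nat) : (forall k, k \in s -> 0 < lam k) ->
  (forall n, bmeas (fun w => \sum_(k <- s) emp_inner (res n w k) (res n w k))) /\
  exists C, forall n, (0 < n)%N ->
    \int[Pr]_w (\sum_(k <- s) emp_inner (res n w k) (res n w k)) <= C / n%:R.
Proof.
elim: s => [_|k s IH ls].
  split=> [n|]; last exists 0 => n _.
    by rewrite (_ : (fun w => _) = fun=> 0); [exact: bmeas_cst|apply/funext => w; rewrite big_nil].
  by under eq_Rintegral do rewrite big_nil; rewrite expect_cst mul0r.
have lk : 0 < lam k by apply: ls; rewrite mem_head.
have [|bs [C EC]] := IH; first by move=> j js; apply: ls; rewrite inE js orbT.
have [D ED] := gram_residual_moment hX bh (bphi lk) (eigenfun_eq hphi k).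
have bk n := residual_emp_inner_bmeas hX bh bphi n lk.
have E n : (fun w => \sum_(j <- k :: s) emp_inner (res n w j) (res n w j)) =
    fun w => emp_inner (res n w k) (res n w k) + \sum_(j <- s) emp_inner (res n w j) (res n w j).
  by apply/funext => w; rewrite big_cons.
split=> [n|]; first by rewrite E; exact: bmeasD.
exists (D + C) => n n0; rewrite E expectD// mulrDl lerD//; [exact: ED|exact: EC].
Qed.

End perturbation.

Unset Implicit Arguments.
Set Strict Implicit.

Theorem corollary4p11 (R : realType)
  (M : pointedMetricType R) (hM : compact [set: M])
  (P : probability (borel M) R)
  (d : measure_display) (Omega : measurableType d) (Pr : probability Omega R)
  (X : nat -> Omega -> M)
  (hX : iid_sample Pr P (X : nat -> Omega -> borel M))
  (h : M -> M -> R)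
  (h_sym : forall x y, h x y = h y x)
  (h_cont : continuous (fun z : M * M => h z.1 z.2))
  (h_psd : psd_kernel h)
  (lam : nat -> R) (phi : nat -> M -> R)
  (hphi : kernel_eigensystem P h lam phi)
  (lamhat : forall n : nat, Omega -> 'I_n -> R)
  (phihat : forall n : nat, Omega -> 'I_n -> 'cV[R]_n)
  (hhat : forall (n : nat) (w : Omega),
     gram_eigensystem h (fun i => X i w) (lamhat n w) (phihat n w))
  (J : {fset nat}) (J_neq0 : J != fset0)
  (gamma_gt0 : 0 < gamma_gap lam J)
  (gamma_le_theta : gamma_gap lam J <= theta_min lam J)
  (stat_meas : forall n : nat, (forall k, k \in J -> (k < n)%N) ->
     measurable_fun [set: Omega]
       (fun w => eigenspace_stat J phi (fun i => X i w) (phihat n w)))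
  (d' : measure_display) (Omega' : measurableType d')
  (Pr' : probability Omega' R) (G : (M -> R) -> Omega' -> R)
  (hG : brownian_bridge P Pr' G) :
  weakly_converges Pr
    (fun n w => eigenspace_stat J phi (fun i => X i w) (phihat n w))
    Pr' (G (fun x => \sum_(k <- J) phi k x ^+ 2)).
Proof.
have bh := continuous_kernel_bmeas hM h_cont.
have bphi k : 0 < lam k -> bmeas (phi k : borel M -> R).
  by move=> lk; apply: (continuous_bmeas hM); exact: (eigenfun_continuous hphi).
set g := gamma_gap lam J in gamma_gt0 gamma_le_theta.
have gapJ k l : k \in J -> l \notin J -> g <= `|lam k - lam l|.
  move=> kJ lJ; apply: ge_inf; last by exists k, l.
  by exists 0 => _ [i [j [_ _ ->]]]; exact: normr_ge0.
have posJ k : k \in J -> g <= lam k.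
  move=> kJ; apply: (le_trans gamma_le_theta); apply: ge_inf; last by exists k.
  by exists 0 => _ [i _ <-]; exact: (eigenval_ge0 hphi).
have J_gt0 k : k \in J -> 0 < lam k by move=> /posJ; exact: lt_le_trans.
pose S n w := (Num.sqrt n%:R)^-1 * \sum_(i < n) influence phi J (X i w).
pose T n w := eigenspace_stat J phi (fun i => X i w) (phihat n w).
have bpsi := bmeas_influence bphi J_gt0.
pose K := (\max_(j <- J) j).+1.
have mT n : (K <= n)%N -> measurable_fun setT (T n).
  move=> Kn; apply: stat_meas => k kJ; apply: leq_trans Kn.
  by rewrite ltnS; exact: leq_bigmax_seq.
pose F (x : M) := \sum_(k <- J) phi k x ^+ 2.
have F2 : in_L2 P F by apply: bmeas_in_L2; exact: (bmeas_sum_sqr bphi J_gt0).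
have gZ : gaussian_rv Pr' (G F).
  have := bridge_gaussian hG (f := fun _ : 'I_1 => F) (fun=> 1) (fun=> F2).
  by under eq_fun do rewrite big_ord1 mul1r.
have cZ : covariance Pr' (G F) (G F) = (\int[P]_x influence phi J x ^+ 2)%:E.
  by rewrite (bridge_cov hG F2 F2) (expect_influence_sqr hphi bphi J_gt0).
apply: weakly_converges_lipschitz; first exact: gZ.1.
  by exists K.
move=> f B L fB fL e e0.
have [N1 CLT] := lipschitz_clt hX bpsi (expect_influence hphi bphi J_gt0) gZ
  (bridge_centered hG F2) cZ fB fL (divr_gt0 e0 (ltr0n R 2)).
have bf := continuous_bounded_bmeas (lipschitz_with_continuous fL) fB.
have L0 : 0 <= L by have := fL 0 1; rewrite sub0r normrN normr1 mulr1; exact: le_trans.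
have B0 : 0 <= B := le_trans (normr_ge0 _) (fB 0).
have eta0 : 0 < e / (8 * (B + 1)) by rewrite divr_gt0// mulr_gt0// ltr_wpDl.
have [V [N2 [bV V0 EV VE]]] := gap_likely hX h_sym bh hphi bphi gamma_gt0
  (fun k l kJ lJ => gapJ k l kJ lJ) eta0.
have [bQ [C EQ]] := residual_sum_moment hX bh hphi bphi (fun k => J_gt0 k).
pose D := ((g / 2) ^+ 2)^-1.
have D0 : 0 <= D by rewrite invr_ge0 exprn_ge0// divr_ge0// ltW.
have [N3 N3_0 CN] := div_sqrt_le (L * D * C) (divr_gt0 e0 (ltr0n R 4)).
exists (maxn (maxn K N1) (maxn N2 N3)) => n; rewrite !geq_max.
move=> /andP[/andP[Kn N1n] /andP[N2n N3n]]; have n0 := leq_trans N3_0 N3n.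
have nR : 0 < n%:R :> R by rewrite ltr0n.
pose Q w := \sum_(k <- J) emp_inner (gram_residual h (lam k) (phi k) n (fun i => X i w))
   (gram_residual h (lam k) (phi k) n (fun i => X i w)).
have Q0 w : 0 <= Q w by apply: sumr_ge0 => k _; exact: emp_inner_ge0.
have bS : bmeas (S n) by exact: (bmeas_sample_sum hX).
(* On the event of separated eigenvalues the remainder is controlled by the residuals;
   elsewhere V is at least 1 and 2 B is a trivial bound. *)
have TS w : `|f (T n w) - f (S n w)| <= L * D * Num.sqrt n%:R * Q w + 2 * B * V n w.
  have [V1|V1] := ltP (V n w) 1; last first.
    apply: (@le_trans _ _ (2 * B * V n w)); last by rewrite lerDr !mulr_ge0 ?sqrtr_ge0.
    rewrite (le_trans (ler_normB _ _))// (le_trans (lerD (fB _) (fB _)))//.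
    have -> : B + B = 2 * B by rewrite mulr_natl mulr2n.
    by rewrite ler_peMr// mulr_ge0.
  apply: (@le_trans _ _ (L * D * Num.sqrt n%:R * Q w)); last by rewrite lerDl !mulr_ge0.
  rewrite (le_trans (fL _ _))// -!mulrA ler_wpM2l// distrC.
  have [Hv lni ov] := hhat n w.
  rewrite stat_expand// ger0_norm; last first.
    by rewrite mulr_ge0 ?sqrtr_ge0//; do 2 (apply: sumr_ge0 => ? _); exact: sqr_ge0.
  rewrite mulrCA ler_wpM2l ?sqrtr_ge0// mulr_sumr big_seq [leRHS]big_seq; apply: ler_sum => l lJ.
  have g2 : 0 < g / 2 by rewrite divr_gt0.
  apply: (residual_bound (gram_sym n _ h_sym) Hv ov _ g2) => k kJ.
  exact: (VE n w N2n V1 _ _ (hhat n w) k l kJ lJ).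
have bR : bmeas (fun w => L * D * Num.sqrt n%:R * Q w + 2 * B * V n w).
  by apply: bmeasD; apply: bmeasM; [exact: bmeas_cst|exact: bQ|exact: bmeas_cst|exact: bV].
have E1 : `|\int[Pr]_w f (T n w) - \int[Pr]_w f (S n w)| <= e / 2.
  apply: le_trans (norm_expectB_le Pr (bmeas_comp bf (mT n Kn)) (bmeas_comp bf bS.1) bR TS) _.
  rewrite expectD; [|apply: bmeasM; [exact: bmeas_cst|exact: bQ]|
    apply: bmeasM; [exact: bmeas_cst|exact: bV]].
  have -> : e / 2 = e / 4 + e / 4 by field.
  rewrite (expectZ Pr (L * D * Num.sqrt n%:R) (bQ n)) (expectZ Pr (2 * B) (bV n)) lerD//.
    apply: le_trans (CN n N3n).
    apply: (@le_trans _ _ (L * D * Num.sqrt n%:R * (C / n%:R))).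
      by rewrite ler_wpM2l ?EQ// !mulr_ge0 ?sqrtr_ge0.
    have -> : C / n%:R = C / Num.sqrt n%:R / Num.sqrt n%:R.
      by rewrite -mulrA -invfM -expr2 sqr_sqrtr// ltW.
    by rewrite -[X in X <= _]mulrA [_ * (_ / _ / _)]mulrC divfK ?mulrA// gt_eqF// sqrtr_gt0.
  by apply: le_trans (shrink_factor_le B0 (ltW e0)); rewrite ler_wpM2l ?EV// mulr_ge0.
rewrite (splitr e); have := lerD E1 (CLT n N1n); apply: le_trans.
exact: ler_distD.
Qed.
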